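(* Feedback Vertex Set (given a graph $G$ on $n$ vertices and $k\in\mathbb{N}$, decide whether there is $S\subseteq V(G)$ with $|S|\le k$ such that $G-S$ is a forest) can be solved using $O(k\log n)$ bits of auxiliary space and in time $5^k\cdot n^{O(1)}$.
   Context: Space model: the input is in read-only random-access memory, output is written to a write-only stream, and only auxiliary read-write memory is counted; words have $O(\log n)$ bits. *)

(* Defs.v *)
From mathcomp Require Import all_boot.
Set Implicit Arguments.
Unset Strict Implicit.
Unset Printing Implicit Defensive.

Inductive binop := Add | Sub | Mul | Div | Mod | Eq | Lt.

(* [Sub] truncates at 0 and division by 0 gives quotient 0, as in ssrnat/div. *)
Definition binop_val (o : binop) (x y : nat) : nat :=
  match o with
  | Add => x + y
  | Sub => x - y
  | Mul => x * y
  | Div => x %/ y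
  | Mod => x %% y
  | Eq => x == y
  | Lt => x < y
  end.

(* Below, M is the auxiliary memory, and i, j, l are fixed addresses in it.
   There are no further registers: all read-write storage is in M. *)
Inductive cmd :=
  | Skip
  | Const (i v : nat)               (* M[i] := v *)
  | Bin (o : binop) (i j l : nat)   (* M[i] := M[j] o M[l] *)
  | LoadInd (i j : nat)             (* M[i] := M[M[j]] *)
  | StoreInd (i j : nat)            (* M[M[i]] := M[j] *)
  | Read (i j : nat)                (* M[i] := input[M[j]] *)
  | Write (i : nat)                 (* append M[i] to the output *)
  | Seq (c1 c2 : cmd)
  | If (i : nat) (c1 c2 : cmd)      (* M[i] <> 0 is true *)
  | While (i : nat) (c : cmd).

Definition mem := nat -> nat.

Definition upd (m : mem) (i v : nat) : mem :=
  fun j => if j == i then v else m j.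

(* [exec w s inp c m m' out t]: on a machine with w-bit words and s words of
   auxiliary memory, with read-only input inp, the command c started in memory
   m halts after t steps in memory m', having written the stream out.  Every
   stored value is reduced modulo 2 ^ w.  No rule applies to an access to an
   address >= s, so that a derivation exists only if c halts within s words.
   Input cells past the end of inp read as 0. *)
Inductive exec (w s : nat) (inp : seq nat) :
    cmd -> mem -> mem -> seq nat -> nat -> Prop :=
  | ExecSkip m :
      exec w s inp Skip m m [::] 1
  | ExecConst i v m :
      i < s ->
      exec w s inp (Const i v) m (upd m i (v %% 2 ^ w)) [::] 1
  | ExecBin o i j l m :
      i < s -> j < s -> l < s ->
      exec w s inp (Bin o i j l) m
        (upd m i (binop_val o (m j) (m l) %% 2 ^ w)) [::] 1
  | ExecLoadInd i j m :
      i < s -> j < s -> m j < s ->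
      exec w s inp (LoadInd i j) m (upd m i (m (m j))) [::] 1
  | ExecStoreInd i j m :
      i < s -> j < s -> m i < s ->
      exec w s inp (StoreInd i j) m (upd m (m i) (m j)) [::] 1
  | ExecRead i j m :
      i < s -> j < s ->
      exec w s inp (Read i j) m (upd m i (nth 0 inp (m j) %% 2 ^ w)) [::] 1
  | ExecWrite i m :
      i < s ->
      exec w s inp (Write i) m m [:: m i] 1
  | ExecSeq c1 c2 m m1 m2 out1 out2 t1 t2 :
      exec w s inp c1 m m1 out1 t1 ->
      exec w s inp c2 m1 m2 out2 t2 ->
      exec w s inp (Seq c1 c2) m m2 (out1 ++ out2) (t1 + t2)
  | ExecIf i c1 c2 m m' out t :
      i < s ->
      exec w s inp (if m i != 0 then c1 else c2) m m' out t ->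
      exec w s inp (If i c1 c2) m m' out t.+1
  | ExecWhileStop i c m :
      i < s -> m i = 0 ->
      exec w s inp (While i c) m m [::] 1
  | ExecWhileLoop i c m m1 m2 out1 out2 t1 t2 :
      i < s -> m i != 0 ->
      exec w s inp c m m1 out1 t1 ->
      exec w s inp (While i c) m1 m2 out2 t2 ->
      exec w s inp (While i c) m m2 (out1 ++ out2) (t1 + t2).+1.

(* The auxiliary memory is initially all zero. *)
Definition runs (w s : nat) (c : cmd) (inp out : seq nat) (t : nat) : Prop :=
  exists m' : mem, exec w s inp c (fun=> 0) m' out t.

(* A simple graph is a symmetric irreflexive relation; its cycles are the
   duplicate-free cyclic sequences of at least three vertices. *)
Definition forest (T : eqType) (e : rel T) : Prop :=
  ~ exists c : seq T, ucycle e c /\ 3 <= size c.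

(* G - S, on the vertex type {v | v \notin S}. *)
Definition del_vertices (T : finType) (e : rel T) (S : {set T}) :
    rel {v : T | v \notin S} :=
  fun u v => e (val u) (val v).

Definition feedback_vertex_set (T : finType) (e : rel T) (k : nat) : Prop :=
  exists S : {set T}, #|S| <= k /\ forest (@del_vertices T e S).

(* Binary digits of k, least significant first, without leading zeros. *)
Definition digits (k : nat) : seq nat :=
  mkseq (fun i => k %/ 2 ^ i %% 2) (up_log 2 k.+1).

(* The number n of vertices, the n * n adjacency matrix in row-major order,
   then k in binary, closed by the end marker 2.  The parameter k is not given
   as one word because it is unbounded while words have O(log n) bits. *)
Definition encode (n : nat) (e : rel 'I_n) (k : nat) : seq nat :=
  n :: [seq nat_of_bool (e u v) | u <- enum 'I_n, v <- enum 'I_n]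
    ++ rcons (digits k) 2.

(* log n, kept positive for n < 2. *)
Definition log2 (n : nat) : nat := trunc_log 2 (maxn 2 n).

(* Main.v *)
Require Import Defs.
From mathcomp Require Import all_boot zify.
Set Implicit Arguments.
Unset Strict Implicit.
Unset Printing Implicit Defensive.

(** Iterative compression: the vertices are added one by one, and [W] consists of
    a solution for the previous graph and the new vertex, so that [F = V \ W]
    induces a forest and [#|W| <= k + 1].  The vertices of [F] are processed in an
    order in which each of them has at most one unprocessed neighbour.  When [v] is
    reached, let [Z] be the set of kept vertices of [W] and of kept processed
    vertices.  If at most one neighbour of [v] lies in a component of [G[Z]] that
    meets [W], then [v] is kept: a solution containing [v] can be modified to
    contain its unprocessed neighbour instead.  Otherwise one guesses whether [v]
    is deleted; a deletion uses up one unit of the budget, and keeping [v] merges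
    two components that meet [W].  Hence a solution that deletes [z] vertices of
    [W] is found with fewer than [2 (k + 1 - z)] guessed bits.  One digit in
    [{0 .. 4}] for each vertex of [W] therefore suffices: 0 deletes the vertex, and
    the four other values keep it and supply two bits.  This gives [5 ^ (k + 1)]
    strings of digits, and each is tried in polynomial time.

    Connectivity in a forest needs no marks: the walk that leaves each vertex
    through the cyclic successor of the edge by which it came traverses a whole
    component.  The order on [F] is the reverse of the order of first visits of
    such walks.  So only [W], the digits, the bits and the deleted vertices are
    stored, that is, [O(k)] words. *)

(** * Induced forests *)

(** The base 5 is 1 + 4: summing $\binom{k+1}{z} 4^{k+1-z}$ over the number z of deleted vertices of
    W gives $5^{k+1}$. Two potentials pay for the bits: guessed deletions consume the at most k - z
    remaining units, and each guessed keep lowers the number of components of G[Z] that meet W,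
    which is at most k + 1 - z at the start. Reversed first visits give a suitable order because a
    tour grows its tree connectedly: within one tree of F the visited vertices stay connected, so a
    newly visited vertex has at most one neighbour visited before it, and that is its only
    unprocessed neighbour when time runs backwards. The obstacle is that neither visited marks nor
    component labels fit into O(k) words. Such questions are answered by replaying walks from their
    roots; the nesting depth is fixed, so the time stays polynomial. A walk is sure to cover its
    component only in an acyclic set. Wrong guesses may make G[Z] cyclic and the simulation
    meaningless, but it still halts within its bounds, and [check] validates the outcome
    independently. *)

Section Induced.
Variables (T : finType) (e : rel T).
Hypothesis e_sym : symmetric e.
Implicit Types (W Z A B : {set T}) (c p : seq T).

Definition induced Z : rel T := fun x y => [&& e x y, x \in Z & y \in Z].
Definition conn Z : rel T := connect (induced Z).
(** Membership in [Z] replaces the subtype in [forest], so that vertex sets can vary without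
    transport; [forestP] links the two. *)
Definition acyclic Z : Prop :=
  forall c, ucycle e c -> 2 < size c -> ~~ all (mem Z) c.

Lemma conn_sym Z : symmetric (conn Z).
Proof.
by apply: sym_connect_sym => x y; rewrite /induced e_sym; congr andb; rewrite andbC.
Qed.

Lemma conn_refl Z x : conn Z x x. Proof. exact: connect0. Qed.

Lemma conn_trans Z x y z : conn Z x y -> conn Z y z -> conn Z x z.
Proof. exact: connect_trans. Qed.

Lemma conn_sub A B x y : A \subset B -> conn A x y -> conn B x y.
Proof.
move=> /subsetP sAB; apply: connect_sub => u v /and3P[euv uA vA].
by apply: connect1; rewrite /induced euv !sAB.
Qed.

Lemma conn_edge Z x y : e x y -> x \in Z -> y \in Z -> conn Z x y.
Proof. by move=> exy xZ yZ; apply: connect1; rewrite /induced exy xZ. Qed.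

Lemma conn_closed Z (P : pred T) x y :
  (forall u v, P u -> u \in Z -> v \in Z -> e u v -> P v) ->
  P x -> conn Z x y -> P y.
Proof.
move=> clP Px /connectP[p]; elim: p x Px => [|u p IHp] x Px /=.
  by move=> _ ->.
by move=> /andP[/and3P[exu xZ uZ] pth] yE; apply: (IHp u) => //; apply: (clP x).
Qed.

Lemma conn_mem Z x y : x \in Z -> conn Z x y -> y \in Z.
Proof. by move=> xZ; apply: (conn_closed (P := [in Z])). Qed.

Lemma induced_path_sub Z x p : path (induced Z) x p -> path e x p.
Proof. by apply: sub_path => u v /and3P[]. Qed.

Lemma induced_path_all Z x p : path (induced Z) x p -> all (mem Z) p.
Proof.
elim: p x => //= u p IHp x /andP[/and3P[_ _ uZ] /IHp pZ].
by rewrite uZ.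
Qed.

Lemma conn_upath Z x y : x \in Z -> conn Z x y ->
  exists p, [/\ path e x p, last x p = y, uniq (x :: p) & all (mem Z) (x :: p)].
Proof.
move=> xZ /connectP[p0 pth0 ->].
case/shortenP: pth0 => p pth up _; exists p; split=> //.
- exact: induced_path_sub pth.
- by rewrite /= xZ; apply: induced_path_all pth.
Qed.

Lemma acyclic_sub A B : A \subset B -> acyclic B -> acyclic A.
Proof.
move=> /subsetP sAB acB c uc sc; apply: contra (acB c uc sc) => /allP cA.
by apply/allP => x /cA; apply: sAB.
Qed.

(** Otherwise a path from a to a' in A, the edge to b', a path from b' to b in B and the edge back
    to a form a cycle in Z. *)
Lemma acyclic_no_double_link Z A B a a' b b' :
  acyclic Z -> A \subset Z -> B \subset Z -> [disjoint A & B] ->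
  a \in A -> b \in B -> conn A a a' -> conn B b b' ->
  e a b -> e a' b' -> (a == a') && (b == b').
Proof.
move=> acZ sAZ sBZ dAB aA bB caa' cbb' eab eab'.
have b'B := conn_mem bB cbb'.
have [p [pthp lp up Ap]] := conn_upath aA caa'.
move: cbb'; rewrite conn_sym => cbb'.
have [q [pthq lq uq Bq]] := conn_upath b'B cbb'.
(* With at most two vertices in all, both paths are trivial, which gives the two equalities. *)
have [sz|] := ltnP 2 (size ((a :: p) ++ (b' :: q))); last first.
  case: p lp {pthp up Ap} => [|x p] /= lp; last by rewrite size_cat /= addnS.
  case: q lq {pthq uq Bq} => [|x q] //= lq.
  by rewrite lp lq !eqxx.
have := acZ _ _ sz; rewrite all_cat.
rewrite (sub_all (a2 := mem Z) _ Ap); last by move=> x; apply: (subsetP sAZ).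
rewrite (sub_all (a2 := mem Z) _ Bq); last by move=> x; apply: (subsetP sBZ).
suff uc : ucycle e ((a :: p) ++ b' :: q) by move/(_ uc).
rewrite /ucycle; apply/andP; split.
  rewrite cat_cons /= rcons_cat cat_path pthp lp /= eab' rcons_path pthq lq.
  by rewrite e_sym.
rewrite cat_uniq up uq andbT andTb; apply/hasPn => x xq.
apply/negP => xp; move/allP: Ap => /(_ _ xp) /= xA.
have xB : x \in B by move/allP: Bq => /(_ _ xq).
by move: dAB => /pred0P/(_ x) /=; rewrite xA xB.
Qed.

(** A cycle through v enters and leaves v by neighbours joined by a path in Z. The hypothesis makes
    them equal, which a cycle on at least three vertices forbids. *)
Lemma acyclic_add Z v : v \notin Z -> acyclic Z ->
  (forall u u', u \in Z -> u' \in Z -> e v u -> e v u' -> conn Z u u' -> u = u') ->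
  acyclic (v |: Z).
Proof.
move=> vZ acZ nc c uc sc; apply/negP => cvZ.
have [vc|vc] := boolP (v \in c); last first.
  move/negP: (acZ c uc sc); apply; apply/allP => x xc.
  move/allP: cvZ => /(_ x xc) /=; rewrite in_setU1; case/orP => // /eqP xv.
  by move: vc; rewrite -xv xc.
have [i p rc] := rot_to vc.
have cvp : cycle e (v :: p) by rewrite -rc rot_cycle; case/andP: uc.
have uvp : uniq (v :: p) by rewrite -rc rot_uniq; case/andP: uc.
have avp : all (mem (v |: Z)) (v :: p)
  by rewrite -rc (perm_all _ (permEl (perm_rot i c))).
have svp : 2 < size (v :: p) by rewrite -rc size_rot.
case: p {rc} cvp uvp avp svp => // u p cvp uvp avp svp.
move: cvp; rewrite /= rcons_path => /and3P[evu pth elv].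
have pZ : {subset u :: p <= Z}.
  move=> x xp; move/allP: avp => /(_ x); rewrite inE xp orbT => /(_ isT) /=.
  rewrite in_setU1; case/orP => // /eqP xv; move: uvp; rewrite /= -xv.
  by move: xp; rewrite inE => ->.
have cul : conn Z u (last u p).
  apply/connectP; exists p => //.
  elim: p u pth pZ {avp uvp svp evu elv} => //= y p IHp u /andP[euy pth] pZ.
  rewrite /induced euy !pZ ?inE ?eqxx ?orbT //=; apply: IHp => // x xp.
  by apply: pZ; rewrite inE xp orbT.
have := nc u (last u p); rewrite e_sym in elv.
rewrite !pZ ?mem_head ?mem_last // => /(_ isT isT evu elv cul) ul.
case: p ul uvp svp {avp pth pZ elv cul} => // y p /= ul.
by rewrite ul mem_last /= andbF.
Qed.

(** Converse of [acyclic_add]: two edges at v would doubly link [Z] and [[set v]]. *)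
Lemma acyclic_nbrs Z v u u' : v \notin Z -> acyclic (v |: Z) ->
  u \in Z -> u' \in Z -> e v u -> e v u' -> conn Z u u' -> u = u'.
Proof.
move=> vZ acZ uZ u'Z evu evu' cuu'; apply/eqP.
have /andP[//] : (u == u') && (v == v).
apply: (acyclic_no_double_link acZ (A := Z) (B := [set v])) => //.
- exact: subsetUr.
- exact: subsetUl.
- by rewrite disjoint_sym disjoints1.
- by rewrite inE.
- exact: conn_refl.
- by rewrite e_sym.
- by rewrite e_sym.
Qed.

Lemma acyclic0 : acyclic set0.
Proof. by move=> [|x c] // _ _; rewrite /= inE. Qed.

Lemma forestP (S : {set T}) : forest (@del_vertices T e S) <-> acyclic (~: S).
Proof.
split=> [fS c /andP[cc uc] sc|acS [c [/andP[cc uc] sc]]].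
  apply/negP => cS; apply: fS.
  have [c' c'E] : exists c' : seq {v | v \notin S}, map val c' = c.
    elim: c cS {cc uc sc} => [|x c IHc] /=; first by exists [::].
    move=> /andP[xS /IHc[c' <-]]; rewrite inE in xS.
    by exists (exist _ x xS :: c').
  exists c'; rewrite -c'E size_map in sc uc cc *; split=> //.
  rewrite /ucycle; apply/andP; split; last by rewrite map_inj_uniq in uc => //; apply: val_inj.
  by rewrite -cycle_map.
have := acS (map val c); rewrite size_map => /(_ _ sc).
suff -> : all (mem (~: S)) (map val c).
  move=> H; have : ~~ true; last by []. apply: H.
  by rewrite /ucycle; apply/andP; split; rewrite ?cycle_map ?map_inj_uniq //; apply: val_inj.
by apply/allP => _ /mapP[x _ ->]; rewrite !inE; apply: (valP x).
Qed.

(** * Components that meet W *)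

Definition component Z x : {set T} := [set y | conn Z x y].
(** The potential for guessed keeps. It is at most the number of kept vertices of W, does not grow
    when a vertex outside W is kept, and drops when that vertex joins two rooted components. *)
Definition ncomp (W Z : {set T}) : nat := #|[set component Z w | w in W :&: Z]|.

Lemma eq_component Z x y : conn Z x y -> component Z x = component Z y.
Proof.
move=> cxy; apply/setP => z; rewrite !inE; apply/idP/idP; last exact: conn_trans.
by apply: conn_trans; rewrite conn_sym.
Qed.

Lemma ncomp_le_card W Z : ncomp W Z <= #|W :&: Z|.
Proof. exact: leq_imset_card. Qed.

(** Sends a component of a subset of [Z'] to the component of [Z'] containing it. Adding a vertex
    outside W acts on the components that meet W by this map. *)
Let lift_component Z' (C : {set T}) : {set T} := [set y | [exists x in C, conn Z' x y]].

Lemma lift_componentE Z Z' x : Z \subset Z' -> lift_component Z' (component Z x) = component Z' x.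
Proof.
move=> sZ; apply/setP => y; rewrite !inE; apply/existsP/idP => [[z]|cxy].
  by rewrite inE => /andP[/(conn_sub sZ)]; apply: conn_trans.
by exists x; rewrite inE conn_refl.
Qed.

Lemma ncomp_addE W Z v : v \notin W ->
  [set component (v |: Z) w | w in W :&: (v |: Z)] =
  lift_component (v |: Z) @: [set component Z w | w in W :&: Z].
Proof.
move=> vW; rewrite -imset_comp.
have -> : W :&: (v |: Z) = W :&: Z.
  apply/setP => x; rewrite !inE; case: eqP => // ->.
  by rewrite (negPf vW).
by apply: eq_imset => w /=; rewrite lift_componentE ?subsetUr.
Qed.

Lemma ncomp_add W Z v : v \notin W -> ncomp W (v |: Z) <= ncomp W Z.
Proof. by move=> vW; rewrite /ncomp ncomp_addE ?leq_imset_card. Qed.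

(** By acyclicity u and u' lie in different components of Z; both meet W and have the same lift, so
    the lifting is not injective. *)
Lemma ncomp_add_lt W Z v u u' w w' : v \notin W -> v \notin Z ->
  acyclic (v |: Z) -> u != u' -> e v u -> e v u' -> u \in Z -> u' \in Z ->
  w \in W -> w' \in W -> conn Z u w -> conn Z u' w' ->
  ncomp W (v |: Z) < ncomp W Z.
Proof.
move=> vW vZ acZ nuu' evu evu' uZ u'Z wW w'W cuw cu'w'.
rewrite ltn_neqAle ncomp_add // andbT /ncomp ncomp_addE //.
apply/negP => /imset_injP inj.
have wZ := conn_mem uZ cuw; have w'Z := conn_mem u'Z cu'w'.
have svZ : Z \subset v |: Z by apply: subsetUr.
have cvu : conn (v |: Z) v u by apply: conn_edge => //; rewrite !inE ?eqxx ?uZ ?orbT.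
have cvu' : conn (v |: Z) v u' by apply: conn_edge => //; rewrite !inE ?eqxx ?u'Z ?orbT.
have : component Z w = component Z w'.
  apply: inj; [by apply: imset_f; rewrite inE wW | by apply: imset_f; rewrite inE w'W |].
  rewrite !lift_componentE //; apply: eq_component.
  apply: (@conn_trans _ _ u); first by rewrite conn_sym (conn_sub svZ).
  apply: (@conn_trans _ _ v); first by rewrite conn_sym.
  by apply: (conn_trans cvu'); apply: conn_sub cu'w'.
move/setP/(_ w'); rewrite !inE conn_refl => cww'.
have cuu' : conn Z u u'.
  by apply: (conn_trans cuw); apply: (conn_trans cww'); rewrite conn_sym.
by move/eqP: nuu'; apply; apply: (acyclic_nbrs vZ acZ).
Qed.

End Induced.

(** * Rotor walks *)

Section RotorWalk.
Variables (n' : nat).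
Local Notation n := n'.+1.
Variable e : rel 'I_n.
Hypothesis e_sym : symmetric e.
Hypothesis e_irr : irreflexive e.
Implicit Types (Z : {set 'I_n}) (p c u y : 'I_n).

(** Cyclic order starting just after p. The last offset n - 1 gives p itself, so a walk turns back
    at a leaf. *)
Definition rotate p q : 'I_n := Ordinal (ltn_pmod (p + q.+1) (ltn0Sn n')).

(** The smallest admissible offset wins, and an isolated c is its own successor. The [foldr] form
    matches a loop that counts offsets down and overwrites its result. *)
Definition nxt Z p c : 'I_n :=
  foldr (fun q acc => if e c (rotate p q) && (rotate p q \in Z) then rotate p q else acc)
    c (iota 0 n).

Definition wstep Z (d : 'I_n * 'I_n) := (d.2, nxt Z d.1 d.2).
Definition walk Z u i : 'I_n := (iter i (wstep Z) (u, u)).2.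

(* Exceeds the number of darts, so that a walk of this length goes through a whole component. *)
Definition tour_len : nat := (n * n).+1.

Lemma foldr_if_find (T : Type) (P : pred nat) (g : nat -> T) d s :
  foldr (fun q acc => if P q then g q else acc) d s =
  if has P s then g (nth 0 s (find P s)) else d.
Proof. by elim: s => //= q s ->; case: (P q). Qed.

Lemma nxtP Z p c :
  (exists q, [/\ q < n, nxt Z p c = rotate p q, e c (rotate p q) /\ rotate p q \in Z &
      forall r, r < q -> ~~ (e c (rotate p r) && (rotate p r \in Z))])
  \/ nxt Z p c = c /\ forall q, q < n -> ~~ (e c (rotate p q) && (rotate p q \in Z)).
Proof.
rewrite /nxt; pose P q := e c (rotate p q) && (rotate p q \in Z).
rewrite (foldr_if_find P); case: ifP => hP; [left|right]; last first.
  split=> // q qn; apply: contraFN hP => Pq; apply/hasP; exists q => //.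
  by rewrite mem_iota.
have fn : find P (iota 0 n) < n by rewrite -[X in _ < X](size_iota 0 n) -has_find.
exists (find P (iota 0 n)); rewrite nth_iota // add0n; split=> //.
  by apply/andP; have := nth_find 0 hP; rewrite nth_iota // add0n.
by move=> r rf; have := before_find 0 rf; rewrite nth_iota ?add0n ?(ltn_trans rf) // => /negbT.
Qed.

Lemma rotate_onto p y : exists2 q, q < n & rotate p q = y.
Proof.
exists ((y + (n - p.+1)) %% n); first exact: ltn_pmod.
apply: val_inj => /=; rewrite -addSnnS modnDmr.
have -> : p.+1 + (y + (n - p.+1)) = y + n by have := ltn_ord p; lia.
by rewrite modnDr modn_small.
Qed.

Lemma rotate_rotate p q r : rotate (rotate p q) r = rotate p (q + r.+1).
Proof. by apply: val_inj => /=; rewrite modnDml; congr (_ %% _); lia. Qed.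

(** Of two rotations ending at the same vertex, the longer one passes the starting point of the
    shorter one. *)
Lemma rotate_eq_lt p p' q q' : rotate p q = rotate p' q' -> q < q' ->
  rotate p' (q' - q.+1) = p.
Proof.
move=> /(congr1 val) /= /eqP E lt; apply: val_inj => /=; apply/eqP.
rewrite -[X in _ == X](modn_small (ltn_ord p)) -(eqn_modDr q.+1) eq_sym.
by have -> : p' + (q' - q.+1).+1 + q.+1 = p' + q'.+1 by lia.
Qed.

Lemma rotate_inj p p' q : rotate p q = rotate p' q -> p = p'.
Proof.
move=> /(congr1 val) /= /eqP; rewrite eqn_modDr !modn_small // => /eqP.
exact: val_inj.
Qed.

Lemma nxt_step Z p c : nxt Z p c = c \/ e c (nxt Z p c) /\ nxt Z p c \in Z.
Proof. by case: (nxtP Z p c) => [[q [_ -> ? _]]|[->]]; [right|left]. Qed.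

Lemma nxt_nbr Z p c y : e c y -> y \in Z -> e c (nxt Z p c) /\ nxt Z p c \in Z.
Proof.
move=> ecy yZ; case: (nxtP Z p c) => [[q [_ -> ? _]]//|[_ no]].
by have [q qn qy] := rotate_onto p y; have := no q qn; rewrite qy ecy yZ.
Qed.

(** If the rotations from p and p' to the common successor had different lengths, the longer one
    would pass the start of the other, a neighbour of c in Z, and would have stopped there. *)
Lemma nxt_inj Z c p p' : e c p -> p \in Z -> e c p' -> p' \in Z ->
  nxt Z p c = nxt Z p' c -> p = p'.
Proof.
move=> ep pZ ep' p'Z.
have [q0 q0n q0E] := rotate_onto p p; have [q1 q1n q1E] := rotate_onto p' p'.
case: (nxtP Z p c) => [[q [qn -> _ qmin]]|[_ no]]; last first.
  by have := no _ q0n; rewrite q0E ep pZ.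
case: (nxtP Z p' c) => [[q' [qn' -> _ qmin']]|[_ no]]; last first.
  by have := no _ q1n; rewrite q1E ep' p'Z.
move=> E; have [lt|lt|eqq] := ltngtP q q'.
- have := rotate_eq_lt E lt; have : q' - q.+1 < q' by lia.
  by move=> /qmin' + pE; rewrite pE ep pZ.
- have := rotate_eq_lt (esym E) lt; have : q - q'.+1 < q by lia.
  by move=> /qmin + pE; rewrite pE ep' p'Z.
- by move: E; rewrite eqq; apply: rotate_inj.
Qed.

(** Induction on the offset of y from p: the successor is y or lies strictly before it, and in the
    latter case the offset decreases. *)
Lemma nxt_transitive Z c (A : pred 'I_n) p y :
  (forall x, A x -> A (nxt Z x c)) -> A p -> e c y -> y \in Z -> A y.
Proof.
move=> clA Ap ecy yZ; have [q qn qy] := rotate_onto p y.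
have [m] := ubnP q; elim: m q p Ap qn qy => // m IHm q p Ap qn qy lqm.
case: (nxtP Z p c) => [[q0 [q0n q0E _ qmin]]|[_ no]]; last first.
  by have := no _ qn; rewrite qy ecy yZ.
have Anx := clA p Ap.
have [lt|lt|eqq] := ltngtP q q0.
- by have := qmin q lt; rewrite qy ecy yZ.
- apply: (IHm (q - q0.+1) (nxt Z p c)); rewrite ?q0E //; try lia.
    by rewrite -q0E.
  by rewrite rotate_rotate; have -> : q0 + (q - q0.+1).+1 = q by lia.
- by rewrite -qy eqq -q0E.
Qed.

Lemma walk0 Z u : walk Z u 0 = u. Proof. by []. Qed.

Lemma walkS Z u i :
  walk Z u i.+1 = walk Z u i \/ e (walk Z u i) (walk Z u i.+1) /\ walk Z u i.+1 \in Z.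
Proof. rewrite /walk iterS /=; exact: nxt_step. Qed.

Lemma walk_mem Z u i : u \in Z -> walk Z u i \in Z.
Proof. by move=> uZ; elim: i => // i IHi; case: (walkS Z u i) => [->|[]]. Qed.

Lemma walk_conn Z u i : u \in Z -> conn e Z u (walk Z u i).
Proof.
move=> uZ; elim: i => [|i IHi]; first exact: conn_refl.
case: (walkS Z u i) => [->//|[exy yZ]]; apply: conn_trans IHi _.
by apply: conn_edge => //; apply: walk_mem.
Qed.

Section Tour.
Variable Z : {set 'I_n}.
Hypothesis acZ : acyclic e Z.

Local Notation dart d := (induced e Z d.1 d.2).
(** Fixing the non-darts makes the step an injection of a finite type into itself, so that its
    orbits are cycles and [fconnect] is symmetric. *)
Let phi (d : 'I_n * 'I_n) := if dart d then wstep Z d else d.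

Lemma phi_dart d : dart d -> dart (phi d).
Proof.
move=> dd; rewrite /phi dd /=; case/and3P: dd => edc pZ cZ.
rewrite e_sym in edc; have [enx nxZ] := nxt_nbr d.1 edc pZ.
by rewrite /induced enx cZ.
Qed.

Lemma phi_inj : injective phi.
Proof.
move=> d d' E; have : dart (phi d) = dart (phi d') by rewrite E.
have phiF a : ~~ dart a -> ~~ dart (phi a) by move=> na; rewrite /phi (negPf na).
have [dd|nd] := boolP (dart d); have [dd'|nd'] := boolP (dart d').
- move: E; rewrite /phi dd dd' /wstep => -[E2 E1] _.
  case: d d' dd dd' E2 E1 => [a b] [a' b'] /= dd dd' E2 E1; subst b'.
  case/and3P: dd => e1 ? ?; case/and3P: dd' => e2 ? ?.
  by congr (_, _); apply: (nxt_inj _ _ _ _ E1) => //; rewrite e_sym.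
- by rewrite (phi_dart dd) (negPf (phiF _ nd')).
- by rewrite (phi_dart dd') (negPf (phiF _ nd)).
- by move: E; rewrite /phi (negPf nd) (negPf nd').
Qed.

Lemma fconnect_dart d d' : dart d -> fconnect phi d d' -> dart d'.
Proof.
move=> dd; case/connectP=> p; elim: p d dd => [|x p IHp] d dd /=; first by move=> _ ->.
by move=> /andP[/eqP E pth]; apply: IHp; rewrite // -E phi_dart.
Qed.

(* The tour leaves the side of [b] only through the edge [ba], and, being a
   cycle of a permutation, it must leave. *)
Lemma fconnect_reverse a b : dart (a, b) -> fconnect phi (a, b) (b, a).
Proof.
move=> dab; have /and3P[/= eab aZ bZ] := dab.
apply: contraT => nfc.
pose B := Z :\ a.
have aB : a \notin B by rewrite !inE eqxx.
have aBZ : a |: B = Z by rewrite setD1K.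
have bB : b \in B by rewrite !inE bZ andbT; apply: contraTneq eab => ->; rewrite e_irr.
(* As long as (b, a) is not met, heads of darts stay in the component of b in [B]: by acyclicity b
   is the only vertex of that component adjacent to a. *)
have inv d : fconnect phi (a, b) d -> conn e B b d.2.
  case/connectP=> p; elim/last_ind: p d => [|p x IHp] d /=.
    by move=> _ -> /=; apply: conn_refl.
  rewrite rcons_path last_rcons => /andP[pth /eqP E] ->.
  set y := last _ _ in E *; have cby := IHp y pth erefl.
  have fy : fconnect phi (a, b) y by apply/connectP; exists p.
  have dy := fconnect_dart dab fy.
  have fx : fconnect phi (a, b) x by rewrite -E; apply: connect_trans fy (fconnect1 _ _).
  move: (fconnect_dart dab fx) => /and3P[ex x1Z x2Z].
  have x1E : x.1 = y.2 by rewrite -E /phi dy.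
  have yB : y.2 \in B by apply: conn_mem cby.
  have [xa|xa] := eqVneq x.2 a; last first.
    apply: conn_trans cby _; rewrite -x1E; apply: conn_edge => //; first by rewrite x1E.
    by rewrite !inE xa x2Z.
  have yb : b = y.2.
    apply: (acyclic_nbrs e_sym aB _ bB yB eab _ cby); first by rewrite aBZ.
    by rewrite e_sym -x1E -xa.
  have xE : x = (b, a) by rewrite [x]surjective_pairing xa x1E -yb.
  by move: nfc; rewrite -xE fx.
(* The predecessor of (a, b) on its cycle has head a, which is outside [B]. *)
have fpre : fconnect phi (a, b) (finv phi (a, b)).
  rewrite (fconnect_sym phi_inj) -{2}(f_finv phi_inj (a, b)).
  exact: fconnect1.
have fin := inv _ fpre; have dpre := fconnect_dart dab fpre.
have : phi (finv phi (a, b)) = (a, b) by apply: f_finv phi_inj _.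
rewrite /phi dpre /wstep => -[E _]; rewrite E in fin.
by have := conn_mem bB fin; rewrite (negPf aB).
Qed.

Lemma walk_onto u y : u \in Z -> conn e Z u y ->
  exists2 i, i < tour_len & walk Z u i = y.
Proof.
move=> uZ cuy.
have [z /andP[euz zZ]|no] := pickP (fun z => e u z && (z \in Z)); last first.
  exists 0 => //; rewrite walk0; apply/eqP.
  apply: (conn_closed (P := fun x => u == x) _ _ cuy) => //.
  by move=> a b /eqP <- _ bZ eab; move: (no b); rewrite eab bZ.
pose d0 := wstep Z (u, u).
have [e1 y1Z] := nxt_nbr u euz zZ.
have dd0 : dart d0 by rewrite /induced e1 uZ.
have rev x w : fconnect phi d0 (x, w) -> fconnect phi d0 (w, x).
  move=> f; apply: (connect_trans f); apply: fconnect_reverse.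
  exact: (fconnect_dart dd0 f).
(* The heads met on the orbit are closed under adjacency: reverse the dart ending in a, rotate
   around a to the wanted neighbour. *)
have : [exists x, fconnect phi d0 (x, y)].
  apply: (conn_closed (P := fun w => [exists x, fconnect phi d0 (x, w)]) _ _ cuy).
    move=> a b /existsP[x fx] aZ bZ eab; apply/existsP; exists a; apply/rev.
    apply: (nxt_transitive (A := fun x => fconnect phi d0 (x, a)) _ fx eab bZ).
    move=> w fw; apply/rev; have dw := fconnect_dart dd0 fw.
    apply: connect_trans fw _.
    have -> : (a, nxt Z w a) = phi (w, a) by rewrite /phi dw.
    exact: fconnect1.
  apply/existsP; exists d0.2; apply/rev.
  have -> : (u, d0.2) = d0 by [].
  exact: connect0.
case/existsP=> x fx.
(* The initial pair (u, u) is not a dart, so the orbit starts one step later. This shift is the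
   successor in [tour_len]. *)
have walkE i : iter i.+1 (wstep Z) (u, u) = iter i phi d0 /\ dart (iter i phi d0).
  elim: i => [//|i [IHi di]]; split; last by rewrite iterS phi_dart.
  by rewrite iterS IHi [in RHS]iterS {2}/phi di.
exists (findex phi d0 (x, y)).+1.
  rewrite ltnS; apply: leq_trans (findex_max fx) _.
  apply: leq_trans (max_card _) _.
  by rewrite card_prod card_ord.
by rewrite /walk (walkE _).1 iter_findex.
Qed.
End Tour.
End RotorWalk.

(** * The algorithm on graphs *)

(** Indices run from t - 1 down to 0, as in the [for_] loops of the machine; for [sim_step] this is
    the reversal of time. *)
Fixpoint downto (A : Type) (f : nat -> A -> A) (t : nat) (a : A) : A :=
  if t is t'.+1 then downto f t' (f t' a) else a.

Lemma iota0S m : iota 0 m.+1 = rcons (iota 0 m) m.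
Proof. by rewrite -addn1 iotaD cats1. Qed.

Section Model.
Variables (n' : nat).
Local Notation n := n'.+1.
Variable e : rel 'I_n.
Implicit Types (Z F : {set 'I_n}) (u v : 'I_n) (sl wl ys : seq nat).

(* Vertex lists hold [v.+1] for the vertex [v], so that 0 marks an empty entry. *)
Definition vset sl : {set 'I_n} := [set x : 'I_n | x.+1 \in sl].
Definition below i : {set 'I_n} := [set x : 'I_n | x < i].

(* The time [t = r * tour_len + i] stands for step [i] of the walk from [r]. *)
Definition pos F t : option 'I_n :=
  if inord (t %/ tour_len n') \in F
  then Some (walk e F (inord (t %/ tour_len n')) (t %% tour_len n')) else None.
Definition visited F t : {set 'I_n} :=
  [set x | has (fun t' => pos F t' == Some x) (iota 0 t)].

Definition hits Z u (P : pred 'I_n) : bool :=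
  has (fun i => P (walk e Z u i)) (iota 0 (tour_len n')).
(** The target may depend on the neighbour: the simulation looks for a vertex of W, the check for a
    neighbour of v other than the one it started from. *)
Definition linked Z v (P : 'I_n -> pred 'I_n) : nat :=
  count (fun q => [&& e v (inord q), inord q \in Z & hits Z (inord q) (P (inord q))])
    (iota 0 n).

(** The set Z when the backward sweep stands at time t: the vertices first visited before t are the
    unprocessed ones. *)
Definition live i F sl t : {set 'I_n} := below i :\: vset sl :\: visited F t.

Definition old_graph i wl : {set 'I_n} := below i :\: vset wl.

(* The state consists of the deleted vertices and of the number of bits of [Y]
   that have been used. *)
Definition sim_step i wl k (Y : nat -> nat) t (st : seq nat * nat) : seq nat * nat :=
  let F := old_graph i wl in
  let: (sl, bp) := st in
  if pos F t is Some v then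
    if v \in visited F t then st
    else if (1 < linked (live i F sl t.+1) v (fun _ x => x \in vset wl)) && (bp < k.*2.+2)
    then (if (Y bp != 0) && (size sl < k) then rcons sl v.+1 else sl, bp.+1)
    else st
  else st.

(** The guard on the size keeps the list within k entries for every digit string, however
    useless. *)
Definition init_step wl k (x : nat -> nat) j (st : seq nat * seq nat) :=
  let: (sl, ys) := st in
  if x j == 0 then (if size sl < k then rcons sl (nth 0 wl j) else sl, ys)
  else (sl, ys ++ [:: (x j).-1 %% 2; (x j).-1 %/ 2]).

Definition sim i wl k x : seq nat :=
  let: (sl, ys) := downto (init_step wl k x) k.+1 ([::], [::]) in
  (downto (sim_step i wl k (nth 0 ys)) (n * tour_len n') (sl, 0)).1.

(** Adding v to the kept vertices below it closes a cycle iff two of its neighbours are already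
    connected there. *)
Definition check_vertex sl v : bool :=
  (v \in vset sl) ||
  (linked (live v set0 sl 0) v (fun u x => (x != u) && e v x) == 0).
Definition check i sl : bool := all (fun q => check_vertex sl (inord q)) (iota 0 i).

Lemma in_vset v sl : (v \in vset sl) = (v.+1 \in sl).
Proof. by rewrite inE. Qed.

Lemma in_below v i : (v \in below i) = (v < i).
Proof. by rewrite inE. Qed.

Lemma visited0 F : visited F 0 = set0.
Proof. by apply/setP => x; rewrite !inE. Qed.

Lemma visitedS F t :
  visited F t.+1 = if pos F t is Some v then v |: visited F t else visited F t.
Proof.
apply/setP => x; rewrite inE iota0S has_rcons.
case: (pos F t) => [v|]; rewrite ?inE //.
by congr orb; rewrite (inj_eq Some_inj) eq_sym.
Qed.

Lemma live0E i F sl : live i F sl 0 = below i :\: vset sl.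
Proof. by rewrite /live visited0 setD0. Qed.

Lemma pos_at F r i : r < n -> i < tour_len n' ->
  pos F (r * tour_len n' + i) =
  if inord r \in F then Some (walk e F (inord r) i) else None.
Proof.
by move=> rn il; rewrite /pos divnMDl // modnMDl divn_small // modn_small // addn0.
Qed.

Lemma mem_visited F t t' v : pos F t = Some v -> t < t' -> v \in visited F t'.
Proof.
move=> E lt; rewrite inE; apply/hasP; exists t; rewrite ?E //.
by rewrite mem_iota.
Qed.

Lemma visitedP F t v : v \in visited F t -> exists2 t', t' < t & pos F t' = Some v.
Proof. by rewrite inE => /hasP[t']; rewrite mem_iota => lt /eqP E; exists t'. Qed.

Lemma pos_mem F t v : pos F t = Some v -> v \in F.
Proof. by rewrite /pos; case: ifP => // rF [<-]; apply: walk_mem. Qed.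

Lemma visited_sub F t : visited F t \subset F.
Proof. by apply/subsetP => v /visitedP[t' _ /pos_mem]. Qed.

Lemma visited_all F : visited F (n * tour_len n') = F.
Proof.
apply/eqP; rewrite eqEsubset visited_sub; apply/subsetP => v vF.
apply: (@mem_visited _ (v * tour_len n' + 0)).
  by rewrite pos_at // inord_val vF.
by rewrite addn0 ltn_pmul2r.
Qed.

Lemma count_inord (A : pred 'I_n) : count (fun q => A (inord q)) (iota 0 n) = #|A|.
Proof.
have -> : count (fun q => A (inord q)) (iota 0 n) = count A (map inord (iota 0 n)).
  by rewrite count_map.
rewrite -val_enum_ord -map_comp.
have -> : map (inord \o val) (enum 'I_n) = enum 'I_n.
  by rewrite -[RHS]map_id; apply: eq_map => x /=; rewrite inord_val.
by rewrite -size_filter cardE /enum_mem -enumT /= -filter_predI; congr size; apply: eq_filter => x /=; rewrite andbT.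
Qed.

Section Sym.
Hypothesis e_sym : symmetric e.
Hypothesis e_irr : irreflexive e.

(** Here walks turn into connectivity. Acyclicity matters: in a set with cycles a walk may return to
    its start before covering its component. *)
Lemma hitsP Z u P : acyclic e Z -> u \in Z ->
  hits Z u P = [exists x, conn e Z u x && P x].
Proof.
move=> acZ uZ; apply/hasP/existsP => [[i _ Pi]|[x /andP[cux Px]]].
  by exists (walk e Z u i); rewrite Pi walk_conn.
have [i il E] := walk_onto e_sym e_irr acZ uZ cux.
by exists i; rewrite ?mem_iota // E.
Qed.

Lemma linkedE Z v P : acyclic e Z ->
  linked Z v P = #|[pred u | [&& e v u, u \in Z & [exists x, conn e Z u x && P u x]]]|.
Proof.
move=> acZ; rewrite /linked (count_inord [pred u | [&& e v u, u \in Z & hits Z u (P u)]]).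
apply: eq_card => u; rewrite !inE; case uZ: (u \in Z); last by rewrite !andbF.
by rewrite hitsP.
Qed.

(** In increasing order, the set in which the walks for the next vertex run is already known to be
    acyclic. *)
Lemma check_sound i sl : i <= n -> check i sl -> acyclic e (below i :\: vset sl).
Proof.
elim: i => [|i IHi] lin.
  move=> _; have -> : below 0 :\: vset sl = set0 by apply/setP => x; rewrite !inE andbF.
  exact: acyclic0.
rewrite /check iota0S all_rcons => /andP[+ /(IHi (ltnW lin)) acZ].
have iE : nat_of_ord (inord i : 'I_n) = i by rewrite inordK.
set v : 'I_n := inord i in iE *.
have sub : below i.+1 :\: vset sl \subset v |: (below i :\: vset sl).
  apply/subsetP => x; rewrite !inE ltnS leq_eqVlt -(inj_eq val_inj) /= iE.
  by case: (_ \in sl); case: eqP.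
have [vsl _|vsl] := boolP (v \in vset sl).
  apply: acyclic_sub acZ; apply/subsetP => x xB; have := subsetP sub x xB.
  rewrite in_setU1; case/orP => // /eqP xv; move: xB vsl; rewrite xv !inE.
  by case: (_ \in sl).
rewrite /check_vertex (negPf vsl) live0E iE linkedE //= => /eqP/card0_eq no.
apply: acyclic_sub sub _; apply: (acyclic_add e_sym) => //.
  by rewrite !inE iE ltnn andbF.
move=> u u' uZ u'Z evu evu' cuu'; apply/eqP; apply: contraT => nuu'.
have := no u; rewrite !inE evu /=.
move: uZ; rewrite !inE => -> /= /existsP[]; exists u'.
by rewrite cuu' evu' eq_sym nuu'.
Qed.

Lemma check_complete i sl : i <= n -> acyclic e (below i :\: vset sl) -> check i sl.
Proof.
move=> lin acZ; apply/allP => q; rewrite mem_iota add0n => /= qi.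
have vE : nat_of_ord (inord q : 'I_n) = q by rewrite inordK // (leq_trans qi).
set v : 'I_n := inord q in vE *.
rewrite /check_vertex; have [//|vsl] := boolP (v \in vset sl).
rewrite live0E vE.
have sub : v |: (below q :\: vset sl) \subset below i :\: vset sl.
  apply/subsetP => x; rewrite !inE; case/orP=> [/eqP ->|/andP[-> xq]].
    by move: vsl; rewrite inE vE qi andbT.
  exact: ltn_trans qi.
have acv := acyclic_sub sub acZ.
have vq : v \notin below q :\: vset sl by rewrite !inE vE ltnn andbF.
rewrite linkedE //; last by apply: acyclic_sub acv; apply: subsetUr.
apply/eqP/eq_card0 => u; rewrite !inE; apply/negP => /and3P[evu uZ /existsP[x]].
case/and3P=> cux nxu evx; move/eqP: nxu; apply; apply: esym.
have uZ' : u \in below q :\: vset sl by rewrite !inE.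
exact: (acyclic_nbrs e_sym vq acv uZ' (conn_mem uZ' cux)).
Qed.

Section Order.
Variable F : {set 'I_n}.
Hypothesis acF : acyclic e F.

(** A walk visits its tree in a connected way, and a later root finds a tree either untouched or
    completely visited. *)
Lemma visited_conn t x y : t <= n * tour_len n' ->
  x \in visited F t -> y \in visited F t -> conn e F x y -> conn e (visited F t) x y.
Proof.
elim: t x y => [|t IHt] x y lt; first by rewrite visited0 inE.
rewrite visitedS; case posE: (pos F t) => [v|]; last by apply: IHt; lia.
have [vt|vt] := boolP (v \in visited F t).
  have -> : v |: visited F t = visited F t by apply/setUidPr; rewrite sub1set.
  by apply: IHt; lia.
have vF := pos_mem posE.
have sub : visited F t \subset v |: visited F t by apply: subsetUr.
(* The case of the newly visited v and an older z of the same tree. *)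
have claim z : z \in visited F t -> conn e F z v -> conn e (v |: visited F t) z v.
  move=> zt czv.
  have rn : t %/ tour_len n' < n by rewrite ltn_divLR.
  have tE := divn_eq t (tour_len n'); have ml := ltn_pmod t (ltn0Sn (n * n)).
  rewrite -/(tour_len n') in ml.
  set r := t %/ _ in tE rn; set i := t %% _ in tE ml.
  have posE' := posE; rewrite tE pos_at // in posE'.
  move: posE'; case: ifP => // rF [] wE.
  (* Inside a walk, v is adjacent to the preceding position, which is visited. *)
  case: i ml wE tE => [|i] ml wE tE; last first.
    have pE : pos F t.-1 = Some (walk e F (inord r) i).
      by rewrite tE addnS /= pos_at ?rF // ltnW.
    have pt : walk e F (inord r) i \in visited F t.
      by apply: (mem_visited pE); rewrite {2}tE addnS; lia.
    case: (walkS e F (inord r) i) => [E|[E _]]; first by move: vt; rewrite -wE E pt.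
    rewrite wE in E.
    have cpv : conn e (v |: visited F t) (walk e F (inord r) i) v.
      by apply: conn_edge; rewrite ?in_setU1 ?eqxx ?pt ?orbT.
    apply: (conn_trans _ cpv); apply: (conn_sub sub); apply: IHt => //; first by lia.
    apply: (conn_trans czv); rewrite (conn_sym e_sym).
    by apply: conn_edge => //; apply: walk_mem.
  (* If v is the root of a new walk, then z was met by the walk of an earlier root of the same tree;
     that walk is complete and has visited v, a contradiction. *)
  rewrite walk0 in wE.
  have [t' lt' pE'] := visitedP zt.
  have rn' : t' %/ tour_len n' < r by rewrite ltn_divLR //; lia.
  have ml' := ltn_pmod t' (ltn0Sn (n * n)); rewrite -/(tour_len n') in ml'.
  have tE' := divn_eq t' (tour_len n').
  set r' := t' %/ _ in tE' rn'; set i' := t' %% _ in tE' ml'.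
  rewrite tE' pos_at // in pE'; last by lia.
  move: pE'; case: ifP => // rF' [] wE'.
  have cr'v : conn e F (inord r') v.
    by apply: (conn_trans _ czv); rewrite -wE'; apply: walk_conn.
  have [j jl jE] := walk_onto e_sym e_irr acF rF' cr'v.
  case/negP: vt; apply: (@mem_visited F (r' * tour_len n' + j)).
    by rewrite pos_at ?rF' ?jE //; lia.
  rewrite tE addn0; apply: (@leq_trans (r'.+1 * tour_len n')).
    by rewrite mulSn addnC ltn_add2r.
  by rewrite leq_mul2r rn' orbT.
rewrite !in_setU1.
case/orP=> [/eqP->|xt]; case/orP=> [/eqP->|yt] cxy.
- exact: conn_refl.
- by rewrite (conn_sym e_sym); apply: claim => //; rewrite (conn_sym e_sym).
- exact: claim.
- by apply: (conn_sub sub); apply: IHt => //; lia.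
Qed.

End Order.
End Sym.
End Model.

(** * Completeness of the guesses *)

Section Completeness.
Variables (n' : nat).
Local Notation n := n'.+1.
Variable e : rel 'I_n.
Hypothesis e_sym : symmetric e.
Hypothesis e_irr : irreflexive e.
Variables (i k : nat) (wl : seq nat).
Local Notation W := (vset n' wl).
Local Notation V := (below n' i).
Local Notation F := (old_graph n' i wl).
Hypothesis acF : acyclic e F.
Implicit Types (S : {set 'I_n}) (sl ys : seq nat).

Local Notation rooted Z u := [exists x, conn e Z u x && (x \in W)].

(* A vertex [v] of the optimal solution with at most one rooted neighbour below
   it can be exchanged for its (unique) neighbour among the unprocessed vertices. *)
Lemma exchange_acyclic S sl t v :
  t < n * tour_len n' -> pos e F t = Some v -> v \notin visited e F t ->
  vset n' sl \subset S -> S :\: vset n' sl \subset visited e F t.+1 ->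
  acyclic e (V :\: S) -> v \in S ->
  (forall u u', e v u -> e v u' -> u \in live e i F sl t.+1 -> u' \in live e i F sl t.+1 ->
     rooted (live e i F sl t.+1) u -> rooted (live e i F sl t.+1) u' -> u = u') ->
  acyclic e (V :\: ((S :\ v) :|: [set p in visited e F t | e v p])).
Proof.
move=> lt posE vt sS Svis acS vS uniq_rooted.
set P := [set p in _ | _]; set Z := live e i F sl t.+1 in uniq_rooted *.
have visE : visited e F t.+1 = v |: visited e F t by rewrite visitedS posE.
have vF := pos_mem posE; have vV : v \in V by case/setDP: vF.
pose Q := V :\: (S :|: P).
have vQ : v \notin Q by rewrite !inE vS.
have sub : V :\: ((S :\ v) :|: P) \subset v |: Q.
  apply/subsetP => x; rewrite !in_setU !in_setD !in_setU !in_setD !in_set1.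
  by case: eqP => //= _; case: (x \in S).
apply: acyclic_sub sub _.
have acQ : acyclic e Q.
  by apply: acyclic_sub acS; apply: setDS; apply: subsetUl.
have QZ u : e v u -> u \in Q -> u \in Z.
  move=> evu; rewrite /Q in_setD in_setU negb_or => /andP[/andP[uS uP] uV].
  rewrite /Z /live !in_setD uV andbT visE in_setU1 negb_or -andbA.
  apply/and3P; split; last by apply: contra uS; apply: (subsetP sS).
    by apply: contraNneq uS => ->.
  by move: uP; rewrite inE evu andbT.
have sZFF : Z :&: F \subset F by apply: subsetIr.
have vZ : v \notin Z by rewrite /Z /live !in_setD visE in_setU1 eqxx.
(* The component of u in Z avoids W and so lies in F. A path in Q leaving it would enter an
   unprocessed y' of the tree of v in F. The edges to v and y' would then doubly link it to the
   visited part of that tree. So the path stays in F, where v sees each component once. *)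
have unrooted u u' : ~~ rooted Z u -> u \in Q -> u' \in Q -> e v u -> e v u' ->
    conn e Q u u' -> u = u'.
  move=> nr uQ u'Q evu evu' cuu'.
  have inF x : x \in Z -> conn e Z u x -> x \in F.
    move=> xZ cux; rewrite in_setD; apply/andP; split.
      by apply: contra nr => xW; apply/existsP; exists x; rewrite cux.
    by move: xZ; rewrite /Z /live !in_setD => /andP[_ /andP[]].
  have uZ := QZ u evu uQ.
  have uZF : u \in Z :&: F by rewrite in_setI uZ inF ?conn_refl.
  have sZF : Z :&: F \subset Z by apply: subsetIl.
  have cZF : conn e (Z :&: F) u u'.
    apply: (conn_closed (P := conn e (Z :&: F) u) _ _ cuu'); last exact: conn_refl.
    move=> y y' cuy yQ y'Q eyy'.
    have yZF := conn_mem uZF cuy.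
    have yZ : y \in Z by case/setIP: yZF.
    have [y'Z|y'Z] := boolP (y' \in Z).
      have y'F : y' \in F.
        apply: inF => //; apply: conn_trans (conn_sub sZF cuy) _.
        exact: conn_edge.
      by apply: (conn_trans cuy); apply: conn_edge; rewrite // in_setI y'Z.
    move: y'Q; rewrite /Q in_setD in_setU negb_or => /andP[/andP[y'S y'P] y'V].
    have y'vis : y' \in visited e F t.+1.
      move: y'Z; rewrite /Z /live !in_setD y'V andbT negb_and !negbK.
      by case/orP=> // y's; move: y'S; rewrite (subsetP sS).
    have y'v : y' != v by apply: contraNneq y'S => ->.
    have y'F := subsetP (visited_sub e F t.+1) _ y'vis.
    have [uF yF] : u \in F /\ y \in F by case/setIP: uZF; case/setIP: yZF.
    have cvy' : conn e F v y'.
      apply: (conn_trans (conn_edge evu vF uF)).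
      apply: (conn_trans (conn_sub sZFF cuy)); exact: conn_edge.
    have vvis : v \in visited e F t.+1 by rewrite visE in_setU1 eqxx.
    have cvis := visited_conn e_sym e_irr acF lt vvis y'vis cvy'.
    have dis : [disjoint Z :&: F & visited e F t.+1].
      apply/pred0P => x; rewrite /= in_setI /Z /live in_setD.
      by case: (x \in visited e F t.+1); rewrite ?andbF.
    have := acyclic_no_double_link e_sym acF sZFF (visited_sub e F t.+1) dis uZF vvis cuy cvis.
    rewrite [e u v]e_sym evu eyy' => /(_ isT isT) /andP[_ /eqP vy'].
    by rewrite vy' eqxx in y'v.
  apply: (acyclic_nbrs e_sym (Z := Z :&: F) (v := v)) => //.
  - by rewrite in_setI (negPf vZ).
  - by apply: acyclic_sub acF; rewrite subUset sub1set vF.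
  - exact: conn_mem uZF cZF.
(* If one of the two neighbours is unrooted, the preceding claim applies; if both are rooted, the
   hypothesis does. *)
apply: (acyclic_add e_sym) => // u u' uQ u'Q evu evu' cuu'.
have [ru|nr] := boolP (rooted Z u); last exact: unrooted nr _ _ _ _ _.
have [ru'|nr'] := boolP (rooted Z u'); first by apply: uniq_rooted => //; apply: QZ.
by apply/esym/unrooted => //; rewrite (conn_sym e_sym).
Qed.

(** Induction along the backward sweep. The solution S contains all deletions made so far and
    otherwise only unprocessed vertices; it may be exchanged on the way. The bits are fixed before
    [Y] and [bp], so that a further bit can be put in front of them. *)
Lemma sim_tail t sl S :
  t <= n * tour_len n' -> [disjoint vset n' sl & visited e F t] ->
  vset n' sl \subset S -> S :\: vset n' sl \subset visited e F t ->
  size sl + #|S :\: vset n' sl| <= k -> acyclic e (V :\: S) ->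
  exists2 bs : seq bool, size bs <= (k - size sl) + ncomp e W (live e i F sl t) &
    forall (Y : nat -> nat) bp,
      (forall j, j < size bs -> Y (bp + j) = nth false bs j) ->
      bp + size bs <= k.*2.+2 ->
      acyclic e (V :\: vset n' (downto (sim_step e i wl k Y) t (sl, bp)).1).
Proof.
elim: t sl S => [|t IHt] sl S lt dis sS Svis budget acS.
  exists [::] => // Y bp _ _ /=; move: Svis; rewrite visited0 subset0 setD_eq0 => Ssl.
  by have -> : vset n' sl = S by apply/eqP; rewrite eqEsubset sS.
case posE: (pos e F t) => [v|]; last first.
  have visE : visited e F t.+1 = visited e F t by rewrite visitedS posE.
  rewrite visE in dis Svis.
  have [bs sbs H] := IHt sl S (ltnW lt) dis sS Svis budget acS.
  exists bs; first by rewrite /live visE.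
  by move=> Y bp HY Hbp; rewrite /= posE; apply: H.
have visE : visited e F t.+1 = v |: visited e F t by rewrite visitedS posE.
have [vt|vt] := boolP (v \in visited e F t).
  have visE' : visited e F t.+1 = visited e F t.
    by rewrite visE; apply/setUidPr; rewrite sub1set.
  rewrite visE' in dis Svis.
  have [bs sbs H] := IHt sl S (ltnW lt) dis sS Svis budget acS.
  exists bs; first by rewrite /live visE'.
  by move=> Y bp HY Hbp; rewrite /= posE vt; apply: H.
have vF := pos_mem posE; have vV : v \in V by case/setDP: vF.
have vW : v \notin W by case/setDP: vF.
set Z := live e i F sl t.+1.
have vsl : v \notin vset n' sl.
  by apply: contraTN dis => vsl; apply/pred0Pn; exists v; rewrite /= vsl visE in_setU1 eqxx.
have dis' : [disjoint vset n' sl & visited e F t].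
  by apply: disjointWr dis; rewrite visE subsetUr.
have vZ : v \notin Z by rewrite /Z /live !in_setD visE in_setU1 eqxx.
have ZS : Z \subset V :\: S.
  apply/subsetP => x; rewrite /Z /live !in_setD => /and3P[xvis xsl ->]; rewrite andbT.
  by apply: contra xvis => xS; apply: (subsetP Svis); rewrite in_setD xsl.
have acZ := acyclic_sub ZS acS.
have keepE : live e i F sl t = v |: Z.
  apply/setP => x; rewrite in_setU1 /Z /live !in_setD visE in_setU1.
  by have [->|] := eqVneq x v; rewrite //= vt vsl vV.
have linkE := linkedE e_sym e_irr v (fun _ x => x \in W) acZ.
set c := linked e Z v _ in linkE.
have [c2|c1] := ltnP 1 c; last first.
  (* The simulation keeps v without asking, so a solution that deletes v is exchanged for one that
     deletes its unprocessed neighbour. *)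
  pose S' := if v \in S then (S :\ v) :|: [set p in visited e F t | e v p] else S.
  have [sS' Svis' budget' acS'] : [/\ vset n' sl \subset S', S' :\: vset n' sl \subset visited e F t,
     size sl + #|S' :\: vset n' sl| <= k & acyclic e (V :\: S')].
    rewrite /S'; case: ifP => [vS|vS]; last first.
      split=> //; apply/subsetP => x xS; have := subsetP Svis x xS.
      rewrite visE in_setU1; case/orP=> // /eqP xv; move: xS.
      by rewrite xv in_setD vS andbF.
    split.
    - apply: subset_trans (subsetUl _ _); apply/subsetD1P; split=> //.
    - apply/subsetP => x; rewrite !in_setD in_setU !in_setD in_set1.
      case/andP=> xsl /orP[/andP[nxv xS]|]; last by rewrite inE => /andP[].
      have := subsetP Svis x; rewrite in_setD xsl xS visE in_setU1 (negPf nxv).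
      exact.
    - set P := [set p in _ | _].
      (* Visited neighbours of v are connected among the visited vertices, so two of them would
         close a cycle in F. Hence the exchange stays within the budget. *)
      have P1 : #|P| <= 1.
        apply/card_le1_eqP => p p' /setIdP[pv evp] /setIdP[pv' evp'].
        have vis_F := subsetP (visited_sub e F t).
        have cF : conn e F p p'.
          apply: (@conn_trans _ e F p v).
            rewrite (conn_sym e_sym).
            by apply: conn_edge => //; apply: vis_F.
          by apply: conn_edge => //; apply: vis_F.
        have cvis := visited_conn e_sym e_irr acF (ltnW lt) pv pv' cF.
        apply/esym/(acyclic_nbrs e_sym vt _ pv pv' evp evp' cvis).
        by apply: acyclic_sub acF; rewrite -visE visited_sub.
      have : #|((S :\ v) :|: P) :\: vset n' sl| <= #|(S :\: vset n' sl) :\ v| + 1.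
        apply: leq_trans (leq_add (leqnn _) P1); apply: leq_trans (leq_card_setU _ _).
        apply: subset_leq_card; apply/subsetP => x; rewrite !in_setD !in_setU !in_setD.
        by case: (_ \in vset n' sl).
      have := cardsD1 v (S :\: vset n' sl); rewrite in_setD vS vsl /=.
      move=> cD cle; apply: leq_trans budget; rewrite cD leq_add2l addnC; exact: cle.
    - apply: (@exchange_acyclic S sl) => //.
      move=> u u' evu evu' uZ u'Z ru ru'.
      move: c1; rewrite linkE => /card_le1_eqP uniq_c; apply/esym/uniq_c; rewrite inE.
        by rewrite evu ru andbT.
      by rewrite evu' ru' andbT.
  have [bs sbs H] := IHt sl S' (ltnW lt) dis' sS' Svis' budget' acS'.
  exists bs.
    by apply: leq_trans sbs _; rewrite leq_add2l keepE ncomp_add.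
  move=> Y bp HY Hbp; rewrite /= posE (negPf vt) -/Z -/c ltnNge c1 /=; exact: H.
(* From here on a bit is read. A true bit is paid for by the budget, a false one by the drop of
   [ncomp]. *)
have [vS|vS] := boolP (v \in S).
  pose sl' := rcons sl v.+1.
  have sl'E : vset n' sl' = v |: vset n' sl.
    by apply/setP => x; rewrite !inE mem_rcons inE eqSS.
  have cD : #|S :\: vset n' sl| = #|(S :\: vset n' sl) :\ v|.+1.
    by rewrite (cardsD1 v) in_setD vS vsl.
  have SE : S :\: vset n' sl' = (S :\: vset n' sl) :\ v.
    by rewrite sl'E setUC setDDl.
  have liveE : live e i F sl' t = Z.
    apply/setP => x; rewrite /Z /live !in_setD visE sl'E !in_setU1 !negb_or.
    by case: eqP; rewrite /= ?andbF.
  have szlt : size sl < k by move: budget; rewrite cD; clear; lia.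
  have [||||//|bs sbs H] := IHt sl' S (ltnW lt).
  - apply/pred0P => x /=; rewrite sl'E in_setU1.
    have [->|_] := eqVneq x v; first by rewrite (negPf vt) andbF.
    exact: (pred0P dis' x).
  - by rewrite sl'E subUset sub1set vS.
  - rewrite SE; apply/subsetP => x; rewrite in_setD1 => /andP[nxv xS].
    by have := subsetP Svis x xS; rewrite visE in_setU1 (negPf nxv).
  - by move: budget; rewrite SE size_rcons cD; clear; lia.
  exists (true :: bs); first by move: sbs szlt; rewrite liveE size_rcons /=; clear; lia.
  move=> Y bp HY Hbp; rewrite /= posE (negPf vt) -/Z -/c c2.
  have bplt : bp < k.*2.+2 by move: Hbp => /=; clear; lia.
  have Y0 : Y bp = 1 by have := HY 0; rewrite addn0 /=; apply.
  rewrite bplt Y0 szlt /=; apply: H; last by move: Hbp => /=; clear; lia.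
  by move=> j jl; rewrite addSnnS; have := HY j.+1; rewrite /= ltnS; apply.
have Svis' : S :\: vset n' sl \subset visited e F t.
  apply/subsetP => x xS; have := subsetP Svis x xS.
  rewrite visE in_setU1; case/orP=> // /eqP xv; move: xS.
  by rewrite xv in_setD (negPf vS) andbF.
have [bs sbs H] := IHt sl S (ltnW lt) dis' sS Svis' budget acS.
have nlt : ncomp e W (v |: Z) < ncomp e W Z.
  move: c2; rewrite linkE => /card_gt1P[u [u' []]].
  move=> /and3P[evu uZ /existsP[w /andP[cuw wW]]].
  move=> /and3P[evu' u'Z /existsP[w' /andP[cuw' wW']]] nuu'.
  apply: (ncomp_add_lt e_sym vW vZ _ nuu' evu evu' uZ u'Z wW wW' cuw cuw').
  apply: acyclic_sub acS; rewrite subUset ZS andbT sub1set in_setD vS.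
  exact: vV.
exists (false :: bs); first by move: sbs nlt; rewrite keepE /=; clear; lia.
move=> Y bp HY Hbp; rewrite /= posE (negPf vt) -/Z -/c c2.
have bplt : bp < k.*2.+2 by move: Hbp => /=; clear; lia.
have Y0 : Y bp = 0 by have := HY 0; rewrite addn0 /=; apply.
rewrite bplt Y0 /=; apply: H; last by move: Hbp => /=; clear; lia.
by move=> j jl; rewrite addSnnS; have := HY j.+1; rewrite /= ltnS; apply.
Qed.

(** With this bound on the zeros the size guard always lets a deletion through. The reversals come
    from the downward loop. *)
Lemma init_runE x j sl ys :
  size sl + count (fun q => x q == 0) (iota 0 j) <= k ->
  downto (init_step wl k x) j (sl, ys) =
  (sl ++ [seq nth 0 wl q | q <- rev [seq q <- iota 0 j | x q == 0]],
   ys ++ flatten [seq [:: (x q).-1 %% 2; (x q).-1 %/ 2]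
                 | q <- rev [seq q <- iota 0 j | x q != 0]]).
Proof.
elim: j sl ys => [|j IHj] sl ys; first by rewrite !cats0.
rewrite iota0S -cats1 count_cat !filter_cat /= addn0.
have [xj|xj] := eqVneq (x j) 0 => /= sz.
  rewrite !cats0 ifT; last by lia.
  by rewrite IHj ?size_rcons 1?rev_cat /= ?cat_rcons //; lia.
by rewrite !cats0 IHj ?rev_cat /= -?catA //; lia.
Qed.

Lemma map_index (A : eqType) (B : Type) (h : nat -> B) (L : seq A) :
  uniq L -> [seq h (index q L) | q <- L] = map h (iota 0 (size L)).
Proof.
case: L => [//|q0 L0]; set L := q0 :: L0 => uL.
apply: (@eq_from_nth _ (h 0)); first by rewrite !size_map size_iota.
move=> j; rewrite size_map => jl.
by rewrite (nth_map q0) // index_uniq // (nth_map 0) ?size_iota // nth_iota.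
Qed.

Lemma flatten_pairs (A : Type) (b : nat -> A) m :
  flatten [seq [:: b j.*2; b j.*2.+1] | j <- iota 0 m] = map b (iota 0 m.*2).
Proof.
elim: m => // m IHm; rewrite doubleS !iota0S !map_rcons flatten_rcons IHm.
by rewrite -!cats1 -catA.
Qed.

Lemma sim_complete S : size wl <= k.+1 -> #|S| <= k -> acyclic e (V :\: S) ->
  exists2 x : nat -> nat, (forall j, x j < 5) & acyclic e (V :\: vset n' (sim e i wl k x)).
Proof.
move=> swl cS acS.
pose S0 := S :&: V.
have acS0 : acyclic e (V :\: S0) by rewrite /S0 setDIr setDv setU0.
have cS0 : #|S0| <= k by apply: leq_trans cS; apply: subset_leq_card; apply: subsetIl.
pose inS w := [exists v in S0, v.+1 == w].
have inSE (v : 'I_n) : inS v.+1 = (v \in S0).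
  apply/existsP/idP => [[u /andP[uS /eqP [/val_inj <-]]]//|vS].
  by exists v; rewrite vS eqxx.
(* Only the first occurrence of a vertex in [wl] gets the digit 0, so repeated entries do not use up
   the budget. Padding zeros never satisfy [inS]. *)
pose zero q := inS (nth 0 wl q) && (index (nth 0 wl q) wl == q).
have zero_lt q : zero q -> q < size wl.
  case/andP=> /existsP[v /andP[_ /eqP vE]] _; rewrite ltnNge; apply/negP => sq.
  by move: vE; rewrite nth_default.
pose Lz := [seq q <- iota 0 k.+1 | zero q].
pose L := rev [seq q <- iota 0 k.+1 | ~~ zero q].
have uL : uniq L by rewrite rev_uniq filter_uniq // iota_uniq.
have uLz : uniq Lz by rewrite filter_uniq // iota_uniq.
have sLL : size Lz + size L = k.+1.
  by rewrite size_rev !size_filter count_predC size_iota.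
pose sl0 := [seq nth 0 wl q | q <- rev Lz].
have sl0E : vset n' sl0 = W :&: S0.
  apply/setP => v; rewrite in_setI !in_vset -inSE; apply/mapP/andP => [[q]|[vW vS]].
    rewrite mem_rev mem_filter => /andP[zq _] vE.
    by rewrite vE mem_nth ?zero_lt //; case/andP: zq.
  exists (index v.+1 wl); last by rewrite nth_index.
  rewrite mem_rev mem_filter mem_iota /zero nth_index // vS eqxx /=.
  by rewrite (leq_trans _ swl) // index_mem.
have succ_inj : injective (fun v : 'I_n => v.+1) by move=> u v [] /val_inj.
have zle : size Lz <= #|W :&: S0|.
  rewrite -(size_map (nth 0 wl)) cardE -(size_map (fun v : 'I_n => v.+1)).
  apply: uniq_leq_size.
    rewrite map_inj_in_uniq // => q q'; rewrite !mem_filter.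
    move=> /andP[/andP[_ /eqP iq] _] /andP[/andP[_ /eqP iq'] _] E.
    by rewrite -iq -iq' E.
  move=> w /mapP[q]; rewrite mem_filter => /andP[zq _] ->.
  have ql := zero_lt q zq; case/andP: zq => /existsP[v /andP[vS /eqP vE]] _.
  rewrite -vE; apply: map_f; rewrite mem_enum in_setI vS andbT in_vset vE.
  exact: mem_nth.
have Lge : #|W :\: S0| <= size L.
  rewrite -[size L](size_map (nth 0 wl)) cardE -(size_map (fun v : 'I_n => v.+1)).
  apply: uniq_leq_size; first by rewrite map_inj_uniq ?enum_uniq.
  move=> w /mapP[v]; rewrite mem_enum in_setD => /andP[vS vW] ->.
  rewrite in_vset in vW; apply/mapP; exists (index v.+1 wl); last by rewrite nth_index.
  rewrite mem_rev mem_filter mem_iota /zero nth_index // inSE (negPf vS) /=.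
  by rewrite (leq_trans _ swl) // index_mem.
have [||||bs sbs H] := @sim_tail (n * tour_len n') sl0 S0 (leqnn _) _ _ _ _ acS0.
- rewrite visited_all sl0E; apply/pred0P => v /=; rewrite in_setI in_setD.
  by case: (v \in W); rewrite ?andbF.
- by rewrite sl0E subsetIr.
- rewrite visited_all sl0E; apply/subsetP => v.
  rewrite in_setD in_setI negb_and in_setD /S0 in_setI.
  by case: (v \in W); case: (v \in S); case: (v \in V).
- rewrite size_map size_rev sl0E; apply: leq_trans cS0.
  rewrite -(cardsID W S0) [S0 :&: W]setIC leq_add //.
  apply: subset_leq_card; apply/subsetP => v; rewrite !in_setD in_setI.
  by case: (v \in W); case: (v \in S0).
have Lz_k : size Lz <= k.
  by apply: leq_trans zle (leq_trans _ cS0); apply: subset_leq_card; apply: subsetIr.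
(* The remaining budget is at most [k - size Lz], which is less than [size L]; the rooted components
   number at most the kept vertices of W, again at most [size L]. *)
have sbs2 : size bs <= (size L).*2.
  apply: leq_trans sbs _; rewrite size_map size_rev.
  have : ncomp e W (live e i F sl0 (n * tour_len n')) <= size L.
    apply: leq_trans (ncomp_le_card _ _ _) (leq_trans _ Lge).
    apply: subset_leq_card; apply/subsetP => v; rewrite /live sl0E !in_setI !in_setD in_setI.
    by case: (v \in W); case: (v \in S0); rewrite /= ?andbF.
  by lia.
pose b j := nat_of_bool (nth false bs j).
(* Nonzero digits encode consecutive pairs of bits, low bit first, in the order in which [init_step]
   meets them. *)
pose x q := if zero q then 0 else (b (index q L).*2 + (b (index q L).*2.+1).*2).+1.
have b01 j : b j < 2 by rewrite /b; case: (nth _ _ _).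
exists x.
  move=> q; rewrite /x; case: (zero q) => //.
  by have := b01 (index q L).*2; have := b01 (index q L).*2.+1; lia.
have x0 q : (x q == 0) = zero q by rewrite /x; case: (zero q).
have sumE : size ([::] : seq nat) + count (fun q => x q == 0) (iota 0 k.+1) <= k.
  by rewrite (eq_count x0) -size_filter.
rewrite /sim (init_runE _ sumE) !cat0s.
have -> : [seq q <- iota 0 k.+1 | x q == 0] = Lz by apply: eq_filter => q.
have -> : rev [seq q <- iota 0 k.+1 | x q != 0] = L.
  by congr rev; apply: eq_filter => q /=; rewrite x0.
have -> : [seq [:: (x q).-1 %% 2; (x q).-1 %/ 2] | q <- L] =
    [seq [:: b (index q L).*2; b (index q L).*2.+1] | q <- L].
  apply/eq_in_map => q; rewrite mem_rev mem_filter /x => /andP[/negPf -> _] /=.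
  have := b01 (index q L).*2; have := b01 (index q L).*2.+1.
  by move: (b _) (b _) => [|[|//]] [|[|//]].
rewrite (map_index (fun j => [:: b j.*2; b j.*2.+1])) // flatten_pairs.
apply: H; last first.
  by rewrite add0n; move: sbs2 sLL; lia.
move=> j jl; have jL := leq_trans jl sbs2.
by rewrite add0n (nth_map 0) ?size_iota ?nth_iota.
Qed.

Lemma size_sim x : size (sim e i wl k x) <= k.
Proof.
have H1 j sl ys : size sl <= k -> size (downto (init_step wl k x) j (sl, ys)).1 <= k.
  elim: j sl ys => //= j IHj sl ys sl_k; case: (x j == 0); apply: IHj => //.
  by case: ltnP => //; rewrite size_rcons.
have H2 Y t sl bp : size sl <= k -> size (downto (sim_step e i wl k Y) t (sl, bp)).1 <= k.
  elim: t sl bp => //= t IHt sl bp sl_k.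
  case: (pos _ _ _) => [v|]; last exact: IHt.
  case: (v \in _); first exact: IHt.
  case: (_ && _); last exact: IHt.
  apply: IHt; case: (Y bp != 0) => //=.
  by case: ltnP => //; rewrite size_rcons.
rewrite /sim; have := H1 k.+1 [::] [::] (leq0n _).
by case: (downto _ _ _) => sl ys sl_k; apply/H2/sl_k.
Qed.

End Completeness.

(** * Expressions and total correctness with time bounds *)

Inductive expr :=
  | Reg (r : nat) | Cst (v : nat) | Op (o : binop) (a b : expr) | Inp (a : expr) | Ld (a : expr).

(* Machine cells 0 .. 7 are the evaluation stack, and the cell [j] of the
   programs below is the machine cell [8 + j]. *)
Definition stack : nat := 8.
Definition regs : nat := 64.

(** The value is left in stack cell [d], and cells below [d] are untouched. A register is read by an
    indirect load from its own address, as the machine has no copy instruction. *)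
Fixpoint compile (a : expr) (d : nat) : cmd :=
  match a with
  | Reg r => Seq (Const d (stack + r)) (LoadInd d d)
  | Cst v => Const d v
  | Op o a b => Seq (compile a d) (Seq (compile b d.+1) (Bin o d d d.+1))
  | Inp a => Seq (compile a d) (Read d d)
  | Ld a => Seq (compile a d)
              (Seq (Const d.+1 stack) (Seq (Bin Add d d d.+1) (LoadInd d d)))
  end.

Fixpoint depth (a : expr) : nat :=
  match a with
  | Reg _ | Cst _ => 1
  | Op _ a b => maxn (depth a) (depth b).+1
  | Inp a => depth a
  | Ld a => maxn (depth a) 2
  end.

Fixpoint cost (a : expr) : nat :=
  match a with
  | Reg _ => 2
  | Cst _ => 1
  | Op _ a b => cost a + (cost b + 1)
  | Inp a => cost a + 1
  | Ld a => cost a + 3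
  end.

(** The bound 1000 on constants lies below every admissible $2^w$, so they survive the reduction
    modulo the word size. *)
Fixpoint small (a : expr) : bool :=
  match a with
  | Reg r => r < regs
  | Cst v => v < 1000
  | Op _ a b => small a && small b
  | Inp a | Ld a => small a
  end.

Definition wf (d : nat) (a : expr) : bool := (d + depth a <= stack) && small a.

Definition asg r a := Seq (compile a 0) (Seq (Const 1 (stack + r)) (StoreInd 1 0)).
Definition sto l a :=
  Seq (compile a 0) (Seq (compile l 1) (Seq (Const 2 stack) (Seq (Bin Add 1 1 2) (StoreInd 1 0)))).
Definition ifs a c1 c2 := Seq (compile a 0) (If 0 c1 c2).
Definition while r c := While (stack + r) c.
(** The counter is decremented before the body, which therefore sees the indices N - 1, ..., 0. *)
Definition for_ r a c :=
  Seq (asg r a) (while r (Seq (asg r (Op Defs.Sub (Reg r) (Cst 1))) c)).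

Definition frame L (m m' : Defs.mem) := forall j, L <= j -> m' j = m j.

Lemma frame_trans L m1 m2 m3 : frame L m1 m2 -> frame L m2 m3 -> frame L m1 m3.
Proof. by move=> f12 f23 j jL; rewrite f23 // f12. Qed.

Lemma frame_le L L' m m' : L <= L' -> frame L m m' -> frame L' m m'.
Proof. by move=> le f j jL; apply: f; apply: leq_trans jL. Qed.

Lemma frame_upd L m m' r v : r < L -> frame L m m' -> frame L m (upd m' r v).
Proof.
move=> rL f j jL; rewrite /upd; case: eqP => [E|_]; last exact: f.
by move: jL; rewrite E leqNgt rL.
Qed.

Section Hoare.
Variables (w s : nat) (inp : seq nat).
Local Notation M := (2 ^ w).
Hypothesis M_large : 1000 <= M.
Hypothesis s_le : s <= M.
Hypothesis s_ge : stack + regs <= s.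
Hypothesis inp_lt : forall j, nth 0 inp j < M.
Implicit Types (m : Defs.mem) (Q : Defs.mem -> Prop).

Fixpoint ev m a : nat :=
  match a with
  | Reg r => m r
  | Cst v => v
  | Op o a b => binop_val o (ev m a) (ev m b)
  | Inp a => nth 0 inp (ev m a)
  | Ld a => m (ev m a)
  end.

(** Only sums and products can overflow, and only loads can leave the memory. *)
Fixpoint ok m a : Prop :=
  match a with
  | Reg _ | Cst _ => True
  | Op Add a b => [/\ ok m a, ok m b & ev m a + ev m b < M]
  | Op Mul a b => [/\ ok m a, ok m b & ev m a * ev m b < M]
  | Op _ a b => ok m a /\ ok m b
  | Inp a => ok m a
  | Ld a => ok m a /\ stack + ev m a < s
  end.

Definition bounded m := forall j, m j < M.

Lemma bounded_upd m i v : bounded m -> v < M -> bounded (upd m i v).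
Proof. by move=> bm vM j; rewrite /upd; case: eqP. Qed.

Lemma upd_eq m i v : upd m i v i = v. Proof. by rewrite /upd eqxx. Qed.

Lemma upd_neq m i v j : j != i -> upd m i v j = m j.
Proof. by rewrite /upd => /negPf ->. Qed.

Lemma binop_lt o m a b x y : ok m (Op o a b) -> x = ev m a -> y = ev m b ->
  x < M -> y < M -> binop_val o x y < M.
Proof.
have M1 : 1 < M by apply: leq_trans M_large.
case: o => /=.
- by move=> [_ _ lt] -> ->.
- by move=> _ _ _ xM _; apply: leq_ltn_trans xM; apply: leq_subr.
- by move=> [_ _ lt] -> ->.
- by move=> _ _ _ xM _; apply: leq_ltn_trans xM; apply: leq_div.
- by move=> _ _ _ xM _; apply: leq_ltn_trans xM; apply: leq_mod.
- by move=> _ _ _ _ _; case: (x == y) => //; apply: ltnW.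
- by move=> _ _ _ _ _; case: (x < y) => //; apply: ltnW.
Qed.

Lemma ok_op m o a b : ok m (Op o a b) -> ok m a /\ ok m b.
Proof. by case: o => /= -[]. Qed.

Lemma compile_spec a d m hm : bounded m -> (forall j, m (stack + j) = hm j) ->
  wf d a -> ok hm a ->
  exists m', [/\ exec w s inp (compile a d) m m' [::] (cost a), m' d = ev hm a, bounded m' &
    forall j, (j < d) || (stack <= j) -> m' j = m j].
Proof.
have dlt d' : d' < stack -> d' < s.
  by move=> ds; apply: leq_trans s_ge; apply: leq_trans ds _; apply: leq_addr.
rewrite /wf; elim: a d m => [r|v|o a IHa b IHb|a IHa|a IHa] d m bm mE /andP[dep sm] oka.
- have rs : stack + r < s by apply: leq_trans s_ge; rewrite ltn_add2l.
  have rM := leq_trans rs s_le.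
  have ds : d < stack by move: dep; rewrite /= addn1.
  pose m1 := upd m d (stack + r).
  have b1 : bounded m1 by apply: bounded_upd.
  exists (upd m1 d (m1 (m1 d))); split.
  + apply: (@ExecSeq w s inp _ _ m m1 _ [::] [::] 1 1).
      have := @ExecConst w s inp d (stack + r) m (dlt _ ds).
      by rewrite modn_small.
    by apply: ExecLoadInd; [exact: dlt | exact: dlt | rewrite /m1 upd_eq].
  + by rewrite upd_eq /m1 upd_eq upd_neq //= ?mE //; rewrite neq_ltn (leq_trans ds) ?orbT ?leq_addr.
  + exact: bounded_upd.
  + move=> j jd; have nj : j != d by apply: contraTneq jd => ->; rewrite ltnn leqNgt ds.
    by rewrite upd_neq // /m1 upd_neq.
- have ds : d < stack by move: dep; rewrite /= addn1.
  have vM : v < M by apply: leq_trans M_large.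
  exists (upd m d v); split.
  + have := @ExecConst w s inp d v m (dlt _ ds).
    by rewrite modn_small.
  + by rewrite upd_eq.
  + exact: bounded_upd.
  + move=> j jd; have nj : j != d by apply: contraTneq jd => ->; rewrite ltnn leqNgt ds.
    by rewrite upd_neq.
- have [oa ob] := ok_op oka; case/andP: sm => sa sb.
  have depa : d + depth a <= stack by move: dep => /=; rewrite /stack; lia.
  have depb : d.+1 + depth b <= stack by move: dep => /=; rewrite /stack; lia.
  have [|m1 [ex1 v1 b1 f1]] := IHa d m bm mE _ oa; first by rewrite depa.
  have m1E j : m1 (stack + j) = hm j by rewrite f1 ?mE // leq_addr orbT.
  have [|m2 [ex2 v2 b2 f2]] := IHb d.+1 m1 b1 m1E _ ob; first by rewrite depb.
  have db : 0 < depth b by elim: (b) => //= *; rewrite ?leq_max ?ltnS ?orbT //.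
  have ds1 : d.+1 < stack by move: depb db; rewrite /stack; lia.
  have vE : m2 d = ev hm a by rewrite f2 ?ltnS ?leqnn.
  have lt := binop_lt oka vE v2 (b2 d) (b2 d.+1).
  exists (upd m2 d (binop_val o (m2 d) (m2 d.+1))); split.
  + apply: (@ExecSeq w s inp _ _ m m1 _ [::] [::]) => //.
    apply: (@ExecSeq w s inp _ _ m1 m2 _ [::] [::]) => //.
    have := @ExecBin w s inp o d d d.+1 m2 (dlt _ (ltnW ds1)) (dlt _ (ltnW ds1)) (dlt _ ds1).
    by rewrite modn_small.
  + by rewrite upd_eq vE v2.
  + exact: bounded_upd.
  + move=> j jd; have nj : j != d.
      by apply: contraTneq jd => ->; rewrite ltnn leqNgt (ltnW ds1).
    rewrite upd_neq // f2 ?f1 //; case/orP: jd => [jd|->]; rewrite ?orbT //.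
    by rewrite ltnS ltnW.
- have [|m1 [ex1 v1 b1 f1]] := IHa d m bm mE _ oka; first by rewrite dep.
  have db : 0 < depth a by elim: (a) => //= *; rewrite ?leq_max ?ltnS ?orbT //.
  have ds : d < stack by move: dep db => /=; rewrite /stack; lia.
  exists (upd m1 d (nth 0 inp (m1 d))); split.
  + apply: (@ExecSeq w s inp _ _ m m1 _ [::] [::]) => //.
    have := @ExecRead w s inp d d m1 (dlt _ ds) (dlt _ ds).
    by rewrite modn_small.
  + by rewrite upd_eq v1.
  + exact: bounded_upd.
  + move=> j jd; have nj : j != d by apply: contraTneq jd => ->; rewrite ltnn leqNgt ds.
    by rewrite upd_neq // f1.
- case: oka => oka as_.
  have depa : d + depth a <= stack by move: dep => /=; rewrite /stack; lia.
  have ds1 : d.+1 < stack by move: dep => /=; rewrite /stack; lia.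
  have [|m1 [ex1 v1 b1 f1]] := IHa d m bm mE _ oka; first by rewrite depa.
  have sM : stack < M by apply: leq_trans M_large.
  pose m2 := upd m1 d.+1 stack.
  have m2d : m2 d = ev hm a by rewrite /m2 upd_neq // neq_ltn ltnSn.
  have m2d1 : m2 d.+1 = stack by rewrite /m2 upd_eq.
  pose m3 := upd m2 d (ev hm a + stack).
  have m3d : m3 d = ev hm a + stack by rewrite /m3 upd_eq.
  have aM : ev hm a + stack < M by rewrite addnC; apply: leq_trans as_ s_le.
  have b2 : bounded m2 by apply: bounded_upd.
  have b3 : bounded m3 by apply: bounded_upd.
  have nd1 j : stack <= j -> (j != d) && (j != d.+1) by move: ds1; rewrite /stack; lia.
  have nd2 j : (j < d) || (stack <= j) -> (j != d) && (j != d.+1) by move: ds1; rewrite /stack; lia.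
  exists (upd m3 d (m3 (m3 d))); split.
  + apply: (@ExecSeq w s inp _ _ m m1 _ [::] [::] _ 3) => //.
    apply: (@ExecSeq w s inp _ _ m1 m2 _ [::] [::] 1 2) => //.
      have := @ExecConst w s inp d.+1 stack m1 (dlt _ ds1).
      by rewrite modn_small.
    apply: (@ExecSeq w s inp _ _ m2 m3 _ [::] [::] 1 1) => //.
      have := @ExecBin w s inp Add d d d.+1 m2 (dlt _ (ltnW ds1)) (dlt _ (ltnW ds1)) (dlt _ ds1).
      by rewrite /= m2d m2d1 modn_small.
    apply: ExecLoadInd; try exact: dlt _ (ltnW ds1).
    by rewrite m3d addnC.
  + have /andP[n1 n2] := nd1 (ev hm a + stack) (leq_addl _ _).
    rewrite upd_eq m3d /m3 upd_neq // /m2 upd_neq // f1 ?leq_addl ?orbT //.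
    by rewrite addnC mE.
  + exact: bounded_upd.
  + by move=> j jd; have /andP[n1 n2] := nd2 j jd; rewrite upd_neq // /m3 upd_neq // /m2 upd_neq // f1.
Qed.

(** Total correctness with time bound [B] and no output. [hm] is the memory above the stack; it is
    related to the machine memory pointwise, and the stack contents are arbitrary. *)
Definition hwp c Q B hm : Prop :=
  forall m, bounded m -> (forall j, m (stack + j) = hm j) ->
  exists m' t hm', [/\ exec w s inp c m m' [::] t, t <= B, bounded m',
    (forall j, m' (stack + j) = hm' j) & Q hm'].

Lemma hwp_conseq c Q Q' B B' hm :
  hwp c Q B hm -> (forall hm', Q hm' -> Q' hm') -> B <= B' -> hwp c Q' B' hm.
Proof.
move=> H QQ BB m bm mE; have [m' [t [hm' [ex tB bm' mE' Qm]]]] := H m bm mE.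
by exists m', t, hm'; split; rewrite ?(leq_trans tB) //; apply: QQ.
Qed.

Lemma hwp_time c Q B B' hm : hwp c Q B hm -> B <= B' -> hwp c Q B' hm.
Proof. by move=> H BB; apply: hwp_conseq H _ BB. Qed.

Lemma hwp_seq c1 c2 Q B1 B2 hm :
  hwp c1 (hwp c2 Q B2) B1 hm -> hwp (Seq c1 c2) Q (B1 + B2) hm.
Proof.
move=> H m bm mE; have [m1 [t1 [h1 [ex1 tB1 b1 mE1 H2]]]] := H m bm mE.
have [m2 [t2 [h2 [ex2 tB2 b2 mE2 HQ]]]] := H2 m1 b1 mE1.
exists m2, (t1 + t2), h2; split=> //; last exact: leq_add.
exact: (ExecSeq ex1 ex2).
Qed.

Lemma hwp_skip Q hm : Q hm -> hwp Skip Q 1 hm.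
Proof. by move=> HQ m bm mE; exists m, 1, hm; split=> //; apply: ExecSkip. Qed.

Lemma hwp_store m1 m2 hm v a :
  bounded m1 -> (forall j, m1 (stack + j) = hm j) -> m2 = upd m1 (stack + a) v -> v < M ->
  bounded m2 /\ (forall j, m2 (stack + j) = upd hm a v j).
Proof.
move=> b1 mE1 -> vM; split; first exact: bounded_upd.
by move=> j; rewrite /upd eqn_add2l mE1.
Qed.

Lemma hwp_asg r a Q hm : r < regs -> wf 0 a -> ok hm a ->
  Q (upd hm r (ev hm a)) -> hwp (asg r a) Q (cost a + 2) hm.
Proof.
move=> rr wfa oka HQ m bm mE.
have [m1 [ex1 v1 b1 f1]] := compile_spec bm mE wfa oka.
have rs : stack + r < s by apply: leq_trans s_ge; rewrite ltn_add2l.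
have rM := leq_trans rs s_le.
have s1 j : j < stack -> j < s by move: s_ge; rewrite /stack /regs; lia.
pose m2 := upd m1 1 (stack + r).
have m21 : m2 1 = stack + r by rewrite /m2 upd_eq.
have m20 : m2 0 = ev hm a by rewrite /m2 upd_neq.
have b2 : bounded m2 by apply: bounded_upd.
have mE2 j : m2 (stack + j) = hm j by rewrite /m2 upd_neq // f1 // leq_addr orbT.
pose m3 := upd m2 (m2 1) (m2 0).
have [b3 mE3] : bounded m3 /\ (forall j, m3 (stack + j) = upd hm r (ev hm a) j).
  by apply: (@hwp_store m2) => //; rewrite /m3 ?m21 ?m20 // -m20.
exists m3, (cost a + 2), (upd hm r (ev hm a)); split=> //.
apply: (@ExecSeq w s inp _ _ m m1 _ [::] [::] _ 2) => //.
apply: (@ExecSeq w s inp _ _ m1 m2 _ [::] [::] 1 1) => //.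
  have := @ExecConst w s inp 1 (stack + r) m1 (s1 1 isT).
  by rewrite modn_small.
by apply: ExecStoreInd; [exact: s1 | exact: s1 | rewrite m21].
Qed.

Lemma hwp_sto l a Q hm : wf 0 a -> wf 1 l -> ok hm a -> ok hm l ->
  stack + ev hm l < s ->
  Q (upd hm (ev hm l) (ev hm a)) -> hwp (sto l a) Q (cost a + (cost l + 3)) hm.
Proof.
move=> wfa wfl oka okl ls HQ m bm mE.
have [m1 [ex1 v1 b1 f1]] := compile_spec bm mE wfa oka.
have mE1 j : m1 (stack + j) = hm j by rewrite f1 ?mE // leq_addr orbT.
have [m2 [ex2 v2 b2 f2]] := compile_spec b1 mE1 wfl okl.
have mE2 j : m2 (stack + j) = hm j by rewrite f2 ?mE1 // leq_addr orbT.
have s1 j : j < stack -> j < s by move: s_ge; rewrite /stack /regs; lia.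
have sM : stack < M by apply: leq_trans M_large.
have lM : ev hm l + stack < M by rewrite addnC; apply: leq_trans ls s_le.
pose m3 := upd m2 2 stack.
pose m4 := upd m3 1 (ev hm l + stack).
have m31 : m3 1 = ev hm l by rewrite /m3 upd_neq.
have m32 : m3 2 = stack by rewrite /m3 upd_eq.
have m40 : m4 0 = ev hm a by rewrite /m4 /m3 !upd_neq // f2.
have m41 : m4 1 = stack + ev hm l by rewrite /m4 upd_eq addnC.
have b4 : bounded m4 by do 2 apply: bounded_upd => //.
have mE4 j : m4 (stack + j) = hm j by rewrite /m4 /m3 !upd_neq.
pose m5 := upd m4 (m4 1) (m4 0).
have [b5 mE5] : bounded m5 /\ (forall j, m5 (stack + j) = upd hm (ev hm l) (ev hm a) j).
  by apply: (@hwp_store m4) => //; rewrite /m5 ?m41 ?m40 // -m40.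
exists m5, (cost a + (cost l + 3)), (upd hm (ev hm l) (ev hm a)); split=> //.
apply: (@ExecSeq w s inp _ _ m m1 _ [::] [::]) => //.
apply: (@ExecSeq w s inp _ _ m1 m2 _ [::] [::] _ 3) => //.
apply: (@ExecSeq w s inp _ _ m2 m3 _ [::] [::] 1 2) => //.
  have := @ExecConst w s inp 2 stack m2 (s1 2 isT).
  by rewrite modn_small.
apply: (@ExecSeq w s inp _ _ m3 m4 _ [::] [::] 1 1) => //.
  have := @ExecBin w s inp Add 1 1 2 m3 (s1 1 isT) (s1 1 isT) (s1 2 isT).
  by rewrite /= m31 m32 modn_small.
by apply: ExecStoreInd; [exact: s1 | exact: s1 | rewrite m41].
Qed.

Lemma hwp_ifs a c1 c2 Q B1 B2 hm : wf 0 a -> ok hm a ->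
  (ev hm a != 0 -> hwp c1 Q B1 hm) -> (ev hm a = 0 -> hwp c2 Q B2 hm) ->
  hwp (ifs a c1 c2) Q (cost a + (B1 + B2).+1) hm.
Proof.
move=> wfa oka H1 H2 m bm mE.
have [m1 [ex1 v1 b1 f1]] := compile_spec bm mE wfa oka.
have mE1 j : m1 (stack + j) = hm j by rewrite f1 ?mE // leq_addr orbT.
have s0 : 0 < s by move: s_ge; rewrite /stack; lia.
have [m2 [t [h2 [ex2 tB b2 mE2 HQ]]]] : exists m' t hm',
    [/\ exec w s inp (if m1 0 != 0 then c1 else c2) m1 m' [::] t, t <= B1 + B2, bounded m',
    (forall j, m' (stack + j) = hm' j) & Q hm'].
  rewrite v1; have [E|E] := eqVneq (ev hm a) 0.
    have [m' [t [h' [ex' tB' b' mE' HQ]]]] := H2 E m1 b1 mE1.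
    by exists m', t, h'; split=> //; apply: leq_trans tB' _; apply: leq_addl.
  have [m' [t [h' [ex' tB' b' mE' HQ]]]] := H1 E m1 b1 mE1.
  by exists m', t, h'; split=> //; apply: leq_trans tB' _; apply: leq_addr.
exists m2, (cost a + t.+1), h2; split=> //; last by rewrite leq_add2l.
by apply: (@ExecSeq w s inp _ _ m m1 _ [::] [::]) => //; apply: ExecIf.
Qed.

(** The index bounds the remaining iterations. It may drop by more than one, which allows a search
    to stop early. *)
Lemma hwp_while r c (I : nat -> Defs.mem -> Prop) Q Bb j hm : r < regs ->
  (forall h, I 0 h -> h r = 0) ->
  (forall q h, I q.+1 h -> h r != 0 -> hwp c (fun h' => exists2 q', q' <= q & I q' h') Bb h) ->
  (forall q h, I q h -> h r = 0 -> Q h) ->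
  I j hm -> hwp (while r c) Q (j * Bb.+1).+1 hm.
Proof.
move=> rr I0 Ibody IQ; have rs : stack + r < s by apply: leq_trans s_ge; rewrite ltn_add2l.
have [m] := ubnP j; elim: m j hm => // u IHu j hm lju Ij m bm mE.
have [E|NE] := eqVneq (hm r) 0.
  exists m, 1, hm; split=> //; last exact: IQ Ij E.
  by apply: ExecWhileStop; rewrite // mE.
case: j lju Ij => [|j] lju Ij; first by rewrite I0 in NE.
have [m1 [t1 [h1 [ex1 tB1 b1 mE1 [q' le I']]]]] := Ibody j hm Ij NE m bm mE.
have [|m2 [t2 [h2 [ex2 tB2 b2 mE2 HQ]]]] := IHu q' h1 _ I' m1 b1 mE1; first by lia.
exists m2, (t1 + t2).+1, h2; split=> //.
  by apply: (@ExecWhileLoop w s inp _ _ m m1 m2 [::] [::]) => //; rewrite mE.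
have : q' * Bb.+1 <= j * Bb.+1 by rewrite leq_mul2r le orbT.
by rewrite mulSn; lia.
Qed.

(** The overhead 7 per round is 6 steps for the decrement and 1 for the loop test. *)
Lemma hwp_for r a c (I : nat -> Defs.mem -> Prop) Q Bb N hm : r < regs -> wf 0 a -> ok hm a ->
  ev hm a = N -> I N (upd hm r N) ->
  (forall j h, j < N -> I j.+1 h -> h r = j.+1 ->
     hwp c (fun h' => h' r = j /\ I j h') Bb (upd h r j)) ->
  (forall h, I 0 h -> h r = 0 -> Q h) ->
  hwp (for_ r a c) Q (cost a + 2 + (N * (Bb + 7)).+1) hm.
Proof.
move=> rr wfa oka aN IN Ibody IQ; apply: hwp_seq; apply: hwp_asg => //; rewrite aN.
apply: (hwp_time (B := (N * (6 + Bb).+1).+1)); last first.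
  by rewrite ltnS leq_mul2l; apply/orP; right; lia.
apply: (@hwp_while _ _ (fun q h => [/\ q <= N, I q h & h r = q])) => //.
- by move=> h [].
- move=> q h [qN Iq hq] _; apply: hwp_seq.
  apply: hwp_asg => //=; first by rewrite /wf /= rr.
  rewrite hq subn1 /=.
  apply: (hwp_conseq (Ibody q h qN Iq hq)) => // h' [hr' I'].
  by exists q => //; split=> //; apply: ltnW.
- by move=> q h [_ Iq hq] h0; apply: IQ => //; rewrite -h0 hq.
- by split=> //; rewrite upd_eq.
Qed.

End Hoare.

(** * The program *)

Declare Scope prog_scope.
Delimit Scope prog_scope with prog.
Notation "a +! b" := (Op Defs.Add a b) (at level 50, left associativity) : prog_scope.
Notation "a -! b" := (Op Defs.Sub a b) (at level 50, left associativity) : prog_scope.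
Notation "a *! b" := (Op Defs.Mul a b) (at level 40, left associativity) : prog_scope.
Notation "a /! b" := (Op Defs.Div a b) (at level 40, left associativity) : prog_scope.
Notation "a %! b" := (Op Defs.Mod a b) (at level 40, left associativity) : prog_scope.
Notation "a ==! b" := (Op Defs.Eq a b) (at level 70) : prog_scope.
Notation "a <! b" := (Op Defs.Lt a b) (at level 70) : prog_scope.
Notation "# r" := (Reg r) (at level 1, format "# r") : prog_scope.
Notation "$ v" := (Cst v) (at level 1, format "$ v") : prog_scope.
Notation "r <- a" := (asg r a) (at level 75) : prog_scope.
Notation "c1 ;; c2" := (Seq c1 c2) (at level 80, right associativity) : prog_scope.
Open Scope prog_scope.

(* A routine changes only registers below a bound that grows with its nesting
   level, so that most frame conditions are of the form [frame L].  Entry [j] of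
   the array [q] is the cell [addr q j]; the arrays are [W] (0), the digits (1),
   the deleted vertices (2) and the guessed bits (3). *)
Definition addr q j := j * 4 + (regs + q).
(** The length of the arrays is known only at run time; interleaving them keeps their base addresses
    constant. *)
Definition cell q a := a *! $4 +! $(regs + q).

Notation rN := 40.
Notation rK := 41.
Notation rI := 42.
Notation rLim := 31.
Notation rBnd := 32.
Notation rCnt := 33.
Notation rBp := 34.
Notation rYc := 35.
Notation rOk := 36.

Definition adjx u v := Inp ($1 +! (u *! #rN +! v)).
Definition slots := #rK *! $2 +! $2.
Definition tourx := #rN *! #rN +! $1.

(** Argument and result registers: 0 and 1 here, 3 and 4 in [mem_old], 10 and 12 in [position] (with
    n for no vertex), 13 and 15 in [mem_visited_code], 16 and 17 in [mem_live], 27 and 28 in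
    [count_linked]. Its tests see the neighbour in 24 and the walker in 19, and answer in 23. *)
Definition mem_array q : cmd :=
  1 <- $0 ;;
  for_ 2 slots (ifs (Ld (cell q #2) ==! #0 +! $1) (1 <- $1) Skip).

Definition mem_old : cmd :=
  0 <- #3 ;; mem_array 0 ;; 4 <- (#3 <! #rI) *! ($1 -! #1).

(** Cells from [b] on: previous vertex, current vertex, offset, best successor so far, candidate.
    Membership is a parameter because walks run in the old forest and in the live set. *)
Definition walk_step b mem_code arg res : cmd :=
  b.+3 <- #(b.+1) ;;
  for_ b.+2 #rN (
    b.+4 <- (#b +! #(b.+2) +! $1) %! #rN ;;
    ifs (adjx #(b.+1) #(b.+4))
      (arg <- #(b.+4) ;; mem_code ;; ifs #res (b.+3 <- #(b.+4)) Skip) Skip) ;;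
  b <- #(b.+1) ;;
  b.+1 <- #(b.+3).

Definition step_old : cmd := walk_step 5 mem_old 3 4.

Definition position : cmd :=
  5 <- #10 /! tourx ;;
  6 <- #5 ;;
  for_ 11 (#10 %! tourx) step_old ;;
  3 <- #10 /! tourx ;;
  mem_old ;;
  12 <- #rN ;;
  ifs #4 (12 <- #6) Skip.

(** Time is traded for space: every earlier position is recomputed from the root of its walk. *)
Definition mem_visited_code : cmd :=
  15 <- $0 ;;
  for_ 14 #rLim (10 <- #14 ;; position ;; ifs (#12 ==! #13) (15 <- $1) Skip).

Definition mem_live : cmd :=
  0 <- #16 ;; mem_array 2 ;;
  17 <- (#16 <! #rBnd) *! ($1 -! #1) ;;
  13 <- #16 ;; mem_visited_code ;;
  17 <- #17 *! ($1 -! #15).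

Definition step_live : cmd := walk_step 18 mem_live 16 17.

Definition count_linked test : cmd :=
  28 <- $0 ;;
  for_ 24 #rN (
    ifs (adjx #27 #24) (
      16 <- #24 ;; mem_live ;;
      ifs #17 (
        25 <- $0 ;; 18 <- #24 ;; 19 <- #24 ;;
        for_ 26 tourx (test ;; ifs #23 (25 <- $1) Skip ;; step_live) ;;
        28 <- #28 +! #25)
      Skip)
    Skip).

Definition test_root : cmd := 0 <- #19 ;; mem_array 0 ;; 23 <- #1.
Definition test_nbr : cmd := 23 <- ($1 -! (#19 ==! #24)) *! adjx #27 #19.

Definition push a : cmd :=
  ifs (#rCnt <! #rK) (sto (cell 2 #rCnt) a ;; rCnt <- #rCnt +! $1) Skip.

Definition clear_arrays : cmd := for_ 29 slots (sto (cell 2 #29) $0 ;; sto (cell 3 #29) $0).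

Definition read_digits : cmd :=
  rCnt <- $0 ;; rYc <- $0 ;;
  for_ 29 (#rK +! $1) (
    30 <- Ld (cell 1 #29) ;;
    ifs #30
      (sto (cell 3 #rYc) ((#30 -! $1) %! $2) ;;
       sto (cell 3 (#rYc +! $1)) ((#30 -! $1) /! $2) ;;
       rYc <- #rYc +! $2)
      (push (Ld (cell 0 #29)))).

Definition process_vertex : cmd :=
  rLim <- #29 +! $1 ;; 27 <- #30 ;; count_linked test_root ;;
  ifs (($1 <! #28) *! (#rBp <! slots))
    (30 <- #30 +! $1 ;; ifs (Ld (cell 3 #rBp)) (push #30) Skip ;; rBp <- #rBp +! $1)
    Skip.

Definition process_forest : cmd :=
  rBnd <- #rI ;; rBp <- $0 ;;
  for_ 29 (#rN *! tourx) (
    10 <- #29 ;; position ;; 30 <- #12 ;;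
    ifs (#30 <! #rN)
      (rLim <- #29 ;; 13 <- #30 ;; mem_visited_code ;; ifs #15 Skip process_vertex)
      Skip).

Definition sim_code : cmd := clear_arrays ;; read_digits ;; process_forest.

(** With [rLim] equal to 0 nothing counts as visited, so [mem_live] tests membership among the
    undeleted vertices below the current one. *)
Definition check_code : cmd :=
  rOk <- $1 ;; rLim <- $0 ;;
  for_ 29 #rI (
    0 <- #29 ;; mem_array 2 ;;
    ifs #1 Skip
      (rBnd <- #29 ;; 27 <- #29 ;; count_linked test_nbr ;; ifs #28 (rOk <- $0) Skip)).

(** Base-5 increment with carry in 53. The loop counts down, so index k is the least significant
    digit. *)
Definition next_digits : cmd :=
  53 <- $1 ;;
  for_ 52 (#rK +! $1) (
    ifs #53
      (54 <- Ld (cell 1 #52) +! $1 ;;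
       ifs (#54 ==! $5) (sto (cell 1 #52) $0) (sto (cell 1 #52) #54 ;; 53 <- $0))
      Skip).

Definition search : cmd :=
  51 <- $0 ;; 50 <- $1 ;;
  for_ 52 (#rK +! $1) (sto (cell 1 #52) $0) ;;
  while 50 (
    sim_code ;; check_code ;;
    ifs #rOk (51 <- $1 ;; 50 <- $0) (next_digits ;; 50 <- $1 -! #53)).

(** Entry k of array 0 is reserved for the new vertex i - 1, stored as i; the entries before it hold
    the previous solution. Register 43 records that some stage has failed. *)
Definition compression : cmd :=
  43 <- $0 ;;
  for_ 44 #rN (
    ifs #43 Skip
      (rI <- #rN -! #44 ;; sto (cell 0 #rK) #rI ;; search ;;
       ifs #51 (for_ 52 slots (sto (cell 0 #52) (Ld (cell 2 #52)))) (43 <- $1))) ;;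
  45 <- $1 -! #43.

Ltac upds := repeat first
  [ rewrite upd_eq | rewrite upd_neq; [|by rewrite ?neq_ltn; lia] ].
Ltac pow_lia := repeat match goal with
  |- context [expn ?x ?y] => move: (expn x y) => ? end; lia.
Ltac name_state h := match goal with |- hwp _ _ _ _ _ _ ?X => set h := X end.
Ltac oks := repeat (split; try exact I); try lia.

Lemma regs_addr q j : regs <= addr q j.
Proof. by rewrite /addr; lia. Qed.

Lemma addr_inj q q' j j' : q < 4 -> q' < 4 -> (addr q j == addr q' j') = (q == q') && (j == j').
Proof. by rewrite /addr; lia. Qed.

Lemma addr_reg q j r : r < regs -> (r == addr q j) = false.
Proof. by move=> rR; apply: ltn_eqF; apply: leq_trans rR (regs_addr q j). Qed.

(** For d a power of 5, divisibility of V + 1 by d says that all lower digits wrap around, that is,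
    that a carry arrives. *)
Lemma digit_carry V d : 0 < d -> d %| V.+1 ->
  V.+1 %/ d %% 5 = (if V %/ d %% 5 + 1 == 5 then 0 else V %/ d %% 5 + 1) /\
  (5 * d %| V.+1) = (V %/ d %% 5 + 1 == 5).
Proof.
move=> d0 dV; have E := divnS V d0; rewrite dV in E.
split; first by rewrite E; move: (V %/ d) => q; case: ifP; lia.
by rewrite -[in LHS](divnK dV) dvdn_pmul2r // E; move: (V %/ d) => q; lia.
Qed.

Lemma digit_nocarry V d : 0 < d -> (d %| V.+1) = false ->
  V.+1 %/ d = V %/ d /\ (5 * d %| V.+1) = false.
Proof.
move=> d0 dV; rewrite (divnS V d0) dV; split=> //.
by apply: contraFF dV; apply: dvdn_trans; apply: dvdn_mull.
Qed.

Lemma digit_onto (x : nat -> nat) m : (forall j, x j < 5) ->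
  exists2 V, V < 5 ^ m & forall l, l < m -> V %/ 5 ^ l %% 5 = x l.
Proof.
move=> x5; elim: m => [|m [V Vlt VE]]; first by exists 0.
exists (x m * 5 ^ m + V).
  rewrite expnS; apply: (@leq_trans ((x m).+1 * 5 ^ m)); first by rewrite mulSn addnC ltn_add2r.
  by rewrite leq_mul2r x5 orbT.
move=> l; rewrite ltnS leq_eqVlt => /orP[/eqP ->|lm].
  by rewrite divnMDl ?expn_gt0 // divn_small // addn0 modn_small.
have -> : 5 ^ m = 5 ^ (m - l).-1 * 5 * 5 ^ l.
  by rewrite -expnSr prednK ?subn_gt0 // -expnD subnK // ltnW.
by rewrite mulnA divnMDl ?expn_gt0 // mulnA modnMDl VE.
Qed.

(** * Correctness and running time of the routines *)

Section Programs.
Variables (w s : nat) (inp : seq nat) (n' k : nat).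
Local Notation n := n'.+1.
Variable e : rel 'I_n.
Local Notation M := (2 ^ w).
Local Notation G := (1000 * n.+1).
Hypothesis k_lt : k < n.
Hypothesis M_ge : 1000 * (n.+1 * n.+1 * n.+1 * n.+1) <= M.
Hypothesis s_def : s = stack + regs + 4 * k.*2.+2.
Hypothesis inp_lt : forall j, nth 0 inp j < M.
Hypothesis inp_adj : forall u v : 'I_n, nth 0 inp (1 + (u * n + v)) = e u v.
Implicit Types (h : Defs.mem).

Lemma M_lin : 1000 * n <= M.
Proof. by apply: leq_trans M_ge; nia. Qed.
Lemma M_sq : 1000 * (n * n) <= M.
Proof. by apply: leq_trans M_ge; nia. Qed.
Lemma M_cube : 1000 * (n * (n * n).+1) <= M.
Proof. by apply: leq_trans M_ge; nia. Qed.

Lemma M1000 : 1000 <= M. Proof. by have := M_lin; lia. Qed.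
Lemma s_leM : s <= M. Proof. by rewrite s_def /stack /regs; have := M_lin; lia. Qed.
Lemma s_geR : stack + regs <= s. Proof. by rewrite s_def; lia. Qed.

Local Notation hwp := (hwp w s inp).

Definition asgP := hwp_asg M1000 s_leM s_geR inp_lt.
Definition stoP := hwp_sto M1000 s_leM s_geR inp_lt.
Definition ifsP := hwp_ifs M1000 s_leM s_geR inp_lt.
Definition forP := hwp_for M1000 s_leM s_geR inp_lt.

Lemma hwp_call c (Q Q' : Defs.mem -> Prop) B h :
  hwp c Q B h -> (forall h', Q h' -> Q' h') -> hwp c Q' B h.
Proof. by move=> H QQ; apply: hwp_conseq H QQ _. Qed.

(** The default 0 makes the slots beyond the list empty entries. *)
Definition arr q l h := forall j, j < k.*2.+2 -> h (addr q j) = nth 0 l j.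

Lemma arr_frame L q l h h' : L <= regs -> frame L h h' -> arr q l h -> arr q l h'.
Proof.
move=> LR f ar j jk; rewrite f ?ar // (leq_trans LR) //; exact: regs_addr.
Qed.

Record glob (i : nat) (wl sl : seq nat) (h : Defs.mem) : Prop := Glob {
  glob_n : h rN = n;
  glob_k : h rK = k;
  glob_i : h rI = i;
  glob_w : arr 0 wl h;
  glob_s : arr 2 sl h }.

Lemma glob_frame L i wl sl h h' : L <= 40 -> frame L h h' -> glob i wl sl h -> glob i wl sl h'.
Proof.
move=> LR f [? ? ? ? ?]; split; rewrite ?f //; try exact: leq_trans LR _.
- by apply: arr_frame f _ => //; apply: leq_trans LR _.
- by apply: arr_frame f _ => //; apply: leq_trans LR _.
Qed.

Lemma mem_array_spec q l h : q < 4 -> size l <= k.*2.+2 -> h rK = k -> arr q l h -> h 0 < n ->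
  hwp (mem_array q) (fun h' => h' 1 = ((h 0).+1 \in l) /\ frame 3 h h') G h.
Proof.
move=> q4 sl hK ar u_lt; set u := h 0 in u_lt *.
pose P j := has (fun j => nth 0 l j == u.+1) (iota 0 j).
have PS j : P j.+1 = (nth 0 l j == u.+1) || P j by rewrite /P iota0S has_rcons.
have mE : ((h 0).+1 \in l) = P k.*2.+2.
  apply/idP/hasP => [ul|[j jl /eqP jE]].
    exists (index u.+1 l); last by rewrite nth_index.
    by rewrite mem_iota (leq_trans _ sl) // index_mem.
  have [sj|sj] := ltnP j (size l); last by move: jE; rewrite nth_default.
  by rewrite -/u -jE mem_nth.
have Ml := M_lin.
eapply hwp_time.
  apply: hwp_seq; apply: asgP => //=.
  (* The indices below [j] are still to come: [b] is the answer for the others, and [P j] is what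
     may be added. *)
  apply: (forP (N := k.*2.+2) (I := fun j h' => [/\ frame 3 h h', h' 0 = u &
     exists2 b : bool, h' 1 = b & b || P j = P k.*2.+2])) => //=.
  - by rewrite /upd /= hK; oks.
  - by rewrite /upd /= hK; lia.
  - split; rewrite /upd //=; first by do 2 apply: frame_upd => //.
    by exists false.
  - move=> j h1 jk [f1 h10 [b h11 bE]] hr.
    have cE : h1 (addr q j) = nth 0 l j by apply: (arr_frame _ f1 ar).
    have aE : upd h1 2 j (addr q j) = nth 0 l j.
      by rewrite upd_neq ?cE // neq_ltn (leq_trans _ (regs_addr q j)) ?orbT.
    apply: ifsP => //=.
    + by rewrite /wf /= /regs; lia.
    + by rewrite s_def /stack /regs /addr /upd /= h10; oks.
    + rewrite -[j * 4 + _]/(addr q j) aE /upd /= h10 addn1 => cond; apply: asgP => //=.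
      split=> //; split; rewrite //=; first by do 2 apply: frame_upd => //.
      exists true => //; rewrite -bE PS.
      by move: cond; case: (nth _ _ _ == _) => //= _; case: (b).
    + rewrite -[j * 4 + _]/(addr q j) aE /upd /= h10 addn1 => cond; apply: hwp_skip.
      split=> //; split; rewrite //=; first by apply: frame_upd => //.
      exists b => //; rewrite -bE PS.
      by move: cond; case: (nth _ _ _ == _).
  - move=> h1 [f1 h10 [b h11 bE]] _; split=> //.
    by rewrite h11 mE -bE orbF.
rewrite /=; lia.
Qed.

Lemma expG_gt0 a : 0 < G ^ a. Proof. by rewrite expn_gt0. Qed.

(** Time is counted in powers of [G]. Loops add exponents and leave constant slack, and [seq_time]
    absorbs constants up to 1000 into one more factor [G]. *)
Lemma loop_time j a N B : N <= G ^ j -> B <= 100 * G ^ a -> N * B <= 100 * G ^ (j + a).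
Proof. by move=> Nj Ba; have := leq_mul Nj Ba; rewrite mulnCA -expnD. Qed.

Lemma expG_le a b : a <= b -> G ^ a <= G ^ b.
Proof. by move=> ab; rewrite leq_pexp2l. Qed.

Lemma seq_time a B : B <= 1000 * G ^ a -> B <= G ^ a.+1.
Proof.
by move=> H; apply: leq_trans H _; rewrite expnS leq_mul2r; apply/orP; right; lia.
Qed.

Lemma n_le_G : n <= G ^ 1. Proof. rewrite expn1; lia. Qed.
Lemma tour_le_G : tour_len n' <= G ^ 2. Proof. rewrite /tour_len expnS expn1; nia. Qed.
Lemma tours_le_G : n * tour_len n' <= G ^ 3.
Proof. rewrite (expnD _ 1 2); exact: leq_mul n_le_G tour_le_G. Qed.

Lemma mem_old_spec i wl sl h (x : 'I_n) : glob i wl sl h -> size wl <= k.*2.+2 -> h 3 = x ->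
  hwp mem_old (fun h' => h' 4 = (x \in old_graph n' i wl) /\ frame 5 h h') (G ^ 2) h.
Proof.
move=> gl swl hx.
eapply hwp_time.
  apply: hwp_seq; apply: asgP => //=; apply: hwp_seq; apply: hwp_call.
    apply: (@mem_array_spec 0 wl) => //; rewrite /upd /= ?(glob_k gl) ?hx //.
    by apply: (arr_frame (L := 1)) (glob_w gl) => //; apply: frame_upd.
  move=> h1 [h11 f1]; apply: asgP => //=.
    oks; have := M1000; case: (_ < _); case: (h1 1) => [|[|v]] /=; lia.
  have h13 : h1 3 = x by rewrite f1.
  have h1I : h1 rI = i by rewrite f1 //= /upd /= (glob_i gl).
  rewrite /upd /= in h11.
  split; last first.
    apply: frame_upd => //; apply: (@frame_trans _ _ (upd h 0 (h 3))); first exact: frame_upd.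
    exact: frame_le f1.
  rewrite upd_eq h13 h1I h11 hx in_setD in_vset inE.
  by case: (_ \in wl); case: (_ < i).
apply: seq_time; rewrite expn1 /=; lia.
Qed.

Section Walk.
Variables (b arg res : nat) (mem_code : cmd) (Inv : Defs.mem -> Prop) (a : nat) (Z : {set 'I_n}).
Hypotheses (arg_lt : arg < b) (res_lt : res < b) (b_lt : b.+4 < 40).
Hypothesis Inv_frame : forall h h', frame b.+4.+1 h h' -> Inv h -> Inv h'.
Hypothesis Inv_n : forall h, Inv h -> h rN = n.
Hypothesis mem_code_spec : forall h (x : 'I_n), Inv h -> h arg = x ->
  hwp mem_code (fun h' => h' res = (x \in Z) /\ frame b h h') (G ^ a) h.

Lemma walk_step_spec h (p c : 'I_n) : Inv h -> h b = p -> h b.+1 = c ->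
  hwp (walk_step b mem_code arg res)
    (fun h' => [/\ h' b = c, h' b.+1 = nxt e Z p c & frame b.+4.+1 h h']) (G ^ a.+2) h.
Proof.
move=> Ih hp hc; have hn := Inv_n Ih.
have Ml := M_lin; have Msq := M_sq.
pose f q (acc : 'I_n) := if e c (rotate p q) && (rotate p q \in Z) then rotate p q else acc.
have [bR argR resR] : [/\ b.+4 < regs, arg < regs & res < regs] by split; rewrite /regs; lia.
eapply hwp_time.
  apply: hwp_seq; apply: asgP => //=; first by rewrite /regs; lia.
    by rewrite /wf /= /regs; lia.
  apply: hwp_seq.
  (* [acc] is the result for the offsets from [j] on; smaller offsets may still overwrite it. *)
  apply: (forP (N := n) (I := fun j h' => [/\ frame b.+4.+1 h h', h' b = p, h' b.+1 = c &
     exists2 acc : 'I_n, h' b.+3 = acc & foldr f acc (iota 0 j) = nxt e Z p c])).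
  - by rewrite /regs; lia.
  - by rewrite /wf /= /regs; lia.
  - by [].
  - by rewrite /=; upds.
  - split; first by do 2 (apply: frame_upd; first lia).
    + by upds.
    + by upds.
    + by exists c => //; upds.
  - move=> j h1 jn [f1 h1p h1c [acc h1a fE]] hr.
    have h1n : h1 rN = n by rewrite f1 //; lia.
    have vlt : (p + j + 1) %% n < n by rewrite ltn_pmod.
    have [y yE] : exists y, y = rotate p j by exists (rotate p j).
    have rE : (p + j + 1) %% n = y by rewrite yE /= -addnA addn1.
    apply: hwp_seq; apply: asgP; first by rewrite /regs; lia.
      by rewrite /wf /= /regs; lia.
      rewrite /=; upds; rewrite h1p; have := ltn_ord p; oks.
    rewrite /=; upds; rewrite h1p h1n rE.
    apply: ifsP => //.
    + by rewrite /wf /= /regs; lia.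
    + rewrite /=; upds; rewrite h1c h1n; have := ltn_ord c; have := ltn_ord y.
      have : c * n <= n * n by rewrite leq_mul2r ltnW ?orbT.
      oks.
    + rewrite /=; upds; rewrite h1c h1n inp_adj => ecy.
      apply: hwp_seq; apply: asgP; [exact: argR | by rewrite /wf /= /regs; lia | by [] |].
      rewrite /=; upds; apply: hwp_seq.
      apply: hwp_call.
        apply: (@mem_code_spec _ y); last by upds.
        apply: Inv_frame Ih; do 3 (apply: frame_upd; first lia); exact: f1.
      move=> h2 [h2r f2].
      have f02 : frame b.+4.+1 h h2.
        apply: (frame_trans _ (frame_le _ f2)); last lia.
        by do 3 (apply: frame_upd; first lia).
      have [h2j h2y] : h2 b.+2 = j /\ h2 b.+4 = y by split; (rewrite f2; last lia); upds.
      have [h2p h2c] : h2 b = p /\ h2 b.+1 = c by split; (rewrite f2; last lia); upds.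
      have h2a : h2 b.+3 = acc by rewrite f2; [upds | lia].
      apply: ifsP; [by rewrite /wf /= /regs; lia | by [] | |].
      * rewrite /= h2r => yZ; apply: asgP; first by rewrite /regs; lia.
          by rewrite /wf /= /regs; lia.
          by [].
        rewrite /= h2y; split; first by upds.
        split; first by apply: frame_upd => //; lia.
        - by upds.
        - by upds.
        - exists y; first by upds.
          move: fE; rewrite iota0S foldr_rcons {2}/f -yE.
          by move: ecy yZ; case: (e c y); case: (y \in Z).
      * rewrite /= h2r => yZ; apply: hwp_skip; split=> //; split=> //; exists acc => //.
        move: fE; rewrite iota0S foldr_rcons {2}/f -yE.
        by move: yZ; case: (y \in Z); rewrite ?andbF.
    + rewrite /=; upds; rewrite h1c h1n inp_adj => ecy.
      apply: hwp_skip; split; first by upds.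
      split; first by do 2 (apply: frame_upd; first lia).
      * by upds.
      * by upds.
      * exists acc; first by upds.
        move: fE; rewrite iota0S foldr_rcons {2}/f -yE.
        by move: ecy; case: (e c y).
  - move=> h1 [f1 h1p h1c [acc h1a fE]] _.
    apply: hwp_seq; apply: asgP; first by rewrite /regs; lia.
      by rewrite /wf /= /regs; lia.
      by [].
    apply: asgP; first by rewrite /regs; lia.
      by rewrite /wf /= /regs; lia.
      by [].
    rewrite /=; split.
    + by upds.
    + by upds; rewrite h1a -fE.
    + by do 2 (apply: frame_upd; first lia).
set B := (X in n * (X + 7)).
have H : n * (B + 7) <= 100 * G ^ a.+1.
  apply: (@loop_time 1 a); first exact: n_le_G.
  by rewrite /B /=; move: (expG_gt0 a); clear; pow_lia.
move: (n * (B + 7)) H => {B} X H.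
by apply: seq_time; move: H (expG_gt0 a.+1) => /=; clear; pow_lia.
Qed.
End Walk.

Lemma tourE : n * n + 1 = tour_len n'. Proof. by rewrite addn1. Qed.

Lemma divn_tour t : t < n * tour_len n' -> t %/ tour_len n' < n.
Proof. by move=> tl; rewrite ltn_divLR. Qed.

Lemma step_old_spec i wl sl h (p c : 'I_n) : glob i wl sl h -> size wl <= k.*2.+2 ->
  h 5 = p -> h 6 = c ->
  hwp step_old (fun h' => [/\ h' 5 = c, h' 6 = nxt e (old_graph n' i wl) p c & frame 10 h h'])
    (G ^ 4) h.
Proof.
move=> gl swl; apply: (walk_step_spec (Inv := glob i wl sl)) => //.
- by move=> h1 h2 f; apply: glob_frame f.
- by move=> h1 [].
- by move=> h1 x gl1 h1x; apply: mem_old_spec gl1 swl h1x.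
Qed.

Lemma position_spec i wl sl h t : glob i wl sl h -> size wl <= k.*2.+2 -> h 10 = t ->
  t < n * tour_len n' ->
  hwp position (fun h' => h' 12 = oapp val n (pos e (old_graph n' i wl) t) /\ frame 13 h h')
    (G ^ 7) h.
Proof.
move=> gl swl ht tl; have rn := divn_tour tl; have Msq := M_sq; have Ml := M_lin.
set F := old_graph n' i wl; have hn := glob_n gl.
pose r : 'I_n := inord (t %/ tour_len n').
have rE : t %/ tour_len n' = r by rewrite inordK.
(* The [j] remaining steps lead from the current pair to the final one. *)
pose I j h' := (frame 13 h h' /\ h' 10 = t) /\ exists2 pc : 'I_n * 'I_n, h' 5 = pc.1 /\ h' 6 = pc.2 &
  iter j (wstep e F) pc = iter (t %% tour_len n') (wstep e F) (r, r).
eapply hwp_time.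
  apply: hwp_seq; apply: asgP => //; first by rewrite /= hn; oks.
  rewrite /= ht hn tourE rE; apply: hwp_seq; apply: asgP => //.
  rewrite /= /upd /= -/(upd _ _ _); apply: hwp_seq.
  apply: (forP (N := t %% tour_len n') (I := I)) => //.
  - by rewrite /upd /= hn; oks.
  - by rewrite /upd /= hn ht tourE.
  - split; first by split=> //; do 3 apply: frame_upd => //.
    by exists (r, r).
  - move=> j h1 jt [[f1 h1t] [[p c] [h1p h1c] fE]] hr.
    apply: hwp_call; first apply: (step_old_spec (i := i) (wl := wl) (sl := sl) (p := p) (c := c)) => //.
      by apply: (@glob_frame 13) gl => //; apply: frame_upd.
    move=> h2 [h2p h2c f2]; split; first by rewrite f2.
    split; last by exists (c, nxt e F p c); rewrite // -fE iterSr.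
    split; last by rewrite f2.
    apply: (frame_trans _ (frame_le _ f2)) => //; exact: frame_upd.
  - move=> h1 [[f1 h1t] [[p c] /= [h1p h1c] fE]] _.
    have cE : c = walk e F r (t %% tour_len n') by rewrite /walk -fE.
    have h1n : h1 rN = n by rewrite f1.
    apply: hwp_seq; apply: asgP => //; first by rewrite /= h1n; oks.
    rewrite /= h1n h1t tourE rE; apply: hwp_seq.
    apply: hwp_call; first apply: (mem_old_spec (i := i) (wl := wl) (sl := sl) (x := r)) => //.
      by apply: (@glob_frame 13) gl => //; apply: frame_upd.
    move=> h2 [h2r f2].
    have h2n : h2 rN = n by rewrite f2.
    have h26 : h2 6 = c by rewrite f2.
    have f02 : frame 13 h h2 by apply: (frame_trans _ (frame_le _ f2)) => //; apply: frame_upd.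
    apply: hwp_seq; apply: asgP => //; rewrite /= h2n; apply: ifsP => //.
    + rewrite /= /upd /= h2r => rF; apply: asgP => //=.
      split; last by do 2 apply: frame_upd => //.
      by rewrite /upd /= h26 /pos -/F -/r; move: rF; case: (r \in F) => //= _; rewrite cE.
    + rewrite /= /upd /= h2r => rF; apply: hwp_skip; split; last by apply: frame_upd.
      by rewrite /= /pos -/F -/r; move: rF; case: (r \in F).
have lt : t %% tour_len n' <= G ^ 2 by apply: leq_trans (ltnW (ltn_pmod _ _)) tour_le_G.
have H : t %% tour_len n' * (G ^ 4 + 7) <= 100 * G ^ 6.
  by apply: (@loop_time 2 4) => //; move: (expG_gt0 4); clear; pow_lia.
apply: seq_time; move: H (expG_gt0 6) (@expG_le 2 6 isT) => /=; clear.
by move: (t %% _ * _) => N; pow_lia.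
Qed.

Lemma oapp_val_eq (o : option 'I_n) (x : 'I_n) : (oapp val n o == x) = (o == Some x).
Proof.
case: o => [y|] /=; first by rewrite (inj_eq Some_inj).
by rewrite eq_sym ltn_eqF.
Qed.

Lemma mem_visited_spec i wl sl lim h (x : 'I_n) : glob i wl sl h -> size wl <= k.*2.+2 ->
  h rLim = lim -> lim <= n * tour_len n' -> h 13 = x ->
  hwp mem_visited_code
    (fun h' => h' 15 = (x \in visited e (old_graph n' i wl) lim) /\ frame 16 h h') (G ^ 11) h.
Proof.
move=> gl swl hl ll hx; set F := old_graph n' i wl.
pose P j := x \in visited e F j.
have PS j : P j.+1 = (pos e F j == Some x) || P j.
  by rewrite /P visitedS; case: (pos e F j) => [v|] //; rewrite in_setU1 eq_sym.
pose I j h' := [/\ frame 16 h h', h' 13 = x & exists2 b : bool, h' 15 = b & b || P j = P lim].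
eapply hwp_time.
  apply: hwp_seq; apply: asgP => //=; apply: (forP (N := lim) (I := I)) => //.
  - split=> //; first by do 2 apply: frame_upd => //.
    by exists false.
  - move=> j h1 jl [f1 h1x [b h1b bE]] hr.
    apply: hwp_seq; apply: asgP => //=; rewrite upd_eq; apply: hwp_seq.
    apply: hwp_call.
      apply: (position_spec (i := i) (wl := wl) (sl := sl) (t := j)) => //; last exact: leq_trans ll.
      by apply: (@glob_frame 16) gl => //; do 2 apply: frame_upd => //.
    move=> h2 [h2p f2].
    have h2x : h2 13 = x by rewrite f2.
    have h2b : h2 15 = b by rewrite f2.
    have h2j : h2 14 = j by rewrite f2.
    have f02 : frame 16 h h2.
      by apply: (frame_trans _ (frame_le _ f2)) => //; do 2 apply: frame_upd => //.
    have cE : (h2 12 == h2 13) = (pos e F j == Some x) by rewrite h2p h2x oapp_val_eq.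
    apply: ifsP => //; rewrite /= cE => cond.
    + apply: asgP => //=; split=> //; split=> //; first exact: frame_upd.
      by exists true => //; rewrite -bE PS; move: cond; case: (pos _ _ _ == _) => //= _; case: (b).
    + apply: hwp_skip; split=> //; split=> //.
      by exists b => //; rewrite -bE PS; move: cond; case: (pos _ _ _ == _).
  - move=> h1 [f1 h1x [b h1b bE]] _; split=> //.
    by rewrite h1b -/(P lim) -bE /P visited0 in_set0 orbF.
set B := (X in _ * (X + 7)).
have H : lim * (B + 7) <= 100 * G ^ 10.
  apply: (@loop_time 3 7); first exact: leq_trans ll tours_le_G.
  by rewrite /B /=; move: (expG_gt0 7); clear; pow_lia.
apply: seq_time; move: H (expG_gt0 10) => /=; clear.
by move: (lim * _) => N; pow_lia.
Qed.

Record live_ctx i wl sl lim bnd h : Prop := LiveCtx {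
  live_glob : glob i wl sl h;
  live_lim : h rLim = lim;
  live_bnd : h rBnd = bnd }.

Lemma live_frame L i wl sl lim bnd h h' : L <= 31 -> frame L h h' ->
  live_ctx i wl sl lim bnd h -> live_ctx i wl sl lim bnd h'.
Proof.
move=> LR f [gl hl hb]; split; rewrite ?f //; try exact: leq_trans LR _.
by apply: glob_frame f gl; apply: leq_trans LR _.
Qed.

(** * Membership and walks in the live set *)

Section Live.
Variables (i : nat) (wl sl : seq nat) (lim bnd : nat).
Hypotheses (swl : size wl <= k.*2.+2) (ssl : size sl <= k.*2.+2).
Hypothesis lim_le : lim <= n * tour_len n'.
Local Notation F := (old_graph n' i wl).
Local Notation Z := (live e bnd F sl lim).
Local Notation ctx := (live_ctx i wl sl lim bnd).

Lemma mem_live_spec h (x : 'I_n) : ctx h -> h 16 = x ->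
  hwp mem_live (fun h' => h' 17 = (x \in Z) /\ frame 18 h h') (G ^ 12) h.
Proof.
move=> cx hx; have gl := live_glob cx; have M1 := M1000.
eapply hwp_time.
  apply: hwp_seq; apply: asgP => //=; apply: hwp_seq; apply: hwp_call.
    apply: (@mem_array_spec 2 sl) => //; rewrite /upd /= ?(glob_k gl) ?hx //.
    by apply: (arr_frame (L := 1)) (glob_s gl) => //; apply: frame_upd.
  move=> h1 [h11 f1]; rewrite /upd /= in h11.
  have h1x : h1 16 = x by rewrite f1.
  have h1b : h1 rBnd = bnd by rewrite f1 //= /upd /= (live_bnd cx).
  have f01 : frame 3 h h1 by apply: (frame_trans _ f1); apply: frame_upd.
  apply: hwp_seq; apply: asgP => //=.
    by oks; move: M1; case: (_ < _); case: (h1 1) => [|[|v]] /=; clear; pow_lia.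
  rewrite h11 h1x h1b hx.
  apply: hwp_seq; apply: asgP => //; rewrite /= /upd /= -/(upd _ _ _) h1x.
  name_state h2; have f02 : frame 18 h h2.
    by rewrite /h2; do 2 apply: frame_upd => //; apply: frame_le f01.
  apply: hwp_seq; apply: hwp_call.
    apply: (mem_visited_spec (i := i) (wl := wl) (sl := sl) (lim := lim) (x := x)) => //.
      by apply: (@glob_frame 18) gl.
    by rewrite f02 //; apply: live_lim cx.
  move=> h3 [h3v f3].
  have h317 : h3 17 = (x < bnd) * (1 - (x.+1 \in sl)) by rewrite f3.
  apply: asgP => //=.
    rewrite h317 h3v; oks; move: M1; case: (x < bnd); case: (_ \in sl); case: (x \in visited _ _ _) => /=; clear; pow_lia.
  split; last by apply: frame_upd => //; apply: (frame_trans f02 (frame_le _ f3)).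
  rewrite upd_eq h317 h3v /live !in_setD in_vset in_below.
  by case: (x < bnd); case: (_ \in sl); case: (x \in visited _ _ _).
apply: seq_time; move: (@expG_le 1 11 isT) (expG_gt0 11) => /=; rewrite expn1; clear.
by move: (1000 * _) => X; pow_lia.
Qed.

Lemma step_live_spec h (p c : 'I_n) : ctx h -> h 18 = p -> h 19 = c ->
  hwp step_live (fun h' => [/\ h' 18 = c, h' 19 = nxt e Z p c & frame 23 h h']) (G ^ 14) h.
Proof.
apply: (walk_step_spec (Inv := ctx)) => //.
- by move=> h1 h2 f; apply: live_frame f.
- by move=> h1 [[]].
- exact: mem_live_spec.
Qed.

Section Count.
Variables (test : cmd) (v : 'I_n) (P : 'I_n -> pred 'I_n).
(** A test may change only the cells 0, 1, 2 and 23, so that the walk in progress survives it. *)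
Hypothesis test_spec : forall h (u c : 'I_n), ctx h -> h 27 = v -> h 24 = u -> h 19 = c ->
  hwp test (fun h' => h' 23 = P u c /\ forall j, 3 <= j -> j != 23 -> h' j = h j) (G ^ 2) h.

Lemma count_linked_spec h : ctx h -> h 27 = v ->
  hwp (count_linked test) (fun h' => h' 28 = linked e Z v P /\ frame 29 h h') (G ^ 19) h.
Proof.
move=> cx hv; have gl := live_glob cx; have M1 := M1000; have Ml := M_lin; have Msq := M_sq.
pose f q := [&& e v (inord q), inord q \in Z & hits e Z (inord q) (P (inord q))].
pose cf j := count f (iota 0 j).
have cfS j : cf j.+1 = cf j + f j by rewrite /cf iota0S -cats1 count_cat /= addn0.
have cfn : cf n <= n by rewrite -[X in _ <= X](size_iota 0 n) count_size.
pose I j h' := [/\ frame 29 h h', h' 27 = v & h' 28 + cf j = cf n].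
eapply hwp_time.
  apply: hwp_seq; apply: asgP => //=; apply: (forP (N := n) (I := I)) => //.
  - by rewrite /= /upd /= (glob_n gl).
  - by split=> //; do 2 apply: frame_upd => //.
  - move=> q h1 qn [f1 h1v h1c] hr.
    have h1n : h1 rN = n by rewrite f1 ?(glob_n gl).
    have [u uE] : exists u : 'I_n, u = inord q by exists (inord q).
    have qu : q = u by rewrite uE inordK.
    have uv : v * n <= n * n by rewrite leq_mul2r ltnW ?orbT.
    apply: ifsP => //.
    + by rewrite /= /upd /= h1v h1n; move: uv qn Ml Msq M1; clear; oks.
    + rewrite /= /upd /= h1v h1n {1}qu inp_adj => evu.
      apply: hwp_seq; apply: asgP => //; rewrite /= /upd /= -/(upd _ _ _).
      apply: hwp_seq; apply: hwp_call.
        apply: (mem_live_spec (x := u)); last by rewrite /upd /= qu.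
        by apply: (@live_frame 29) cx => //; do 2 apply: frame_upd => //.
      move=> h2 [h2Z f2].
      have [h2q h2v h2c] : [/\ h2 24 = q, h2 27 = v & h2 28 = h1 28] by split; rewrite f2.
      have f02 : frame 29 h h2.
        by apply: (frame_trans _ (frame_le _ f2)) => //; do 2 apply: frame_upd => //.
      apply: ifsP => //; rewrite /= h2Z => uZ.
      * have {}uZ : u \in Z by move: uZ; case: (u \in Z).
        do 3 (apply: hwp_seq; apply: asgP => //); rewrite /= /upd /= -/(upd _ _ _) h2q.
        name_state h3.
        apply: hwp_seq.
        pose T := tour_len n'.
        (* This invariant describes the [T - j] positions already tested, because walks advance
           while the counter falls. *)
        pose J j h' := [/\ frame 29 h h', [/\ h' 27 = v, h' 24 = u & h' 28 = h1 28] &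
          exists2 pc : 'I_n * 'I_n, [/\ h' 18 = pc.1, h' 19 = pc.2 & pc = iter (T - j) (wstep e Z) (u, u)] &
          exists2 b : bool, h' 25 = b & b = has (fun l => P u (walk e Z u l)) (iota 0 (T - j))].
        apply: (forP (N := T) (I := J)) => //.
        - by rewrite /= /h3 /upd /= f02 ?(glob_n gl) //; move: Ml Msq M1; clear; oks.
        - by rewrite /= /h3 /upd /= f02 ?(glob_n gl) ?tourE.
        - split.
          + by rewrite /h3; do 4 apply: frame_upd => //.
          + by rewrite /h3 /upd /= h2q.
          + exists (u, u); first by rewrite /h3 /upd /= qu subnn.
            by exists false => //; rewrite subnn.
        - move=> j h4 jT [f4 [h4v h4u h4c] [[p c] [h4p h4q pcE] [b h4b bE]]] hr4.
          have TjS : T - j = (T - j.+1).+1 by rewrite subnSK.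
          have cE : c = walk e Z u (T - j.+1) by rewrite /walk -pcE.
          apply: hwp_seq; apply: hwp_call.
            apply: (test_spec (u := u) (c := c)) => //.
            by apply: (@live_frame 29) cx => //; apply: frame_upd.
          move=> h5 [h5t f5].
          have f05 : frame 29 h h5.
            move=> l l29; rewrite f5; last by rewrite neq_ltn (leq_trans _ l29) ?orbT.
              by rewrite upd_neq ?f4 // neq_ltn (leq_trans _ l29) ?orbT.
            exact: leq_trans l29.
          have [h5v h5u h5c] : [/\ h5 27 = v, h5 24 = u & h5 28 = h1 28] by split; rewrite f5.
          have [h5p h5q h5j] : [/\ h5 18 = p, h5 19 = c & h5 26 = j] by split; rewrite f5.
          have h5b : h5 25 = b by rewrite f5.
          have step6 h6 : frame 29 h h6 -> [/\ h6 27 = v, h6 24 = u & h6 28 = h1 28] ->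
              [/\ h6 18 = p, h6 19 = c & h6 26 = j] -> h6 25 = b || P u c ->
              hwp step_live (fun h' => h' 26 = j /\ J j h') (G ^ 14) h6.
            move=> f6 [h6v h6u h6c] [h6p h6q h6j] h6b; apply: hwp_call.
              by apply: (step_live_spec (p := p) (c := c)) => //; apply: (@live_frame 29) cx.
            move=> h7 [h7p h7q f7]; split; first by rewrite f7.
            split; first exact: (frame_trans f6 (frame_le _ f7)).
              by split; rewrite f7.
            exists (c, nxt e Z p c); first by split; rewrite // TjS iterS -pcE.
            exists (b || P u c); first by rewrite f7.
            by rewrite TjS iota0S has_rcons -cE bE orbC.
          apply: hwp_seq; apply: ifsP => //; rewrite /= h5t => Pc.
            apply: asgP => //=; apply: step6.
            + exact: frame_upd.
            + by [].
            + by [].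
            + by rewrite /upd /=; move: Pc; case: (P u c) => //; rewrite orbT.
          apply: hwp_skip; apply: step6 => //.
          by rewrite h5b; move: Pc; case: (P u c) => //; rewrite orbF.
        - move=> h4 [f4 [h4v h4u h4c] [[p c] [h4p h4q pcE] [b h4b bE]]] _.
          have fq : f q = b.
            rewrite /f -uE; have -> : e v u by move: evu; case: (e v u).
            by rewrite uZ /= bE subn0.
          rewrite cfS fq in h1c.
          apply: asgP => //=; rewrite h4c h4b.
            by move: h1c cfn Ml M1; clear; oks.
          split; first by rewrite /upd /= h4u.
          split=> //; first exact: frame_upd.
          by rewrite /upd /= -h1c; clear; lia.
      * apply: hwp_skip; split=> //; split=> //; rewrite h2c -h1c cfS /f -uE.
        by move: uZ; case: (u \in Z) => // _; rewrite /= andbF addn0.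
    + rewrite /= /upd /= h1v h1n {1}qu inp_adj => evu; apply: hwp_skip.
      split=> //; split=> //; first exact: frame_upd.
      by rewrite /upd /= -h1c cfS /f -uE; move: evu; case: (e v u) => // _; rewrite addn0.
  - by move=> h1 [f1 h1v h1c] _; split=> //; rewrite -[linked _ _ _ _]/(cf n) -h1c addn0.
set B := (X in tour_len n' * (X + 7)).
have H : tour_len n' * (B + 7) <= 100 * G ^ 16.
  apply: (@loop_time 2 14); first exact: tour_le_G.
  by rewrite /B /=; move: (expG_gt0 14) (@expG_le 2 14 isT); clear; pow_lia.
move: (tour_len n' * (B + 7)) H => {B} X H.
set B := (X in n * (X + 7)).
have H' : n * (B + 7) <= 100 * G ^ 18.
  apply: (@loop_time 1 17); first exact: n_le_G.
  apply: (@leq_trans (G ^ 17)); last by rewrite -[X in X <= _]mul1n leq_mul2r orbT.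
  apply: seq_time; rewrite /B /=; move: H (expG_gt0 16) (@expG_le 12 16 isT); clear.
  by pow_lia.
move: (n * (B + 7)) H' => {B} Y H'.
apply: seq_time; move: H' (expG_gt0 18) => /=; clear.
by pow_lia.
Qed.

End Count.
Lemma test_root_spec v h (u c : 'I_n) : ctx h -> h 27 = v -> h 24 = u -> h 19 = c ->
  hwp test_root (fun h' => h' 23 = (c \in vset n' wl) /\ forall j, 3 <= j -> j != 23 -> h' j = h j)
    (G ^ 2) h.
Proof.
move=> cx _ _ hc; have gl := live_glob cx; eapply hwp_time.
  apply: hwp_seq; apply: asgP => //=; apply: hwp_seq; apply: hwp_call.
    apply: (@mem_array_spec 0 wl) => //; rewrite /upd /= ?(glob_k gl) ?hc //.
    by apply: (arr_frame (L := 1)) (glob_w gl) => //; apply: frame_upd.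
  move=> h1 [h11 f1]; apply: asgP => //=; split.
    by rewrite upd_eq h11 /upd /= hc in_vset.
  move=> j j3 j23; rewrite upd_neq // f1 // upd_neq //.
  by rewrite neq_ltn (leq_trans _ j3) ?orbT.
by apply: seq_time; rewrite expn1 /=; clear; lia.
Qed.

Lemma test_nbr_spec (v : 'I_n) h (u c : 'I_n) : ctx h -> h 27 = v -> h 24 = u -> h 19 = c ->
  hwp test_nbr (fun h' => h' 23 = (c != u) && e v c /\ forall j, 3 <= j -> j != 23 -> h' j = h j)
    (G ^ 2) h.
Proof.
move=> cx hv hu hc; have hn := glob_n (live_glob cx).
have M1 := M1000; have Ml := M_lin; have Msq := M_sq.
have lt : v * n <= n * n by rewrite leq_mul2r ltnW ?orbT.
have cn := ltn_ord c.
eapply hwp_time.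
  apply: asgP => //=; rewrite hv hu hc hn inp_adj.
    split; [by [] | by move: lt cn M1 Msq Ml; clear; oks |].
    by move: M1; case: (c == u :> nat); case: (e v c) => /=; clear; pow_lia.
  split; last by move=> j j3 j23; rewrite upd_neq.
  by rewrite upd_eq (inj_eq val_inj); case: (c == u); case: (e v c).
by apply: seq_time; rewrite expn1 /=; clear; lia.
Qed.

End Live.

Lemma arr_upd_reg q l h r v : r < regs -> arr q l h -> arr q l (upd h r v).
Proof. by move=> rR ar j jk; rewrite /upd eq_sym addr_reg // ar. Qed.

Lemma arr_upd_other q q' l h j v : q < 4 -> q' < 4 -> q != q' ->
  arr q l h -> arr q l (upd h (addr q' j) v).
Proof. by move=> q4 q4' nq ar l' lk; rewrite /upd addr_inj // (negPf nq) ar. Qed.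

Lemma arr_push q l h v : q < 4 -> arr q l h -> arr q (rcons l v) (upd h (addr q (size l)) v).
Proof.
move=> q4 ar j jk; rewrite /upd addr_inj // eqxx nth_rcons /=.
case: ltngtP => // lt; rewrite ar //.
by rewrite nth_default // ltnW.
Qed.

(** What a simulation preserves. A [frame] condition cannot say this, since the arrays that change
    are interleaved with those that do not. *)
Record keep h h' : Prop := Keep {
  keep_reg : forall j, 37 <= j -> j < regs -> h' j = h j;
  keep_w : forall j, h' (addr 0 j) = h (addr 0 j);
  keep_x : forall j, h' (addr 1 j) = h (addr 1 j) }.

Lemma keep_trans h1 h2 h3 : keep h1 h2 -> keep h2 h3 -> keep h1 h3.
Proof.
move=> [r12 w12 x12] [r23 w23 x23]; split=> j *; rewrite ?w23 ?x23 ?w12 ?x12 //.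
by rewrite r23 ?r12.
Qed.

Lemma keep_frame L h h' : L <= 37 -> frame L h h' -> keep h h'.
Proof.
move=> L37 f; split=> j *; apply: f; first exact: leq_trans L37 _.
- by apply: leq_trans (regs_addr _ _); apply: leq_trans L37 _.
- by apply: leq_trans (regs_addr _ _); apply: leq_trans L37 _.
Qed.

Lemma keep_upd_reg h h' r v : r < 37 -> keep h h' -> keep h (upd h' r v).
Proof.
move=> r37 kp; apply: (keep_trans kp); apply: (@keep_frame 37) => //.
exact: frame_upd.
Qed.

Lemma keep_upd_addr h h' q j v : 1 < q -> q < 4 -> keep h h' -> keep h (upd h' (addr q j) v).
Proof.
move=> q1 q4 [kr kw kx]; split=> l *.
- by rewrite /upd addr_reg // kr.
- by rewrite /upd addr_inj // kw; case: q q1 {q4} => [|[]].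
- by rewrite /upd addr_inj // kx; case: q q1 {q4} => [|[]].
Qed.

Lemma cell_ok q j h a : q < 4 -> j < k.*2.+2 -> ev inp h a = j -> ok w s inp h a ->
  ok w s inp h (cell q a) /\ stack + ev inp h (cell q a) < s.
Proof.
move=> q4 jk aE oka; have Ml := M_lin; rewrite /= aE; split.
  by split=> //; [split=> // | rewrite /regs]; move: k_lt; lia.
by rewrite s_def /stack /regs; move: k_lt; lia.
Qed.

Lemma cell_ev q j h a : ev inp h a = j -> ev inp h (cell q a) = addr q j.
Proof. by move=> E; rewrite -E. Qed.

Lemma slotsE h : h rK = k -> ok w s inp h slots /\ ev inp h slots = k.*2.+2.
Proof.
by move=> hk; rewrite /= hk; have := M_lin; move: k_lt => kn Ml; split; [oks|lia].
Qed.

Lemma clear_spec h : h rK = k ->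
  hwp clear_arrays (fun h' => [/\ keep h h', arr 2 [::] h' & arr 3 [::] h']) (G ^ 2) h.
Proof.
move=> hk; have [oks_ sE] := slotsE hk.
pose I j h' := keep h h' /\ forall l, j <= l -> l < k.*2.+2 -> h' (addr 2 l) = 0 /\ h' (addr 3 l) = 0.
eapply hwp_time.
  apply: (forP (N := k.*2.+2) (I := I)) => //.
  - split; first by apply: keep_upd_reg.
    by move=> l jl lk; move: jl; rewrite leqNgt lk.
  - move=> j h1 jk [kp hz] hr.
    have rE (h' : Defs.mem) : h' 29 = j -> ok w s inp h' (cell 2 #29) /\ stack + ev inp h' (cell 2 #29) < s.
      by move=> ?; apply: (@cell_ok 2 j).
    have rE3 (h' : Defs.mem) : h' 29 = j -> ok w s inp h' (cell 3 #29) /\ stack + ev inp h' (cell 3 #29) < s.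
      by move=> ?; apply: (@cell_ok 3 j).
    apply: hwp_seq; apply: stoP => //; try by case: (rE (upd h1 29 j)); rewrite ?upd_eq.
    rewrite (@cell_ev 2 j) /=; last by rewrite upd_eq.
    set h2 := upd _ (addr 2 j) 0.
    have h2j : h2 29 = j by rewrite /h2 /upd addr_reg.
    apply: stoP => //; try by case: (rE3 h2).
    rewrite (@cell_ev 3 j) //; split; first by rewrite /upd addr_reg.
    split.
      by apply: keep_upd_addr => //; apply: keep_upd_addr => //; apply: keep_upd_reg.
    move=> l jl lk; rewrite /h2 /upd !addr_inj //= !(eq_sym _ 29) !addr_reg //.
    have [_|nlj] := eqVneq l j => //.
    by apply: hz => //; rewrite ltn_neqAle eq_sym nlj.
  - move=> h1 [kp hz] _; split=> // j jk; rewrite nth_nil; by case: (hz j).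
set B := (X in _ * (X + 7)).
have H : k.*2.+2 * (B + 7) <= 100 * G ^ 1.
  rewrite expn1 /B /=; move: k_lt; clear; nia.
by apply: seq_time; move: H; rewrite expn1 /=; clear; lia.
Qed.

Lemma arr_keep q l h h' : q < 2 -> keep h h' -> arr q l h -> arr q l h'.
Proof.
by case: q => [|[|//]] _ kp ar j jk; rewrite ?(keep_w kp) ?(keep_x kp) ar.
Qed.

Lemma push_spec a sl v h : h rK = k -> h rCnt = size sl -> size sl <= k -> arr 2 sl h ->
  wf 0 a -> ok w s inp h a -> ev inp h a = v ->
  let sl' := if size sl < k then rcons sl v else sl in
  hwp (push a) (fun h' => [/\ h' rCnt = size sl', size sl' <= k, arr 2 sl' h',
      forall j, j < regs -> j != rCnt -> h' j = h j &
      forall q j, q < 4 -> q != 2 -> h' (addr q j) = h (addr q j)]) (cost a + 30) h.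
Proof.
move=> hk hc sk ar wfa oka av sl'; have Ml := M_lin.
have kn := k_lt.
eapply hwp_time.
  apply: ifsP => //; rewrite /= hc hk => cond.
  - have lt : size sl < k by move: cond; case: (_ < _).
    have [ok2 st2] := @cell_ok 2 (size sl) h #rCnt isT ltac:(lia) hc I.
    apply: hwp_seq; apply: stoP => //.
    rewrite (@cell_ev 2 (size sl)) // av; set h1 := upd _ _ _.
    have h1c : h1 rCnt = size sl by rewrite /h1 /upd addr_reg.
    apply: asgP => //=; rewrite h1c; first by oks.
    rewrite /sl' lt size_rcons; split=> //.
    + by rewrite upd_eq addn1.
    + by apply: arr_upd_reg => //; apply: arr_push.
    + by move=> j jR jc; rewrite upd_neq // /h1 /upd addr_reg.
    + by move=> q j q4 q2; rewrite /h1 /upd eq_sym addr_reg // addr_inj // (negPf q2).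
  - have -> : sl' = sl by rewrite /sl'; move: cond; case: (_ < _).
    by apply: hwp_skip.
rewrite /=; clear; lia.
Qed.

Lemma read_digits_spec x wl h : h rK = k -> arr 0 wl h ->
  (forall j, j <= k -> h (addr 1 j) = x j) -> arr 2 [::] h -> arr 3 [::] h ->
  hwp read_digits (fun h' => let st := downto (init_step wl k x) k.+1 ([::], [::]) in
    [/\ h' rCnt = size st.1, size st.1 <= k, arr 2 st.1 h', arr 3 st.2 h' & keep h h']) (G ^ 2) h.
Proof.
move=> hk arw hx ar2 ar3; set fin := downto _ _ _; have Ml := M_lin; have kn := k_lt.
(* Each index stores at most two bits; the bound on [size st.2] keeps the writes inside the 2k + 2
   slots. *)
pose Iv j h' := keep h h' /\ exists2 st : seq nat * seq nat,
  [/\ h' rCnt = size st.1, size st.1 <= k, arr 2 st.1 h', arr 3 st.2 h' & h' rYc = size st.2] &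
  size st.2 <= (k.+1 - j).*2 /\ downto (init_step wl k x) j st = fin.
eapply hwp_time.
  apply: hwp_seq; apply: asgP => //=; apply: hwp_seq; apply: asgP => //=.
  apply: (forP (N := k.+1) (I := Iv)) => //.
  - by rewrite /= /upd /= hk; oks.
  - by rewrite /= /upd /= hk addn1.
  - split; first by do 3 apply: keep_upd_reg => //.
    exists ([::], [::]); last by rewrite subnn.
    by split=> //; do 3 apply: arr_upd_reg => //.
  - move=> j h1 jk [kp [[sl ys] [/= h1c ssl h1s h1y h1yc] [sys fE]]] hr.
    have jk2 : j < k.*2.+2 by move: jk; clear; lia.
    have h1k : h1 rK = k by rewrite (keep_reg kp).
    apply: hwp_seq; apply: asgP => //.
      by have [ok2 st2] := @cell_ok 1 j (upd h1 29 j) #29 isT jk2 (upd_eq _ _ _) I.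
    have -> : ev inp (upd h1 29 j) (Ld (cell 1 #29)) = x j.
      rewrite -hx // -(keep_x kp) /= upd_eq -/(addr 1 j).
      by rewrite /upd eq_sym addr_reg.
    name_state h2.
    have kp2 : keep h h2 by do 2 apply: keep_upd_reg => //.
    have h2j : h2 29 = j by [].
    have h2s : arr 2 sl h2 by do 2 apply: arr_upd_reg => //.
    have h2y : arr 3 ys h2 by do 2 apply: arr_upd_reg => //.
    have h2w : arr 0 wl h2 by apply: arr_keep kp2 arw.
    have h2yc : h2 rYc = size ys by [].
    have szy : (size ys).+1 < k.*2.+2 by move: sys jk; clear; lia.
    apply: ifsP => //; rewrite /= -/(h2 30) => cond.
    + have [o1 s1] := @cell_ok 3 (size ys) h2 #rYc isT (ltnW szy) h2yc I.
      apply: hwp_seq; apply: stoP => //.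
      rewrite (@cell_ev 3 (size ys)) //= -/(h2 30).
      set y1 := (x j - 1) %% 2; set h3 := upd h2 _ y1.
      have h3yc : h3 rYc = size ys by rewrite /h3 /upd addr_reg.
      have h3x : h3 30 = x j by rewrite /h3 /upd addr_reg.
      have e3 : ev inp h3 (#rYc +! $1) = (size ys).+1 by rewrite /= h3yc addn1.
      have [o2 s2] : ok w s inp h3 (cell 3 (#rYc +! $1)) /\ stack + ev inp h3 (cell 3 (#rYc +! $1)) < s.
        by apply: (@cell_ok 3 _ _ _ isT szy e3); rewrite /= h3yc; move: szy; oks.
      apply: hwp_seq; apply: stoP => //.
      rewrite (@cell_ev 3 (size ys).+1) //= h3x.
      set y2 := (x j - 1) %/ 2; set h4 := upd h3 _ y2.
      have h4yc : h4 rYc = size ys by rewrite /h4 /upd addr_reg.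
      apply: asgP => //=; rewrite h4yc; first by move: szy; oks.
      split; first by rewrite /h4 /h3 /upd /= !addr_reg.
      split.
        apply: keep_upd_reg => //; rewrite /h4 /h3.
        by do 2 apply: keep_upd_addr => //.
      exists (sl, ys ++ [:: y1; y2]) => /=.
        split=> //.
        * by rewrite /h4 /h3 /upd /= !addr_reg.
        * apply: arr_upd_reg => //; rewrite /h4 /h3.
          by do 2 apply: arr_upd_other => //.
        * apply: arr_upd_reg => //; rewrite /h4 -(size_rcons ys y1).
          have -> : ys ++ [:: y1; y2] = rcons (rcons ys y1) y2 by rewrite -2!cats1 -catA.
          by apply: arr_push => //; apply: arr_push.
        * by rewrite upd_eq size_cat.
      rewrite size_cat /=; split; first by move: sys jk; clear; lia.
      rewrite -fE /=; congr downto; rewrite /init_step ifF; last by apply: negPf.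
      by rewrite /y1 /y2 subn1.
    + have av : ev inp h2 (Ld (cell 0 #29)) = nth 0 wl j.
        by rewrite -h2w // /= -/(h2 29).
      have [o1 s1] := @cell_ok 0 j h2 #29 isT jk2 h2j I.
      apply: hwp_call; first by apply: (push_spec (sl := sl) (v := nth 0 wl j)) => //; rewrite /h2 /upd /=.
      move=> h3 [h3c h3sz h3s h3r h3a].
      split; first by rewrite h3r.
      have kp3 : keep h h3.
        split=> [l l37 lR|l|l]; rewrite ?h3a ?(keep_w kp2) ?(keep_x kp2) //.
        by rewrite h3r ?(keep_reg kp2) // neq_ltn (leq_trans _ l37) ?orbT.
      split=> //; exists (if size sl < k then rcons sl (nth 0 wl j) else sl, ys) => /=.
        split=> //; last by rewrite h3r.
        by move=> l lk; rewrite h3a // h2y.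
      split; first by move: sys; clear; lia.
      by have xj0 : x j = 0 := cond; rewrite -fE /= xj0.
  - move=> h1 [kp [[sl ys] [/= h1c ssl h1s h1y h1yc] [sys fE]]] _.
    by rewrite -fE.
set B := (X in _ * (X + 7)).
have H : k.+1 * (B + 7) <= 100 * G ^ 1.
  rewrite expn1 /B /=; move: k_lt; clear; nia.
by apply: seq_time; move: H; rewrite expn1 /=; clear; lia.
Qed.

(** * One simulation for a fixed digit string *)

Section Simulation.
Variables (i : nat) (wl ys : seq nat) (h0 : Defs.mem).
Hypotheses (swl : size wl <= k.*2.+2) (h0n : h0 rN = n) (h0k : h0 rK = k) (h0i : h0 rI = i).
Hypothesis h0w : arr 0 wl h0.
Local Notation F := (old_graph n' i wl).

Record sim_ctx (st : seq nat * nat) h : Prop := SimCtx {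
  sim_keep : keep h0 h;
  sim_bnd : h rBnd = i;
  sim_y : arr 3 ys h;
  sim_s : arr 2 st.1 h;
  sim_cnt : h rCnt = size st.1;
  sim_size : size st.1 <= k;
  sim_bp : h rBp = st.2;
  sim_bp_le : st.2 <= k.*2.+2 }.

Lemma sim_frame L st h h' : L <= 31 -> frame L h h' -> sim_ctx st h -> sim_ctx st h'.
Proof.
move=> LR f [kp hb hy hs hc hz hp hpl].
have LR' : L <= regs by apply: leq_trans LR _.
split=> //; rewrite ?f //; try exact: leq_trans LR _.
- by apply: (keep_trans kp); apply: keep_frame f; apply: leq_trans LR _.
- exact: arr_frame f hy.
- exact: arr_frame f hs.
Qed.

Lemma sim_glob st h : sim_ctx st h -> glob i wl st.1 h.
Proof.
case=> kp _ _ hs _ _ _ _; split; rewrite ?(keep_reg kp) //.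
exact: arr_keep kp h0w.
Qed.

Lemma process_vertex_spec sl bp h t (v : 'I_n) : sim_ctx (sl, bp) h -> h 29 = t -> h 30 = v ->
  t < n * tour_len n' ->
  hwp process_vertex (fun h' => h' 29 = t /\ sim_ctx
    (if (1 < linked e (live e i F sl t.+1) v (fun _ x => x \in vset n' wl)) && (bp < k.*2.+2)
     then (if (nth 0 ys bp != 0) && (size sl < k) then rcons sl v.+1 else sl, bp.+1)
     else (sl, bp)) h') (G ^ 20) h.
Proof.
move=> sc ht hv tl; have Ml := M_lin; have Mc := M_cube; have kn := k_lt; have M1 := M1000.
have tM : t.+1 < M.
  by move: tl Mc; rewrite /tour_len; clear; move: (n * _.+1) => X; pow_lia.
have ssl2 : size sl <= k.*2.+2 by have := sim_size sc; clear; move: (size _) => ? /=; lia.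
eapply hwp_time.
  apply: hwp_seq; apply: asgP => //=; first by rewrite ht addn1; oks.
  rewrite ht addn1; apply: hwp_seq; apply: asgP => //=.
  name_state h1.
  have h1v : h1 27 = v by rewrite /h1 /upd /= hv.
  have h1t : h1 29 = t by rewrite /h1 /upd.
  have sc1 : sim_ctx (sl, bp) h1.
    case: sc => kp hb hy hs hc hz hp hpl; split=> //.
    + by do 2 apply: keep_upd_reg => //.
    + by do 2 apply: arr_upd_reg => //.
    + by do 2 apply: arr_upd_reg => //.
  have lc : live_ctx i wl sl t.+1 i h1.
    by split; [exact: (sim_glob sc1) | | exact: sim_bnd sc1].
  apply: hwp_seq; apply: hwp_call.
    apply: (count_linked_spec swl ssl2 tl (P := fun _ x => x \in vset n' wl) _ lc h1v).
    by move=> h' u c cx hv' hu hc; apply: test_root_spec cx hv' hu hc.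
  move=> h2 [h2c f2].
  set c := linked _ _ _ _ in h2c *.
  have sc2 : sim_ctx (sl, bp) h2 by apply: sim_frame f2 sc1.
  have h2t : h2 29 = t by rewrite f2.
  have h2v : h2 30 = v by rewrite f2 //= /h1 /upd /= hv.
  have h2k : h2 rK = k by rewrite (keep_reg (sim_keep sc2)).
  have [oS eS] := slotsE h2k.
  have cE : ev inp h2 (($1 <! #28) *! (#rBp <! slots)) = (1 < c) && (bp < k.*2.+2).
    by rewrite /= -[h2 41 * 2 + 2]/(ev inp h2 slots) eS h2c (sim_bp sc2) mulnb.
  apply: ifsP => //.
  - split=> //; rewrite -[ev inp h2 ($1 <! #28) * _]/(ev inp h2 (($1 <! #28) *! (#rBp <! slots))) cE.
    by move: M1; case: (_ && _); clear; pow_lia.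
  - rewrite cE => cond.
    have {}cond : (1 < c) && (bp < k.*2.+2) by move: cond; case: (_ && _).
    rewrite cond; have bpk : bp < k.*2.+2 by case/andP: cond.
    apply: hwp_seq; apply: asgP => //=.
      by rewrite h2v; have := ltn_ord v; move: Ml; clear; oks; pow_lia.
    rewrite h2v addn1; name_state h3.
    have sc3 : sim_ctx (sl, bp) h3.
      case: sc2 => kp hb hy hs hc hz hp hpl; split=> //.
      + exact: keep_upd_reg.
      + exact: arr_upd_reg.
      + exact: arr_upd_reg.
    have h3p : h3 rBp = bp := sim_bp sc3.
    have [o3 s3] := @cell_ok 3 bp h3 #rBp isT bpk h3p I.
    have yE : ev inp h3 (Ld (cell 3 #rBp)) = nth 0 ys bp.
      by rewrite -(sim_y sc3) // /= h3p.
    set sl' := (if _ && _ then _ else sl).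
    have fin h4 : h4 29 = t -> sim_ctx (sl', bp) h4 ->
        hwp (rBp <- #rBp +! $1) (fun h' => h' 29 = t /\ sim_ctx (sl', bp.+1) h') 7 h4.
      move=> h4t sc4; have h4p := sim_bp sc4; rewrite /= in h4p.
      eapply hwp_time.
        apply: asgP => //=; rewrite h4p; first by move: bpk kn Ml; clear; oks; pow_lia.
        case: sc4 => kp hb hy hs hc hz hp hpl; split=> //; split=> //.
        + exact: keep_upd_reg.
        + exact: arr_upd_reg.
        + exact: arr_upd_reg.
        + by rewrite /= upd_eq addn1.
      by [].
    apply: hwp_seq; apply: ifsP => //; rewrite yE => Yb.
    + apply: hwp_call.
        apply: (push_spec (sl := sl) (v := v.+1)); [| | | | by [] | by [] | by []].
        * by rewrite (keep_reg (sim_keep sc3)).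
        * exact: sim_cnt sc3.
        * exact: sim_size sc3.
        * exact: sim_s sc3.
      move=> h4 [h4c h4z h4s h4r h4a]; apply: fin; first by rewrite h4r.
      have -> : sl' = if size sl < k then rcons sl v.+1 else sl by rewrite /sl' Yb.
      case: sc3 => kp hb hy hs hc hz hp hpl; split=> //=; rewrite ?h4r //.
      * split=> [l l37 lR|l|l]; rewrite ?h4a ?(keep_w kp) ?(keep_x kp) //.
        by rewrite h4r ?(keep_reg kp) // neq_ltn (leq_trans _ l37) ?orbT.
      * by move=> l lk; rewrite h4a // hy.
    + apply: hwp_skip; apply: fin => //.
      by rewrite /sl' Yb.
  - rewrite cE => cond; apply: hwp_skip.
    have -> : (1 < c) && (bp < k.*2.+2) = false by move: cond; case: (_ && _).
    by [].
apply: seq_time; move: (expG_gt0 19) => /=; clear; pow_lia.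
Qed.

Lemma process_forest_spec sl h : keep h0 h -> arr 3 ys h -> arr 2 sl h -> h rCnt = size sl ->
  size sl <= k ->
  hwp process_forest (fun h' => arr 2
      (downto (sim_step e i wl k (nth 0 ys)) (n * tour_len n') (sl, 0)).1 h' /\ keep h0 h')
    (G ^ 24) h.
Proof.
move=> kp hy hs hc hz; have Ml := M_lin; have Mc := M_cube; have Msq := M_sq; have M1 := M1000.
set fin := downto _ _ _.
have [hn hi] : h rN = n /\ h rI = i by split; rewrite (keep_reg kp).
(* Running the remaining [j] abstract steps from the state in memory gives the fixed final state. *)
pose Iv j h' := exists2 st, sim_ctx st h' & downto (sim_step e i wl k (nth 0 ys)) j st = fin.
eapply hwp_time.
  apply: hwp_seq; apply: asgP => //=; apply: hwp_seq; apply: asgP => //=.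
  apply: (forP (N := n * tour_len n') (I := Iv)) => //.
  - by rewrite /= /upd /= hn addn1; move: Mc Msq M1; clear; oks; pow_lia.
  - by rewrite /= /upd /= hn tourE.
  - exists (sl, 0) => //; split=> //=.
    + by do 3 apply: keep_upd_reg => //.
    + by do 3 apply: arr_upd_reg => //.
    + by do 3 apply: arr_upd_reg => //.
  - move=> j h1 jN [[sl1 bp1] sc1 fE] hr.
    have sc2 : sim_ctx (sl1, bp1) (upd (upd h1 29 j) 10 j).
      by apply: (@sim_frame 31) sc1 => //; do 2 apply: frame_upd => //.
    apply: hwp_seq; apply: asgP => //=; rewrite upd_eq; apply: hwp_seq; apply: hwp_call.
      by apply: (position_spec (sim_glob sc2) swl (t := j)).
    move=> h2 [h2p f2].
    apply: hwp_seq; apply: asgP => //=; rewrite h2p.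
    name_state h3.
    have f3 : frame 31 (upd (upd h1 29 j) 10 j) h3 by apply: frame_upd => //; apply: frame_le f2.
    have sc3 : sim_ctx (sl1, bp1) h3 by apply: sim_frame f3 sc2.
    have h3t : h3 29 = j by rewrite /h3 /upd /= f2.
    have h3v : h3 30 = oapp val n (pos e F j) by [].
    have h3n : h3 rN = n by apply: glob_n (sim_glob sc3).
    have fE' : downto (sim_step e i wl k (nth 0 ys)) j
      (sim_step e i wl k (nth 0 ys) j (sl1, bp1)) = fin := fE.
    rewrite /sim_step in fE'.
    apply: ifsP => //; rewrite [ev _ _ _]/= h3v h3n => cond.
    + case posE: (pos e F j) fE' cond h3v => [v|] /= fE' cond h3v; last by rewrite ltnn in cond.
      apply: hwp_seq; apply: asgP => //=; rewrite h3t; apply: hwp_seq; apply: asgP => //=.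
      rewrite upd_neq // h3v; name_state h4.
      have gl4 : glob i wl sl1 h4.
        by apply: (@glob_frame 32) (sim_glob sc3) => //; do 2 apply: frame_upd => //.
      apply: hwp_seq; apply: hwp_call.
        by apply: (mem_visited_spec (lim := j) (x := v) gl4 swl) => //; apply: ltnW.
      move=> h5 [h5v f5].
      have sc5 : sim_ctx (sl1, bp1) h5.
        apply: (sim_frame _ f5) => //; rewrite /h4.
        case: sc3 => kp3 hb3 hy3 hs3 hc3 hz3 hp3 hpl3; split=> //.
        * by do 2 apply: keep_upd_reg => //.
        * by do 2 apply: arr_upd_reg => //.
        * by do 2 apply: arr_upd_reg => //.
      have h5t : h5 29 = j by rewrite f5.
      apply: ifsP => //; rewrite /= h5v => vis.
      * apply: hwp_skip; split=> //; exists (sl1, bp1) => //.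
        by move: fE'; have -> : v \in visited e F j by move: vis; case: (_ \in _).
      * have {}vis : (v \in visited e F j) = false by move: vis; case: (_ \in _).
        apply: hwp_call.
          by apply: (process_vertex_spec sc5 h5t _ jN); rewrite f5 //= /h4 /upd /= h3v.
        move=> h6 [h6t sc6]; split=> //; eexists; first exact: sc6.
        by move: fE'; rewrite vis.
    + apply: hwp_skip; split=> //; exists (sl1, bp1) => //.
      by case posE: (pos e F j) fE' cond => [v|] //= _; rewrite ltn_ord.
  - move=> h1 [st sc1 fE] _; rewrite -fE; split; [exact: sim_s sc1 | exact: sim_keep sc1].
set B := (X in _ * (X + 7)).
have H : n * tour_len n' * (B + 7) <= 100 * G ^ 23.
  apply: (@loop_time 3 20); first exact: tours_le_G.
  rewrite /B /=; move: (expG_gt0 20) (@expG_le 7 20 isT) (@expG_le 11 20 isT); clear; pow_lia.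
move: (n * tour_len n' * (B + 7)) H => {B} X H.
by apply: seq_time; move: H (expG_gt0 23) => /=; clear; pow_lia.
Qed.

End Simulation.

Lemma sim_spec i wl x h : size wl <= k.*2.+2 -> h rN = n -> h rK = k -> h rI = i -> arr 0 wl h ->
  (forall j, j <= k -> h (addr 1 j) = x j) ->
  hwp sim_code (fun h' => arr 2 (sim e i wl k x) h' /\ keep h h') (G ^ 25) h.
Proof.
move=> swl hn hk hi hw hx.
eapply hwp_time.
  apply: hwp_seq; apply: hwp_call; first exact: clear_spec.
  move=> h1 [kp1 ar2 ar3].
  apply: hwp_seq; apply: hwp_call.
    apply: (read_digits_spec (x := x) (wl := wl)) => //; first by rewrite (keep_reg kp1).
    + exact: arr_keep kp1 hw.
    + by move=> j jk; rewrite (keep_x kp1) hx.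
  move=> h2; rewrite /sim; case: (downto _ _ _) => sl ys [/= h2c h2z h2s h2y kp2].
  apply: (process_forest_spec (h0 := h)) => //.
  exact: keep_trans kp1 kp2.
apply: seq_time; move: (@expG_le 2 24 isT) (expG_gt0 24) => /=; clear; pow_lia.
Qed.

Lemma check_spec i wl sl h : glob i wl sl h -> size wl <= k.*2.+2 -> size sl <= k.*2.+2 ->
  i <= n ->
  hwp check_code (fun h' => h' rOk = check e i sl /\ frame 37 h h') (G ^ 22) h.
Proof.
move=> gl swl ssl lin.
pose P j := check e j sl.
have PS j : P j.+1 = check_vertex e sl (inord j) && P j by rewrite /P /check iota0S all_rcons.
pose Iv j h' := [/\ frame 37 h h', h' rLim = 0 & exists2 b : bool, h' rOk = b & b && P j = P i].
eapply hwp_time.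
  apply: hwp_seq; apply: asgP => //=; apply: hwp_seq; apply: asgP => //=.
  apply: (forP (N := i) (I := Iv)) => //.
  - by rewrite /= /upd /= (glob_i gl).
  - split=> //; first by do 3 apply: frame_upd => //.
    by exists true.
  - move=> j h1 ji [f1 h1l [b h1b bE]] hr.
    have [v vE] : exists v : 'I_n, v = inord j by exists (inord j).
    have jv : j = v by rewrite vE inordK // (leq_trans ji).
    have gl1 : glob i wl sl h1 by apply: glob_frame f1 gl.
    apply: hwp_seq; apply: asgP => //=; rewrite upd_eq.
    apply: hwp_seq; apply: hwp_call.
      apply: (@mem_array_spec 2 sl) => //; rewrite /upd /= ?(glob_k gl1) //; last by rewrite jv.
      by apply: (arr_frame (L := 30)) (glob_s gl1) => //; do 2 apply: frame_upd => //.
    move=> h2 [h2r f2]; rewrite /upd /= jv -in_vset in h2r.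
    have f02 : frame 37 h h2.
      by apply: (frame_trans _ (frame_le _ f2)) => //; do 2 apply: frame_upd => //.
    have [h2j h2l h2b] : [/\ h2 29 = j, h2 rLim = 0 & h2 rOk = b] by split; rewrite f2.
    apply: ifsP => //; rewrite /= h2r => cond.
    + apply: hwp_skip; split=> //; split=> //; exists b => //.
      rewrite -bE PS -vE /check_vertex.
      by have -> : v \in vset n' sl by move: cond; case: (_ \in _).
    + have {}cond : (v \in vset n' sl) = false by move: cond; case: (_ \in _).
      apply: hwp_seq; apply: asgP => //=; apply: hwp_seq; apply: asgP => //=.
      rewrite upd_neq // h2j; name_state h3.
      have f3 : frame 37 h h3 by do 2 apply: frame_upd => //.
      have lc : live_ctx i wl sl 0 v h3.
        by split; [apply: glob_frame f3 gl | | rewrite /h3 /upd /=].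
      apply: hwp_seq; apply: hwp_call.
        apply: (count_linked_spec swl ssl (leq0n _) (v := v) (P := fun u x => (x != u) && e v x) _ lc); last by rewrite /h3 upd_eq.
        by move=> h' u c cx hv' hu hc; apply: test_nbr_spec cx hv' hu hc.
      move=> h4 [h4c f4]; rewrite !live0E in h4c.
      have f04 : frame 37 h h4 by apply: (frame_trans f3); apply: frame_le f4.
      have [h4j h4l h4b] : [/\ h4 29 = j, h4 rLim = 0 & h4 rOk = b] by split; rewrite f4 //= /h3 /upd /=.
      rewrite PS -vE /check_vertex cond live0E /= in bE.
      apply: ifsP => //; rewrite /= h4c => lk.
      * apply: asgP => //=; split=> //; split=> //; first exact: frame_upd.
        by exists false => //; rewrite -bE (negPf lk) /= andbF.
      * apply: hwp_skip; split=> //; split=> //; exists b => //.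
        by rewrite -bE lk eqxx.
  - by move=> h1 [f1 _ [b h1b bE]] _; split=> //; rewrite h1b -/(P i) -bE /P /check /= andbT.
set B := (X in _ * (X + 7)).
have H : i * (B + 7) <= 100 * G ^ 20.
  apply: (@loop_time 1 19); first exact: leq_trans lin n_le_G.
  rewrite /B /=; move: (expG_gt0 19) (@expG_le 1 19 isT); rewrite expn1; clear.
  by move: (1000 * _) => Y; pow_lia.
move: (i * (B + 7)) H => {B} X H.
apply: leq_trans (@expG_le 21 22 isT).
by apply: seq_time; move: H (expG_gt0 20) => /=; clear; pow_lia.
Qed.

(** Most significant digit first, so that the downward loop of [next_digits] starts with the least
    significant one. *)
Definition digit V j := V %/ 5 ^ (k - j) %% 5.

Record kept_x h h' : Prop := KeptX {
  kx_reg : forall j, j < 52 -> h' j = h j;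
  kx_arr : forall q j, q < 4 -> q != 1 -> h' (addr q j) = h (addr q j) }.

Lemma kx_upd_reg h h' r v : 51 < r -> r < regs -> kept_x h h' -> kept_x h (upd h' r v).
Proof.
move=> r1 r2 [kr ka]; split=> [j jl|q j q4 q1].
  by rewrite upd_neq ?kr // neq_ltn (leq_trans jl).
by rewrite /upd eq_sym addr_reg // ka.
Qed.

Lemma kx_upd_addr h h' j v : kept_x h h' -> kept_x h (upd h' (addr 1 j) v).
Proof.
move=> [kr ka]; split=> [l jl|q l q4 q1].
  by rewrite /upd addr_reg ?kr // (leq_trans jl).
by rewrite /upd addr_inj // (negPf q1) ka.
Qed.

Lemma next_digits_spec V h : h rK = k -> (forall j, j <= k -> h (addr 1 j) = digit V j) ->
  hwp next_digits (fun h' => [/\ forall j, j <= k -> h' (addr 1 j) = digit V.+1 j,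
    h' 53 = (5 ^ k.+1 %| V.+1) & kept_x h h']) (G ^ 2) h.
Proof.
move=> hk hV; have Ml := M_lin; have kn := k_lt.
(* The entries from [j] on already belong to [V.+1]; a carry is pending iff all of them have wrapped
   around. *)
pose Iv j h' := [/\ kept_x h h', h' 53 = (5 ^ (k.+1 - j) %| V.+1) &
  forall l, l <= k -> h' (addr 1 l) = if j <= l then digit V.+1 l else digit V l].
eapply hwp_time.
  apply: hwp_seq; apply: asgP => //=.
  apply: (forP (N := k.+1) (I := Iv)) => //.
  - by rewrite /= /upd /= hk; oks.
  - by rewrite /= /upd /= hk addn1.
  - split; first by do 2 apply: kx_upd_reg => //.
    + by rewrite upd_neq // upd_eq subnn dvd1n.
    + by move=> l lk; rewrite /upd !(eq_sym (addr _ _)) !addr_reg // hV // ltnNge lk.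
  - move=> j h1 jk [kx h1c h1V] hr.
    have jk2 : j < k.*2.+2 by move: jk; clear; lia.
    have h1j : h1 (addr 1 j) = digit V j by rewrite h1V // ltnn.
    have d0 : 0 < 5 ^ (k - j) by rewrite expn_gt0.
    have ee : 5 ^ (k.+1 - j) = 5 * 5 ^ (k - j) by rewrite subSn // expnS.
    rewrite subSS in h1c.
    have lt5 : digit V j < 5 by rewrite ltn_mod.
    have rest h' y : y = digit V.+1 j -> (forall l, l <= k -> h' (addr 1 l) = if l == j then y else h1 (addr 1 l)) ->
        forall l, l <= k -> h' (addr 1 l) = if j <= l then digit V.+1 l else digit V l.
      move=> yE H l lk; rewrite H // h1V //; case: eqP => [->|/eqP nlj]; first by rewrite leqnn.
      by rewrite (leq_eqVlt j) eq_sym (negPf nlj).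
    apply: ifsP => //; rewrite /= upd_neq // h1c => cond.
    + have {}cond : 5 ^ (k - j) %| V.+1 by move: cond; case: (_ %| _).
      have [dE cE] := digit_carry d0 cond.
      have [o1 s1] := @cell_ok 1 j (upd h1 52 j) #52 isT jk2 (upd_eq _ _ _) I.
      have eE : ev inp (upd h1 52 j) (Ld (cell 1 #52)) = digit V j.
        by rewrite -h1j /= upd_eq -/(addr 1 j) /upd eq_sym addr_reg.
      apply: hwp_seq; apply: asgP => //.
        by rewrite [ok _ _ _ _ _]/=; split=> //; rewrite -/(ev inp (upd h1 52 j) (Ld (cell 1 #52))) eE /=; move: lt5 Ml; clear; pow_lia.
      have -> : ev inp (upd h1 52 j) (Ld (cell 1 #52) +! $1) = digit V j + 1 by rewrite -eE.
      name_state h2.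
      have h2j : h2 52 = j by [].
      have h2y : h2 54 = digit V j + 1 by rewrite /h2 upd_eq.
      have h253 : h2 53 = (5 ^ (k - j) %| V.+1) by rewrite /h2 upd_neq // upd_neq.
      have [o2 s2] := @cell_ok 1 j h2 #52 isT jk2 h2j I.
      have kx2 : kept_x h h2 by do 2 apply: kx_upd_reg => //.
      have h2x l : h2 (addr 1 l) = h1 (addr 1 l).
        by rewrite /h2 /upd !(eq_sym (addr _ _)) !addr_reg.
      apply: ifsP => //; rewrite /= h2y => c5.
      * have {}c5 : (digit V j + 1 == 5) = true by move: c5; case: (_ + 1 == 5).
        apply: stoP => //; rewrite (@cell_ev 1 j) //=; split; first by rewrite /upd addr_reg.
        split; first exact: kx_upd_addr.
          by rewrite upd_neq ?addr_reg // h253 ee cE -/(digit V j) c5 cond.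
        apply: (rest _ 0); first by rewrite /digit dE -/(digit V j) c5.
        by move=> l lk; rewrite /upd addr_inj //= h2x.
      * have {}c5 : (digit V j + 1 == 5) = false by move: c5; case: (_ + 1 == 5).
        apply: hwp_seq; apply: stoP => //; rewrite (@cell_ev 1 j) //= h2y.
        apply: asgP => //=; split; first by rewrite /upd /= addr_reg.
        split; first by apply: kx_upd_reg => //; apply: kx_upd_addr.
          by rewrite upd_eq ee cE -/(digit V j) c5.
        apply: (rest _ (digit V j + 1)); first by rewrite {2}/digit dE -/(digit V j) c5.
        by move=> l lk; rewrite /upd (eq_sym _ 53) addr_reg // addr_inj //= -h2x.
    + have {}cond : (5 ^ (k - j) %| V.+1) = false by move: cond; case: (_ %| _).
      have [dE cE] := digit_nocarry d0 cond.
      apply: hwp_skip; split; first by rewrite upd_eq.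
      split; first by apply: kx_upd_reg.
        by rewrite upd_neq // h1c ee cE cond.
      apply: (rest _ (digit V j)); first by rewrite /digit dE.
      move=> l lk; rewrite /upd eq_sym addr_reg //; case: eqP => [->|//].
      by rewrite h1V // ltnn.
  - by move=> h1 [kx h1c h1V] _; split=> //; rewrite h1c.
set B := (X in _ * (X + 7)).
have H : k.+1 * (B + 7) <= 100 * G ^ 1.
  rewrite expn1 /B /=; move: k_lt; clear; nia.
by apply: seq_time; move: H; rewrite expn1 /=; clear; lia.
Qed.

Record kept_s h h' : Prop := KeptS {
  ks_reg : forall j, 37 <= j -> j < 50 -> h' j = h j;
  ks_w : forall j, h' (addr 0 j) = h (addr 0 j) }.

Lemma ks_trans h1 h2 h3 : kept_s h1 h2 -> kept_s h2 h3 -> kept_s h1 h3.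
Proof.
move=> [r12 w12] [r23 w23]; split=> j *; rewrite ?w23 ?w12 //.
by rewrite r23 ?r12.
Qed.

Lemma ks_keep h h' : keep h h' -> kept_s h h'.
Proof.
by move=> kp; split=> j *; rewrite ?(keep_w kp) ?(keep_reg kp) // (@leq_trans 50).
Qed.

Lemma ks_kx h h' : kept_x h h' -> kept_s h h'.
Proof.
by move=> kx; split=> j *; rewrite ?(kx_arr kx) ?(kx_reg kx) // (@leq_trans 50).
Qed.

Lemma ks_upd_reg h h' r v : 49 < r -> r < regs -> kept_s h h' -> kept_s h (upd h' r v).
Proof.
move=> r1 r2 ks; apply: (ks_trans ks); split=> j *.
  by rewrite upd_neq // neq_ltn (@leq_trans 50).
by rewrite /upd eq_sym addr_reg.
Qed.

Definition solved i wl h' : Prop :=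
  if h' 51 != 0 then exists sl, [/\ arr 2 sl h', size sl <= k & check e i sl]
  else forall V, V < 5 ^ k.+1 -> ~~ check e i (sim e i wl k (digit V)).

Lemma clear_digits_spec h : h rK = k ->
  hwp (for_ 52 (#rK +! $1) (sto (cell 1 #52) $0))
    (fun h' => kept_x h h' /\ forall j, j <= k -> h' (addr 1 j) = digit 0 j) (G ^ 2) h.
Proof.
move=> hk; have Ml := M_lin; have kn := k_lt.
pose Iv j h' := kept_x h h' /\ forall l, j <= l -> l <= k -> h' (addr 1 l) = digit 0 l.
eapply hwp_time.
  apply: (forP (N := k.+1) (I := Iv)) => //.
  - by rewrite /= hk; oks.
  - by rewrite /= hk addn1.
  - split; first by apply: kx_upd_reg.
    by move=> l kl lk; move: kl; rewrite ltnNge lk.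
  - move=> j h1 jk [kx h1V] hr.
    have jk2 : j < k.*2.+2 by move: jk; clear; lia.
    have [o1 s1] := @cell_ok 1 j (upd h1 52 j) #52 isT jk2 (upd_eq _ _ _) I.
    apply: stoP => //; rewrite (@cell_ev 1 j) //=.
    split; first by rewrite /upd addr_reg.
    split; first by apply: kx_upd_addr; apply: kx_upd_reg.
    move=> l jl lk; rewrite /upd addr_inj //= (eq_sym _ 52) addr_reg //.
    case: eqP => [_|/eqP nlj]; first by rewrite /digit div0n mod0n.
    by apply: h1V => //; rewrite ltn_neqAle eq_sym nlj.
  - by move=> h1 [kx h1V] _; split=> // j jk; apply: h1V.
set B := (X in _ * (X + 7)).
have H : k.+1 * (B + 7) <= 100 * G ^ 1.
  rewrite expn1 /B /=; move: k_lt; clear; nia.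
by apply: seq_time; move: H; rewrite expn1 /=; clear; lia.
Qed.

Lemma search_spec i wl h : h rN = n -> h rK = k -> h rI = i -> i <= n ->
  size wl <= k.*2.+2 -> arr 0 wl h ->
  hwp search (fun h' => kept_s h h' /\ solved i wl h') (5 ^ k.+1 * G ^ 28) h.
Proof.
move=> hn hk hi lin swl hw.
(* Either the search is over, or the first [V] strings have failed and [q] strings remain. *)
pose Iv q h' := kept_s h h' /\ ((h' 50 = 0 /\ solved i wl h') \/
  exists V, [/\ h' 50 = 1, h' 51 = 0, V < 5 ^ k.+1 & V + q = 5 ^ k.+1] /\
    [/\ forall j, j <= k -> h' (addr 1 j) = digit V j &
         forall V', V' < V -> ~~ check e i (sim e i wl k (digit V'))]).
eapply hwp_time.
  apply: hwp_seq; apply: asgP => //=; apply: hwp_seq; apply: asgP => //=.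
  name_state h1.
  have ks1 : kept_s h h1 by do 2 apply: ks_upd_reg => //.
  apply: hwp_seq; apply: hwp_call; first by apply: clear_digits_spec.
  move=> h2 [kx2 h2V].
  have ks2 : kept_s h h2 by apply: ks_trans ks1 (ks_kx kx2).
  apply: (hwp_while M1000 s_leM s_geR (I := Iv) (j := 5 ^ k.+1)) => //.
  - move=> h3 [_ [[] //|[V [[_ _ lt]]]]]; rewrite addn0 => E; by rewrite E ltnn in lt.
  - move=> q h3 [ks3 [[-> //]|[V [[h3g h3f Vlt Vq] [h3V h3no]]]]] _.
    have [h3n h3k h3i] : [/\ h3 rN = n, h3 rK = k & h3 rI = i] by split; rewrite (ks_reg ks3).
    have h3w : arr 0 wl h3 by move=> j jk; rewrite (ks_w ks3) hw.
    apply: hwp_seq; apply: hwp_call; first exact: (sim_spec swl h3n h3k h3i h3w h3V).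
    move=> h4 [h4s kp4]; set sl := sim _ _ _ _ _ in h4s.
    have ssl : size sl <= k by apply: size_sim.
    have ssl2 : size sl <= k.*2.+2 by move: ssl; clear; lia.
    have gl4 : glob i wl sl h4.
      by split; rewrite ?(keep_reg kp4) //; apply: arr_keep kp4 h3w.
    apply: hwp_seq; apply: hwp_call; first exact: (check_spec gl4 swl ssl2 lin).
    move=> h5 [h5o f5].
    have kp5 : keep h3 h5 by apply: keep_trans kp4 (keep_frame _ f5).
    have ks5 : kept_s h h5 by apply: ks_trans ks3 (ks_keep kp5).
    apply: ifsP => //; rewrite /= h5o => ck.
    + apply: hwp_seq; apply: asgP => //=; apply: asgP => //=.
      exists 0 => //; split; first by do 2 apply: ks_upd_reg => //.
      left; split=> //; rewrite /solved /=; exists sl; split=> //; last by move: ck; case: (check _ _ _).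
      do 2 apply: arr_upd_reg => //; exact: (arr_frame _ f5 h4s).
    + have h5k : h5 rK = k by rewrite (ks_reg ks5).
      apply: hwp_seq; apply: hwp_call.
        by apply: (next_digits_spec (V := V) h5k) => j jk; rewrite (keep_x kp5) h3V.
      move=> h6 [h6V h6c kx6]; apply: asgP => //=.
      have no6 V' : V' < V.+1 -> ~~ check e i (sim e i wl k (digit V')).
        rewrite ltnS leq_eqVlt => /orP[/eqP ->|]; last exact: h3no.
        by move: ck; rewrite -/sl; case: (check _ _ _).
      have ks7 : kept_s h (upd h6 50 (1 - h6 53)).
        by apply: ks_upd_reg => //; apply: ks_trans ks5 (ks_kx kx6).
      have h6f : h6 51 = 0 by rewrite (kx_reg kx6) // f5 // (keep_reg kp4).
      (* The counter overflows exactly when [V] was the last string. *)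
      exists q => //; split=> //; have [full|nfull] := boolP (5 ^ k.+1 %| V.+1).
        left; split; first by rewrite upd_eq h6c full.
        rewrite /solved upd_neq // h6f /= => V' V'lt; apply: no6.
        by apply: leq_trans V'lt _; apply: dvdn_leq.
      right; exists V.+1; split; split=> //.
      * by rewrite upd_eq h6c (negPf nfull).
      * by rewrite ltn_neqAle Vlt andbT; apply: contraNneq nfull => ->.
      * by rewrite addSnnS.
      * by move=> j jk; rewrite /upd eq_sym addr_reg // h6V.
  - move=> q h3 [ks3 [[_ sol]//|[V [[h3g _ _ _] _]]]] h30; by rewrite h30 in h3g.
  - split=> //; right; exists 0; split; split=> //.
    + by rewrite (kx_reg kx2).
    + by rewrite (kx_reg kx2).
    + by rewrite expn_gt0.
set B := (X in 5 ^ _ * X.+1).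
have H : B.+1 <= G ^ 26.
  apply: seq_time; rewrite /B /=.
  move: (expG_gt0 25) (@expG_le 22 25 isT) (@expG_le 2 25 isT); clear; pow_lia.
have H5 : 0 < 5 ^ k.+1 by rewrite expn_gt0.
have H2 : 5 ^ k.+1 * B.+1 <= 5 ^ k.+1 * G ^ 26 by rewrite leq_mul2l H orbT.
have H3 : G ^ 26 * 1000 <= G ^ 28.
  apply: leq_trans (@expG_le 27 28 isT); apply: seq_time; by rewrite mulnC.
have H4 : 5 ^ k.+1 * (G ^ 26 * 1000) <= 5 ^ k.+1 * G ^ 28 by rewrite leq_mul2l H3 orbT.
apply: leq_trans H4; rewrite mulnA.
have H6 : G ^ 26 <= 5 ^ k.+1 * G ^ 26 by rewrite leq_pmull.
move: (5 ^ k.+1 * B.+1) (5 ^ k.+1 * G ^ 26) H2 H6 => {B H} X Y H2 H6.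
by move: H2 H6 (@expG_le 2 26 isT) (expG_gt0 26) => /=; clear; pow_lia.
Qed.

Lemma eq_sim i wl x x' : (forall j, j <= k -> x j = x' j) -> sim e i wl k x = sim e i wl k x'.
Proof.
move=> xx; rewrite /sim.
have -> : downto (init_step wl k x) k.+1 ([::], [::]) = downto (init_step wl k x') k.+1 ([::], [::]).
  have : k.+1 <= k.+1 by []. move: ([::], [::]) {1 3 4}k.+1 => st m.
  elim: m st => //= m IHm st mk; rewrite IHm ?(ltnW mk) //; congr downto.
  by rewrite /init_step xx.
by [].
Qed.

(** * Iterative compression *)

Section Compression.
Hypothesis e_sym : symmetric e.
Hypothesis e_irr : irreflexive e.

(** A solution for the whole graph also solves every induced subgraph, so one failing stage refutes
    all solutions. In [wl] the padding 0 denotes no vertex, and the entry i removes the new vertex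
    from the old graph. *)
Lemma compress i sl : 0 < i -> i <= n -> size sl <= k ->
  let wl := sl ++ nseq (k - size sl) 0 ++ [:: i] in
  acyclic e (below n' i.-1 :\: vset n' sl) ->
  (forall V, V < 5 ^ k.+1 -> ~~ check e i (sim e i wl k (digit V))) ->
  ~ exists S : {set 'I_n}, #|S| <= k /\ acyclic e (~: S).
Proof.
move=> i0 lin ssl wl acs no [S [cS acS]].
have acF : acyclic e (old_graph n' i wl).
  apply: acyclic_sub acs; apply/subsetP => v; rewrite !in_setD !in_vset !in_below.
  rewrite !mem_cat negb_or => /andP[/andP[-> nv] vi] /=.
  move: nv; rewrite negb_or inE => /andP[_ nv]; move: nv vi i0; clear; lia.
have swl : size wl <= k.+1.
  by rewrite !size_cat size_nseq /= addnA subnKC // addn1.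
have acS' : acyclic e (below n' i :\: S).
  by apply: acyclic_sub acS; apply/subsetP => v; rewrite in_setD in_setC => /andP[].
have [x x5 acx] := sim_complete e_sym e_irr acF swl cS acS'.
have [V Vlt VE] := digit_onto (x := fun l => x (k - l)) k.+1 (fun l => x5 _).
move/negP: (no V Vlt); apply; apply: (check_complete e_sym e_irr) => //.
rewrite (@eq_sim _ _ _ x) // => j jk.
by rewrite /digit VE ?ltnS ?leq_subr // subKn.
Qed.

Lemma arr_pad h sl i : size sl <= k -> arr 0 sl h ->
  arr 0 (sl ++ nseq (k - size sl) 0 ++ [:: i]) (upd h (addr 0 k) i).
Proof.
move=> ssl ar j jk; rewrite /upd addr_inj //= nth_cat.
case: (ltnP j (size sl)) => le; first by rewrite ltn_eqF ?ar // (leq_trans le).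
rewrite nth_cat size_nseq nth_nseq.
have -> : (j - size sl < k - size sl) = (j < k) by move: le ssl; clear; lia.
have -> : j - size sl - (k - size sl) = j - k by move: le ssl; clear; lia.
case: ltngtP => [lt|gt|->]; last by rewrite subnn.
  by rewrite ar // nth_default.
rewrite ar // nth_default //.
by case E: (j - k) => [|m] /=; [move: E gt; clear; lia | rewrite nth_nil].
Qed.

Lemma copy_spec sl h : h rK = k -> arr 2 sl h ->
  hwp (for_ 52 slots (sto (cell 0 #52) (Ld (cell 2 #52))))
    (fun h' => arr 0 sl h' /\ forall j, j < 52 -> h' j = h j) (G ^ 2) h.
Proof.
move=> hk hs; have [oS eS] := slotsE hk.
pose Iv j h' := [/\ arr 2 sl h', forall l, l < 52 -> h' l = h l &
  forall l, j <= l -> l < k.*2.+2 -> h' (addr 0 l) = nth 0 sl l].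
eapply hwp_time.
  apply: (forP (N := k.*2.+2) (I := Iv)) => //.
  - split; first exact: arr_upd_reg.
    + by move=> l l52; rewrite upd_neq // neq_ltn l52.
    + by move=> l jl lk; move: jl; rewrite leqNgt lk.
  - move=> j h1 jk [h1s h1r h1w] hr.
    have [o1 s1] := @cell_ok 0 j (upd h1 52 j) #52 isT jk (upd_eq _ _ _) I.
    have [o2 s2] := @cell_ok 2 j (upd h1 52 j) #52 isT jk (upd_eq _ _ _) I.
    have eE : ev inp (upd h1 52 j) (Ld (cell 2 #52)) = nth 0 sl j.
      by rewrite -h1s // /= upd_eq -/(addr 2 j) /upd eq_sym addr_reg.
    apply: stoP => //; rewrite eE (@cell_ev 0 j) //.
    split; first by rewrite /upd addr_reg.
    split.
    + by apply: arr_upd_other => //; apply: arr_upd_reg.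
    + move=> l l52; rewrite /upd addr_reg; last exact: leq_trans l52 _.
      by rewrite ltn_eqF // h1r.
    + move=> l jl lk; rewrite /upd addr_inj //= (eq_sym _ 52) addr_reg //.
      case: eqP => [->//|/eqP nlj]; apply: h1w => //.
      by rewrite ltn_neqAle eq_sym nlj.
  - by move=> h1 [h1s h1r h1w] _; split=> // l lk; apply: h1w.
set B := (X in _ * (X + 7)).
have H : k.*2.+2 * (B + 7) <= 100 * G ^ 1.
  rewrite expn1 /B /=; move: k_lt; clear; nia.
by apply: seq_time; move: H; rewrite expn1 /=; clear; lia.
Qed.

Lemma compression_spec h : h rN = n -> h rK = k -> arr 0 [::] h ->
  hwp compression (fun h' => exists2 ans : bool, h' 45 = ans &
      ans <-> exists S : {set 'I_n}, #|S| <= k /\ acyclic e (~: S)) (5 ^ k.+1 * G ^ 31) h.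
Proof.
move=> hn hk hw; have Ml := M_lin; have kn := k_lt.
pose fvs := exists S : {set 'I_n}, #|S| <= k /\ acyclic e (~: S).
(* Until a stage fails, array 0 holds a solution for the first [n - j] vertices. *)
pose Iv j h' := [/\ h' rN = n, h' rK = k & exists2 b : bool, h' 43 = b &
  if b then ~ fvs else exists sl, [/\ arr 0 sl h', size sl <= k & acyclic e (below n' (n - j) :\: vset n' sl)]].
eapply hwp_time.
  apply: hwp_seq; apply: asgP => //=; apply: hwp_seq.
  apply: (forP (N := n) (I := Iv)) => //.
  - split=> //; exists false => //; exists [::]; split=> //.
    + by do 2 apply: arr_upd_reg => //.
    + rewrite subnn; have -> : below n' 0 :\: vset n' [::] = set0.
        by apply/setP => v; rewrite !inE andbF.
      exact: acyclic0.
  - move=> j h1 jn [h1n h1k [b h1b bP]] hr.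
    apply: ifsP => //; rewrite /= upd_neq // h1b => fb.
    + case: b fb h1b bP => // _ h1b bP.
      by apply: hwp_skip; split=> //; split=> //; exists true.
    + case: b fb h1b bP => // _ h1b [sl [h1w ssl acs]].
      apply: hwp_seq; apply: asgP => //=; rewrite upd_eq upd_neq // h1n.
      set i := n - j; have i0 : 0 < i by rewrite subn_gt0.
      have lin : i <= n by apply: leq_subr.
      have iE : n - j.+1 = i.-1 by rewrite subnS.
      rewrite iE in acs.
      name_state h2.
      have h2k : h2 rK = k by [].
      have k2 : k < k.*2.+2 by clear; lia.
      have [o1 s1] := @cell_ok 0 k h2 #rK isT k2 h2k I.
      apply: hwp_seq; apply: stoP => //; rewrite (@cell_ev 0 k) //=.
      name_state h3; set wl := sl ++ nseq (k - size sl) 0 ++ [:: i].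
      have h3w : arr 0 wl h3.
        by apply: arr_pad => //; do 2 apply: arr_upd_reg => //.
      have swl : size wl <= k.*2.+2.
        by rewrite !size_cat size_nseq /= addnA subnKC //; clear; lia.
      have [h3n h3k h3i] : [/\ h3 rN = n, h3 rK = k & h3 rI = i].
        by split; rewrite /h3 upd_neq ?addr_reg.
      have [h3j h3f] : h3 44 = j /\ h3 43 = 0.
        by split; rewrite /h3 upd_neq ?addr_reg // /h2 upd_neq //= ?upd_neq // ?upd_eq.
      apply: hwp_seq; apply: hwp_call; first exact: (search_spec h3n h3k h3i lin swl h3w).
      move=> h4 [ks4 sol].
      have [h4n h4k h4j] : [/\ h4 rN = n, h4 rK = k & h4 44 = j] by split; rewrite (ks_reg ks4).
      have h4f : h4 43 = 0 by rewrite (ks_reg ks4).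
      rewrite /solved in sol; apply: ifsP => //; rewrite /= => fd.
      * move: sol; rewrite fd => -[sl' [h4s ssl' ck]].
        apply: hwp_call; first exact: (copy_spec h4k h4s).
        move=> h5 [h5w h5r]; split; first by rewrite h5r.
        split; [by rewrite h5r | by rewrite h5r |].
        exists false; first by rewrite h5r.
        by exists sl'; split=> //; apply: (check_sound e_sym e_irr).
      * move: sol; rewrite fd /= => no.
        apply: asgP => //=; split=> //; split=> //; exists true => //.
        exact: (compress i0 lin ssl acs no).
  - move=> h1 [h1n h1k [b h1b bP]] _; apply: asgP => //=; exists (~~ b).
      by rewrite upd_eq h1b; case: (b).
    case: b bP {h1b} => bP; split=> //= _.
    case: bP => sl [h1w ssl acs]; exists (vset n' sl); split.
      apply: leq_trans ssl; rewrite cardE -(size_map (fun v : 'I_n => v.+1)).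
      apply: uniq_leq_size; first by rewrite map_inj_uniq ?enum_uniq // => u v [] /val_inj.
      by move=> q /mapP[v]; rewrite mem_enum in_vset => vsl ->.
    apply: acyclic_sub acs; apply/subsetP => v; rewrite in_setC in_setD => ->.
    by rewrite in_below subn0 ltn_ord.
set B := (X in n * (X + 7)).
have H5 : 0 < 5 ^ k.+1 by rewrite expn_gt0.
have H : B + 7 <= 5 ^ k.+1 * G ^ 29.
  rewrite /B /=; apply: (@leq_trans (5 ^ k.+1 * (1000 * G ^ 28))); last first.
    by rewrite leq_mul2l seq_time ?orbT.
  rewrite mulnCA; have H6 : G ^ 28 <= 5 ^ k.+1 * G ^ 28 by rewrite leq_pmull.
  move: H6 (@expG_le 2 28 isT) (expG_gt0 28); clear.
  by move: (5 ^ k.+1 * G ^ 28) => X; pow_lia.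
have H2 : n * (B + 7) <= G ^ 1 * (5 ^ k.+1 * G ^ 29) by apply: leq_mul; [exact: n_le_G|].
have H3 : G ^ 1 * (5 ^ k.+1 * G ^ 29) = 5 ^ k.+1 * G ^ 30 by rewrite mulnCA -expnD.
rewrite H3 in H2; move: (n * (B + 7)) H2 => {B H} X H2 /=.
apply: (@leq_trans (5 ^ k.+1 * (1000 * G ^ 30))); last first.
  by rewrite leq_mul2l seq_time ?orbT.
rewrite mulnCA; have : 0 < 5 ^ k.+1 * G ^ 30 by rewrite muln_gt0 H5 expG_gt0.
by move: H2; clear; move: (5 ^ k.+1 * G ^ 30) => Y; lia.
Qed.

End Compression.

End Programs.

(** * Input and main theorem *)

(** The parameter need not fit into a word. Digits are read while their weight is at most n; if the
    end marker is not reached, then k is at least n, and n is used in its place. *)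
Definition read_parameter : cmd :=
  rK <- $0 ;; 55 <- $1 ;; 56 <- #rN *! #rN +! $1 ;;
  for_ 58 (#rN +! $1) (
    ifs (#rN <! #55) Skip
      (57 <- Inp #56 ;;
       ifs (#57 ==! $2) Skip
         (rK <- #rK +! #57 *! #55 ;; 55 <- #55 *! $2 ;; 56 <- #56 +! $1))) ;;
  57 <- Inp #56 ;;
  ifs (#57 ==! $2) Skip (rK <- #rN).

Definition fvs_program : cmd :=
  (rN <- Inp $0 ;; read_parameter ;;
   ifs (#rK <! #rN) compression (45 <- $1)) ;; Write (stack + 45).

Section ReadParameter.
Variables (w s : nat) (inp : seq nat) (n k : nat).
Local Notation M := (2 ^ w).
Hypothesis M_ge : 1000 * (n.+1 * n.+1) <= M.
Hypothesis s_le : s <= M.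
Hypothesis s_ge : stack + regs <= s.
Hypothesis inp_lt : forall j, nth 0 inp j < M.
Local Notation len := (up_log 2 k.+1).
Hypothesis inp_digit : forall j, j < len -> nth 0 inp (n * n + 1 + j) = k %/ 2 ^ j %% 2.
Hypothesis inp_end : nth 0 inp (n * n + 1 + len) = 2.

Lemma param_lt : k < 2 ^ len. Proof. exact: up_logP. Qed.

(** The leading binary digit is nonzero, so k is at least the weight of each of its digit
    positions. *)
Lemma param_ge j : j < len -> 2 ^ j <= k.
Proof.
move=> jl; have k0 : 1 < k.+1 by case: (k) jl => //; rewrite up_log1.
have /andP[+ _] := up_log_bounds (isT : 1 < 2) k0.
rewrite ltnS; apply: leq_trans; rewrite leq_pexp2l //.
by rewrite -ltnS prednK // (leq_ltn_trans _ jl).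
Qed.

Lemma modn_digit j : k %% 2 ^ j.+1 = k %% 2 ^ j + (k %/ 2 ^ j %% 2) * 2 ^ j.
Proof.
have d0 : 0 < 2 ^ j by rewrite expn_gt0.
have E : k = (k %/ 2 ^ j %/ 2) * 2 ^ j.+1 + ((k %/ 2 ^ j %% 2) * 2 ^ j + k %% 2 ^ j).
  by rewrite expnS mulnA addnA -mulnDl -divn_eq -divn_eq.
rewrite [in LHS]E modnMDl modn_small; first exact: addnC.
have := ltn_pmod k d0; have := ltn_pmod (k %/ 2 ^ j) (isT : 0 < 2); rewrite expnS.
move: (2 ^ j) (k %% _) (k %/ _ %% 2) => z y x; case: x => [|[|//]] _; lia.
Qed.

Lemma M_ge1000 : 1000 <= M. Proof. by apply: leq_trans M_ge; rewrite leq_pmulr. Qed.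

Local Notation asgR := (hwp_asg M_ge1000 s_le s_ge inp_lt).
Local Notation ifsR := (hwp_ifs M_ge1000 s_le s_ge inp_lt).
Local Notation forR := (hwp_for M_ge1000 s_le s_ge inp_lt).

Lemma read_parameter_spec h : h rN = n ->
  hwp w s inp read_parameter (fun h' => [/\ h' rN = n, frame 59 h h' &
    h' rK = k \/ n <= k /\ h' rK = n]) (1000 * n.+1) h.
Proof.
move=> hn; have Ml : 1000 * n.+1 <= M by apply: leq_trans M_ge; rewrite leq_mul2l leq_pmulr.
have Msq : 1000 * (n * n) <= M by apply: leq_trans M_ge; rewrite leq_mul2l leq_mul.
have M1 := M_ge1000.
(* The three alternatives are: the weight exceeds n, the end marker is reached, or every round so
   far has consumed a digit. After n + 1 rounds the last implies the first, as $n < 2^j$ for j >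
   n. *)
pose Iv c h' := [/\ h' rN = n, frame 59 h h' & exists2 j,
  [/\ j <= len, h' 55 = 2 ^ j, h' rK = k %% 2 ^ j & h' 56 = n * n + 1 + j] &
  [/\ 2 ^ j <= n.*2.+1 & [\/ n < 2 ^ j, j = len | n.+1 <= c + j]]].
eapply hwp_time.
  apply: hwp_seq; apply: asgR => //=; apply: hwp_seq; apply: asgR => //=.
  apply: hwp_seq; apply: asgR => //=; rewrite /upd /= -/(upd _ _ _) hn.
    by move: Msq M1 Ml; clear; oks; pow_lia.
  apply: hwp_seq; apply: (forR (N := n.+1) (I := Iv)) => //.
  - by rewrite /= /upd /= hn; move: Ml; clear; oks; pow_lia.
  - by rewrite /= /upd /= hn addn1.
  - split=> //; first by do 4 apply: frame_upd => //.
    exists 0; last by split=> //; constructor 3; rewrite addn0.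
    by split; rewrite // ?modn1 ?addn0.
  - move=> c h1 cn [h1n f1 [j [jl h1P h1K h1A] [jb prog]]] hr.
    have skip_ok : n < 2 ^ j \/ j = len ->
        (upd h1 58 c) 58 = c /\ Iv c (upd h1 58 c).
      move=> H; split=> //; split=> //; first exact: frame_upd.
      exists j => //; split=> //.
      by case: H => ?; [constructor 1 | constructor 2].
    apply: ifsR => //; rewrite /= /upd /= -/(upd _ _ _) h1n h1P => cond.
    + by apply: hwp_skip; apply: skip_ok; left; move: cond; case: (_ < _).
    + have {cond} Pn : 2 ^ j <= n by rewrite leqNgt; move: cond; case: (_ < _).
      apply: hwp_seq; apply: asgR => //=; rewrite upd_neq // h1A.
      name_state h2; have f2 : frame 59 h h2 by do 2 apply: frame_upd => //.
      apply: ifsR => //; rewrite /= -/(h2 57) => cond.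
      * apply: hwp_skip; split=> //; split=> //; exists j => //; split=> //.
        have [lt|] := ltnP j len; last first.
          by move=> ge; constructor 2; apply/eqP; rewrite eqn_leq jl.
        by move: cond; rewrite /h2 upd_eq inp_digit // modn2; case: odd.
      * have {jl} lt : j < len.
          rewrite ltn_neqAle jl andbT; apply: contraPneq cond => E.
          by rewrite /h2 upd_eq E inp_end.
        have h2d : h2 57 = k %/ 2 ^ j %% 2 by rewrite /h2 upd_eq inp_digit.
        have [h2K h2P h2A] : [/\ h2 rK = k %% 2 ^ j, h2 55 = 2 ^ j & h2 56 = n * n + 1 + j] by [].
        have jn : j < n by apply: leq_trans Pn; apply: ltn_expl.
        have d2 : k %/ 2 ^ j %% 2 < 2 by rewrite ltn_mod.
        have r2 : k %% 2 ^ j < 2 ^ j by rewrite ltn_mod expn_gt0.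
        apply: hwp_seq; apply: asgR => //=; rewrite h2d h2P h2K.
          have : k %/ 2 ^ j %% 2 * 2 ^ j <= 2 ^ j by case: (_ %% 2) d2 => [|[|//]] _; rewrite ?mul1n.
          by move: r2 Pn Ml; clear; move: (_ %% 2 * _) (k %% _) => X Y; oks; pow_lia.
        rewrite -modn_digit; apply: hwp_seq; apply: asgR => //=; rewrite upd_neq // h2P.
          by move: Pn Ml; clear; oks; pow_lia.
        rewrite -expnSr; apply: asgR => //=; rewrite !upd_neq // h2A.
          by move: jn Ml Msq M1; clear; oks; pow_lia.
        split=> //; split=> //; first by do 3 apply: frame_upd => //.
        exists j.+1; first by split=> //; rewrite /upd /=; clear; lia.
        split; first by rewrite expnS; move: Pn; clear; pow_lia.
        case: prog => [ltP|jE|cj]; first by rewrite ltnNge Pn in ltP.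
          by rewrite jE ltnn in lt.
        by constructor 3; rewrite addnS -addSn.
  - move=> h1 [h1n f1 [j [jl h1P h1K h1A] [jb prog]]] _.
    apply: hwp_seq; apply: asgR => //=; rewrite h1A; name_state h2.
    have f2 : frame 59 h h2 by apply: frame_upd.
    apply: ifsR => //; rewrite /= -/(h2 57) => cond.
    + apply: hwp_skip; split=> //; left; rewrite /h2 upd_neq // h1K.
      have [lt|] := ltnP j len.
        by move: cond; rewrite /h2 upd_eq inp_digit // modn2; case: odd.
      move=> ge; have -> : j = len by apply/eqP; rewrite eqn_leq jl.
      by rewrite modn_small // param_lt.
    (* The cell read is not the end marker, so position j carries a digit of k, and its weight
       exceeds n. *)
    + have lt : j < len.
        rewrite ltn_neqAle jl andbT; apply: contraPneq cond => E.
        by rewrite /h2 upd_eq E inp_end.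
      have ltn2 : n < 2 ^ j.
        case: prog => [//|jE|cj]; first by rewrite jE ltnn in lt.
        by apply: leq_trans (ltn_expl j (isT : 1 < 2)); rewrite ltnS ltnW.
      apply: asgR => //=; split=> //; first exact: frame_upd.
      right; rewrite upd_eq; split=> //.
      exact: leq_trans (ltnW ltn2) (param_ge lt).
rewrite /=; clear; lia.
Qed.

End ReadParameter.

Lemma nth_allpairs (A B : Type) (f : A -> A -> B) (a0 : A) b0 (r t : seq A) i j :
  i < size r -> j < size t ->
  nth b0 [seq f x y | x <- r, y <- t] (i * size t + j) = f (nth a0 r i) (nth a0 t j).
Proof.
move=> + jt; elim: r i => //= x r IHr [|i] ir.
  by rewrite nth_cat size_map jt (nth_map a0).
by rewrite nth_cat size_map mulSn -addnA ltnNge leq_addr /= addKn IHr.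
Qed.

Section Encoding.
Variables (n k : nat) (e : rel 'I_n).

Let matrix := [seq nat_of_bool (e u v) | u <- enum 'I_n, v <- enum 'I_n].

Lemma size_matrix : size matrix = n * n.
Proof. by rewrite size_allpairs !size_enum_ord. Qed.

Lemma nth_encode_adj (u v : 'I_n) : nth 0 (encode e k) (1 + (u * n + v)) = e u v.
Proof.
have lt : u * n + v < n * n.
  apply: (@leq_trans (u.+1 * n)); first by rewrite mulSn [n + _]addnC ltn_add2l.
  by rewrite leq_mul2r ltn_ord orbT.
rewrite /encode add1n /= nth_cat size_matrix lt.
have := @nth_allpairs _ _ (fun u v => nat_of_bool (e u v)) u 0 (enum 'I_n) (enum 'I_n) u v.
by rewrite !size_enum_ord !nth_ord_enum => ->.
Qed.

Lemma nth_encode_digit j : j < up_log 2 k.+1 ->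
  nth 0 (encode e k) (n * n + 1 + j) = k %/ 2 ^ j %% 2.
Proof.
move=> jl; rewrite /encode addn1 addSn /= nth_cat size_matrix ltnNge leq_addr /= addKn.
by rewrite nth_rcons size_mkseq jl nth_mkseq.
Qed.

Lemma nth_encode_end : nth 0 (encode e k) (n * n + 1 + up_log 2 k.+1) = 2.
Proof.
rewrite /encode addn1 addSn /= nth_cat size_matrix ltnNge leq_addr /= addKn.
by rewrite nth_rcons size_mkseq ltnn eqxx.
Qed.

Lemma encode_le j : nth 0 (encode e k) j <= maxn 2 n.
Proof.
have [lt|ge] := ltnP j (size (encode e k)); last by rewrite nth_default.
suff /allP : all (fun x => x <= maxn 2 n) (encode e k) by apply; apply: mem_nth.
rewrite /= leq_maxr /= all_cat all_rcons; apply/and3P; split; last first.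
- by apply/allP => x /mapP[q _ ->]; rewrite modn2 leq_max; case: odd.
- by rewrite leq_max.
- by apply/allP => x /allpairsP[[u v] /= [_ _ ->]]; rewrite leq_max; case: (e u v).
Qed.

End Encoding.

(** Rounding the logarithm down loses at most a factor 2, and doubling the positive exponent
    compensates for it. *)
Lemma leq_word n : maxn 2 n ^ 20 <= 2 ^ (40 * log2 n).
Proof.
have -> : 40 * log2 n = (2 * log2 n) * 20 by lia.
rewrite expnM leq_exp2r // mulSn mul1n expnD.
have /andP[_ lt] : 2 ^ log2 n <= maxn 2 n < 2 ^ (log2 n).+1.
  by apply: trunc_log_bounds => //; apply: leq_trans (leq_maxl _ _).
apply: leq_trans (ltnW lt) _; rewrite expnS leq_mul2r; apply/orP; right.
have : 0 < log2 n by rewrite trunc_log_gt0 /= leq_maxl.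
by case: (log2 n) => // m _; rewrite expnS leq_pmulr // expn_gt0.
Qed.

Theorem theorem6 :
  exists (p : cmd) (a b d : nat),
    forall (n k : nat) (e : rel 'I_n),
      symmetric e -> irreflexive e ->
      exists (s t : nat) (ans : bool),
        [/\ runs (a * log2 n) s p (encode e k) [:: nat_of_bool ans] t,
            ans <-> feedback_vertex_set e k,
            s * (a * log2 n) <= b * (maxn 1 k * log2 n)
          & t <= 5 ^ k * maxn 2 n ^ d].
Proof.
(* A word of 40 log n bits holds $N^{20}$, enough for $1000 (n+1)^4$. The memory has 8 + 64 + 4 (2k
   + 2) = 80 + 8k words, at most 88 max(1, k), and 3520 = 40 * 88. The time needs exponent 3 + 12 *
   32 = 387, which is below 400. *)
exists fvs_program, 40, 3520, 400 => n k e e_sym e_irr.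
set w := 40 * log2 n; set inp := encode e k; set N := maxn 2 n.
have N2 : 2 <= N by apply: leq_maxl.
have nN : n <= N by apply: leq_maxr.
have Nw : N ^ 20 <= 2 ^ w by apply: leq_word.
have w_pos : 0 < log2 n by rewrite trunc_log_gt0 /= leq_maxl.
have pow_le i j : i <= j -> N ^ i <= N ^ j by apply: leq_pexp2l; apply: ltnW.
have c1000 : 1000 <= N ^ 10.
  by apply: (@leq_trans (2 ^ 10)) => //; rewrite leq_exp2r.
have n1N : n.+1 <= N ^ 2.
  by rewrite expnS expn1; apply: (@leq_trans (N + N)); [lia | rewrite addnn -muln2 mulnC leq_mul2r N2 orbT].
have M_sq : 1000 * (n.+1 * n.+1) <= 2 ^ w.
  apply: leq_trans Nw; apply: (@leq_trans (N ^ 10 * (N ^ 2 * N ^ 2))).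
    by rewrite !leq_mul.
  by rewrite - !expnD pow_le.
have M_four : 1000 * (n.+1 * n.+1 * n.+1 * n.+1) <= 2 ^ w.
  apply: leq_trans Nw; apply: (@leq_trans (N ^ 10 * (N ^ 2 * N ^ 2 * N ^ 2 * N ^ 2))).
    by rewrite !leq_mul.
  by rewrite - !expnD pow_le.
have inp_lt j : nth 0 inp j < 2 ^ w.
  apply: leq_ltn_trans (encode_le k e j) _; apply: leq_trans Nw.
  by rewrite -/N -[X in X < _]expn1 ltn_exp2l.
have G_le : 1000 * n.+1 <= N ^ 12 by rewrite (expnD _ 10 2) leq_mul.
have in_digit := @nth_encode_digit n k e.
have in_end := nth_encode_end k e.
pose body := rN <- Inp $0 ;; read_parameter ;; ifs (#rK <! #rN) compression (45 <- $1).
pose post (h : Defs.mem) := exists2 ans : bool, h 45 = ans & ans <-> feedback_vertex_set e k.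
have finish s B : stack + 45 < s -> hwp w s inp body post B (fun=> 0) ->
    exists t (ans : bool), [/\ t <= B + 1, runs w s fvs_program inp [:: nat_of_bool ans] t &
      ans <-> feedback_vertex_set e k].
  move=> s45 H; have [||m' [t [h' [ex tB _ mE [ans hE ansP]]]]] := H (fun=> 0) => //.
    by move=> j; rewrite expn_gt0.
  exists (t + 1), ans; split=> //; first by rewrite leq_add2r.
  exists m'; rewrite -hE -mE; apply: (@ExecSeq _ _ _ _ _ _ m' _ [::]) => //.
  exact: ExecWrite.
(* Both cases share the reading of the input. For k at least n the premise on [compression] is
   vacuous, so the registers alone suffice as memory. *)
have front s B : s <= 2 ^ w -> stack + regs <= s ->
    (forall h, h rN = n -> h rK < n -> h rK = k -> (forall q j, h (addr q j) = 0) ->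
      hwp w s inp compression post B h) ->
    (n <= k -> feedback_vertex_set e k) ->
    hwp w s inp body post (1000 * n.+1 + B + 100) (fun=> 0).
  move=> s_le s_ge Hc Hnk; have M1 : 1000 <= 2 ^ w by apply: leq_trans M_sq; rewrite leq_pmulr.
  eapply hwp_time.
    apply: hwp_seq; apply: (hwp_asg M1 s_le s_ge inp_lt) => //=.
    apply: hwp_seq; apply: hwp_conseq (leqnn _).
      exact: (read_parameter_spec M_sq s_le s_ge inp_lt in_digit in_end (h := upd (fun=> 0) rN n)).
    move=> h [hn fr hk].
    apply: (hwp_ifs (B1 := B) M1 s_le s_ge inp_lt) => //; rewrite /= hn => cond.
    + have {}cond : h rK < n by move: cond; case: (_ < _).
      apply: Hc => //; first by case: hk => [//|[_ hk]]; rewrite hk ltnn in cond.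
      move=> q j; have := regs_addr q j; rewrite /regs => lt; rewrite fr; last by lia.
      by rewrite upd_neq // eq_sym addr_reg.
    + apply: (hwp_asg M1 s_le s_ge inp_lt) => //=; exists true => //; split=> // _; apply: Hnk.
      case: hk => [<-|[]//]; rewrite leqNgt; by move: cond; case: (_ < _).
  rewrite /=; clear; lia.
(* The surplus factor 5 of $5^{k+1}$ goes into $N^3$; the exponent 32 is the 31 of
   [compression_spec] plus one for reading the input and writing the answer. *)
have t_le A : A <= 5 ^ k.+1 * (1000 * n.+1) ^ 32 -> A <= 5 ^ k * N ^ 400.
  move=> AA; apply: (leq_trans AA).
  rewrite expnSr -mulnA leq_mul2l; apply/orP; right.
  apply: (@leq_trans (N ^ 3 * (N ^ 12) ^ 32)); last by rewrite -expnM -expnD pow_le.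
  by rewrite leq_mul // ?leq_exp2r //; apply: (@leq_trans (2 ^ 3)); rewrite // leq_exp2r.
have G1 : 1000 <= 1000 * n.+1 by rewrite leq_pmulr.
have P5 : 5 <= 5 ^ k.+1 by rewrite expnS leq_pmulr // expn_gt0.
have [kn|nk] := ltnP k n; last first.
  (* With k at least n all vertices may be deleted. *)
  have fvs : feedback_vertex_set e k.
    exists setT; rewrite cardsT card_ord; split=> //.
    by apply/forestP; rewrite setCT; apply: acyclic0.
  have s_ok : stack + regs <= 2 ^ w by apply: leq_trans M_sq; apply: (@leq_trans 1000); rewrite ?leq_pmulr.
  have [//|t [ans [tB run ansP]]] := finish (stack + regs) (1000 * n.+1 + 0 + 100) isT.
    apply: front => // h _ lt hk; move: nk; rewrite -hk leqNgt lt.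
    by [].
  exists (stack + regs), t, ans; split=> //.
  + rewrite /w !mulnA leq_mul2r; apply/orP; right.
    by move: (leq_maxl 1 k); rewrite /stack /regs; clear; lia.
  + apply: t_le; apply: (leq_trans tB); rewrite [_ ^ 32]expnS.
    set X := _ ^ 31; have X0 : 0 < X by rewrite expn_gt0.
    have H1 := leq_pmulr (1000 * n.+1) X0.
    apply: leq_trans (leq_mul P5 (leqnn _)).
    by move: (1000 * n.+1) (1000 * n.+1 * X) G1 H1; clear; lia.
have [n' nE] : exists n', n = n'.+1 by case: (n) kn => // n' _; exists n'.
subst n; pose s := stack + regs + 4 * k.*2.+2.
have s_le : s <= 2 ^ w.
  apply: leq_trans M_sq; apply: (@leq_trans (1000 * n'.+2)); last by rewrite leq_mul2l leq_pmulr.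
  by move: kn; rewrite /s /stack /regs; clear; lia.
have [||t [ans [tB run ansP]]] := finish s (1000 * n'.+2 + 5 ^ k.+1 * (1000 * n'.+2) ^ 31 + 100).
- by rewrite /s /stack /regs; lia.
- apply: (front s _ s_le (leq_addr _ _)).
    move=> h hn _ hk h0; apply: hwp_conseq (leqnn _).
      apply: (compression_spec kn M_four (erefl s) inp_lt (nth_encode_adj k e) e_sym e_irr hn hk).
      by move=> j _; rewrite h0 nth_nil.
    move=> h' [ans hE ansP]; exists ans => //; rewrite ansP.
    by split=> -[S [cS fS]]; exists S; split=> //; apply/forestP.
  by rewrite leqNgt kn.
exists s, t, ans; split=> //.
- rewrite /w !mulnA leq_mul2r; apply/orP; right.
  by move: (leq_maxl 1 k) (leq_maxr 1 k); rewrite /s /stack /regs; clear; lia.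
- apply: t_le; apply: (leq_trans tB); rewrite [_ ^ 32]expnS mulnCA.
  set X := _ ^ 31; have X0 : 0 < X by rewrite expn_gt0.
  have Y5 : 5 <= 5 ^ k.+1 * X by apply: leq_trans P5 (leq_pmulr _ X0).
  have := leq_mul G1 (leqnn (5 ^ k.+1 * X)); have := leq_mul (leqnn (1000 * n'.+2)) Y5.
  move: (1000 * n'.+2) (5 ^ k.+1 * X) Y5 G1 => g Y; clear => Y5 G1.
  by move: (g * Y) => Z; lia.
Qed.
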